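(* Let $k$ be an algebraic number field of degree $d$ over $\mathbb{Q}$ with $r$ real places, $s$ complex places, and discriminant $\Delta_k$, and put $c_k = (2/\pi)^{s/d} |\Delta_k|^{1/(2d)}$. Let $P$ be a finite set of rational primes such that for each $p \in P$ there is a non-archimedean place $v$ of $k$ with $v \mid p$ and residue class degree $f_v(k/\mathbb{Q}) = 1$. Let $S$ be a set of non-archimedean places of $k$ containing exactly one place $v$ above each $p \in P$, each such $v$ having $f_v(k/\mathbb{Q}) = 1$ (and no other places). Assume $$c_k < \Bigl(\prod_{p \in P} p\Bigr)^{1/d}.$$ Let $\alpha$ be any nonzero element of $k$ satisfying: $|\alpha|_v < 1$ for every archimedean place $v$; $|\alpha|_v \le 1$ for every non-archimedean place $v \notin S$; and $|\alpha|_v \le |\pi_v|_v^{-1}$ for every $v \in S$, where $\pi_v$ is a uniformizer of the completion $k_v$ (so $|\pi_v|_v^{-1} = p^{1/d}$ if $v \mid p$). (Such $\alpha$ exist.) Then $$\mathbb{Q}(\alpha) = k \quad\text{and}\quad H(\alpha) \le \Bigl(\prod_{p\in P} p\Bigr)^{1/d}.$$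
   Context: For each place $v$ of $k$, $\|\cdot\|_v$ is the absolute value on the completion $k_v$ extending the usual archimedean or $p$-adic absolute value on $\mathbb{Q}$, $d_v = [k_v:\mathbb{Q}_v]$ is the local degree, and $|\cdot|_v = \|\cdot\|_v^{d_v/d}$. For a non-archimedean place $v$, $f_v(k/\mathbb{Q})$ is its residue class degree (the residue degree of the corresponding prime ideal of the ring of integers of $k$). $H(\alpha) = \prod_v \max\{1, |\alpha|_v\}$ is the absolute multiplicative Weil height (product over all places of $k$). *)

(* Defs.v *)
From HB Require Import structures.
From mathcomp Require Import all_boot all_order all_algebra all_field.
From mathcomp Require Import all_classical all_reals all_analysis.
From mathcomp Require Import generic_quotient ring_quotient complex finmap ring lra.
Set Implicit Arguments.
Unset Strict Implicit.
Unset Printing Implicit Defensive.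
Import Order.TTheory GRing.Theory Num.Theory.
Import numFieldNormedType.Exports.
Local Open Scope classical_set_scope.
Local Open Scope ring_scope.

Record absval (R : realType) (F : fieldType) := AbsVal {
  av :> F -> R;
  av_ge0 : forall x, 0 <= av x;
  av_eq0 : forall x, (av x == 0) = (x == 0);
  avM : forall x y, av (x * y) = av x * av y;
  av_triangle : forall x y, av (x + y) <= av x + av y }.

Section AbsValTheory.
Context {R : realType} {F : fieldType} (N : absval R F).

Definition av_cauchy (u : nat -> F) := forall e : R, 0 < e ->
  exists n0 : nat, forall m n, (n0 <= m)%N -> (n0 <= n)%N -> N (u m - u n) < e.

Definition av_null (u : nat -> F) := forall e : R, 0 < e ->
  exists n0 : nat, forall n, (n0 <= n)%N -> N (u n) < e.

Lemma av0 : N 0 = 0. Proof. by apply/eqP; rewrite av_eq0. Qed.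

Lemma av1 : N 1 = 1.
Proof.
have N1 : N 1 != 0 by rewrite av_eq0 oner_eq0.
by apply: (mulfI N1); rewrite -avM !mulr1.
Qed.

Lemma avN x : N (- x) = N x.
Proof.
have NN1 : N (-1) = 1.
  have : N (-1) ^+ 2 = 1 by rewrite expr2 -avM mulrNN mulr1 av1.
  by move/eqP; rewrite sqrp_eq1 ?av_ge0// => /eqP.
by rewrite -mulN1r avM NN1 mul1r.
Qed.

Lemma av_distC x y : N (x - y) = N (y - x).
Proof. by rewrite -avN opprB. Qed.

Lemma av_split y x z : N (x - z) <= N (x - y) + N (y - z).
Proof. by have -> : x - z = (x - y) + (y - z); [ring|exact: av_triangle]. Qed.

Lemma av_dist_dist x y : `|N x - N y| <= N (x - y).
Proof.
have h a b : N a <= N b + N (a - b) by rewrite -{1}[a](subrKC b) av_triangle.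
by rewrite ler_norml; move: (h x y) (h y x); rewrite (av_distC y); lra.
Qed.

Lemma avV x : N x^-1 = (N x)^-1.
Proof.
have [->|x0] := eqVneq x 0; first by rewrite invr0 av0 invr0.
have Nx0 : N x != 0 by rewrite av_eq0.
by apply: (mulfI Nx0); rewrite -avM !divff// av1.
Qed.

Lemma av_cauchy_const x : av_cauchy (fun=> x).
Proof. by move=> e e0; exists 0%N => *; rewrite subrr av0. Qed.

Lemma av_cauchy_bounded u : av_cauchy u -> exists2 B : R, 0 < B & forall n, N (u n) <= B.
Proof.
move=> /(_ 1 ltr01)[n0 hn0].
exists (1 + N (u n0) + \sum_(i < n0) N (u i)).
  by rewrite -addrA ltr_wpDr// addr_ge0 ?av_ge0// sumr_ge0// => *; apply: av_ge0.
move=> n; have [n_lt|n_ge] := ltnP n n0.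
  rewrite (bigD1 (Ordinal n_lt))//=.
  have h : 0 <= \sum_(i < n0 | i != Ordinal n_lt) N (u i).
    by rewrite sumr_ge0// => *; apply: av_ge0.
  by have := av_ge0 N (u n0); lra.
have h : 0 <= \sum_(i < n0) N (u i) by rewrite sumr_ge0// => *; apply: av_ge0.
have := hn0 n n0 n_ge (leqnn _).
have := av_triangle N (u n - u n0) (u n0); rewrite subrK; lra.
Qed.

Lemma av_cauchyB u v : av_cauchy u -> av_cauchy v -> av_cauchy (u - v).
Proof.
move=> cu cv e e0; have e20 : 0 < e / 2 by lra.
have [n1 h1] := cu _ e20; have [n2 h2] := cv _ e20.
exists (maxn n1 n2) => m n; rewrite !geq_max => /andP[m1 m2] /andP[n1' n2'].
have -> : (u - v) m - (u - v) n = (u m - u n) + - (v m - v n) by rewrite !fctE; ring.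
by have := av_triangle N (u m - u n) (- (v m - v n)); rewrite avN;
  have := h1 _ _ m1 n1'; have := h2 _ _ m2 n2'; lra.
Qed.

Lemma av_cauchyM u v : av_cauchy u -> av_cauchy v -> av_cauchy (u * v).
Proof.
move=> cu cv e e0.
have [B B0 hB] := av_cauchy_bounded cu; have [C C0 hC] := av_cauchy_bounded cv.
have e1 : 0 < e / 2 / C by rewrite !divr_gt0.
have e2 : 0 < e / 2 / B by rewrite !divr_gt0.
have [n1 h1] := cu _ e1; have [n2 h2] := cv _ e2.
exists (maxn n1 n2) => m n; rewrite !geq_max => /andP[m1 m2] /andP[n1' n2'].
have -> : (u * v) m - (u * v) n = (u m - u n) * v m + u n * (v m - v n).
  by rewrite !fctE; ring.
apply: (le_lt_trans (av_triangle _ _ _)); rewrite !avM.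
have l1 : N (u m - u n) * N (v m) < e / 2.
  apply: (@le_lt_trans _ _ (N (u m - u n) * C)); first by rewrite ler_wpM2l ?av_ge0.
  by rewrite -ltr_pdivlMr// h1.
have l2 : N (u n) * N (v m - v n) < e / 2.
  apply: (@le_lt_trans _ _ (B * N (v m - v n))); first by rewrite ler_wpM2r ?av_ge0.
  by rewrite mulrC -ltr_pdivlMr// h2.
by lra.
Qed.

Lemma av_null_cauchy u : av_null u -> av_cauchy u.
Proof.
move=> nu e e0; have e20 : 0 < e / 2 by lra.
have [n0 h] := nu _ e20; exists n0 => m n m0 nn0.
by have := av_triangle N (u m) (- u n); rewrite avN;
  have := h _ m0; have := h _ nn0; lra.
Qed.

Lemma av_nullD u v : av_null u -> av_null v -> av_null (u + v).
Proof.
move=> cu cv e e0; have e20 : 0 < e / 2 by lra.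
have [n1 h1] := cu _ e20; have [n2 h2] := cv _ e20.
exists (maxn n1 n2) => n; rewrite !geq_max => /andP[m1 m2].
by have := av_triangle N (u n) (v n); have := h1 _ m1; have := h2 _ m2;
  rewrite !fctE; lra.
Qed.

Lemma av_nullM u v : av_cauchy u -> av_null v -> av_null (u * v).
Proof.
move=> cu nv e e0; have [B B0 hB] := av_cauchy_bounded cu.
have [n0 h] := nv _ (divr_gt0 e0 B0); exists n0 => n n_ge.
rewrite !fctE avM; apply: (@le_lt_trans _ _ (B * N (v n))).
  by rewrite ler_wpM2r ?av_ge0.
by rewrite mulrC -ltr_pdivlMr// h.
Qed.

Lemma av_not_null u : av_cauchy u -> ~ av_null u ->
  exists2 c : R, 0 < c & exists n0 : nat, forall n, (n0 <= n)%N -> c <= N (u n).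
Proof.
move=> cu /existsNP[e /not_implyP[e0 /forallNP he]].
have e20 : 0 < e / 2 by lra.
have [n0 h] := cu _ e20.
exists (e / 2) => //; exists n0 => n nn0.
have /existsNP[m /not_implyP[mn0 /negP]] := he n0; rewrite -leNgt => em.
have := av_triangle N (u m - u n) (u n); rewrite subrK.
by have := h _ _ mn0 nn0; lra.
Qed.

Lemma av_cauchyV u : av_cauchy u -> ~ av_null u -> av_cauchy (fun n => (u n)^-1).
Proof.
move=> cu nu; have [c c0 [n0 hc]] := av_not_null cu nu => e e0.
have [n1 h1] := cu (e * (c * c)) ltac:(by rewrite !mulr_gt0).
exists (maxn n0 n1) => m n; rewrite !geq_max => /andP[m0 m1] /andP[n0' n1'].
have um0 : u m != 0 by rewrite -(av_eq0 N) gt_eqF// (lt_le_trans c0)// hc.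
have un0 : u n != 0 by rewrite -(av_eq0 N) gt_eqF// (lt_le_trans c0)// hc.
have -> : (u m)^-1 - (u n)^-1 = (u n - u m) * (u m * u n)^-1.
  by field; rewrite um0 un0.
rewrite avM avV avM.
have hcc : c * c <= N (u m) * N (u n) by rewrite ler_pM ?hc// ltW.
rewrite ltr_pdivrMr; last by rewrite (lt_le_trans _ hcc)// mulr_gt0.
by apply: (lt_le_trans (h1 _ _ n1' m1)); rewrite ler_wpM2l// ltW.
Qed.

Definition cauchyp : pred (nat -> F) := fun u => `[< av_cauchy u >].

Lemma cauchyp_closed : subring_closed cauchyp.
Proof.
split.
- by apply/asboolP; apply: av_cauchy_const.
- by move=> u v /asboolP cu /asboolP cv; apply/asboolP; apply: av_cauchyB.
- by move=> u v /asboolP cu /asboolP cv; apply/asboolP; apply: av_cauchyM.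
Qed.

HB.instance Definition _ := GRing.isSubringClosed.Build (nat -> F) cauchyp cauchyp_closed.

Record cauchy_seq := CauchySeq { cauchy_val :> nat -> F; _ : cauchyp cauchy_val }.

HB.instance Definition _ := [isSub for cauchy_val].
HB.instance Definition _ := [Choice of cauchy_seq by <:].
HB.instance Definition _ := [SubChoice_isSubComNzRing of cauchy_seq by <:].

Lemma cauchy_seqP (u : cauchy_seq) : av_cauchy u.
Proof. by case: u => u /= /asboolP. Qed.

Definition nullp : cauchy_seq -> bool := fun u => `[< av_null u >].

Lemma nullp_closed : idealr_closed nullp.
Proof.
split.
- by apply/asboolP => e e0; exists 0%N => n _ /=; rewrite av0.
- apply/negP => /asboolP /(_ 1 ltr01)[n /(_ n (leqnn _))] /=.
  by rewrite av1 ltxx.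
- move=> a u v /asboolP nu /asboolP nv; apply/asboolP.
  by apply: av_nullD => //; apply: av_nullM => //; apply: cauchy_seqP.
Qed.

HB.instance Definition _ := isIdealr.Build cauchy_seq nullp nullp_closed.

Definition null_ideal : idealr cauchy_seq := nullp.
Definition completion_field := {ideal_quot null_ideal}.
HB.instance Definition _ := GRing.ComNzRing.on completion_field.

Definition mkcf (u : cauchy_seq) : completion_field := \pi_({ideal_quot null_ideal})%qT u.

Lemma mkcf_is_zmod_morphism : zmod_morphism mkcf.
Proof. by move=> u v; rewrite /mkcf rmorphB. Qed.
Lemma mkcf_is_monoid_morphism : monoid_morphism mkcf.
Proof. by split=> [|u v]; rewrite /mkcf ?rmorph1 ?rmorphM. Qed.
HB.instance Definition _ := GRing.isZmodMorphism.Build _ _ mkcf mkcf_is_zmod_morphism.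
HB.instance Definition _ := GRing.isMonoidMorphism.Build _ _ mkcf mkcf_is_monoid_morphism.

Lemma mkcfK (x : completion_field) : mkcf (repr x) = x.
Proof. exact: reprK. Qed.

Lemma mkcf_surj x : exists u, x = mkcf u.
Proof. by exists (repr x); rewrite mkcfK. Qed.

Lemma mkcf_eq0 (u : cauchy_seq) : (mkcf u == 0) = `[< av_null u >].
Proof.
rewrite -(rmorph0 mkcf) /mkcf.
by have := Quotient.idealrBE null_ideal u 0; rewrite subr0 => <-.
Qed.

Lemma cf_inverse (x : completion_field) : exists y : completion_field,
  x != 0 -> y * x = 1.
Proof.
have [u ->] := mkcf_surj x; rewrite mkcf_eq0.
case: asboolP => [nu|nu]; first by exists 0.
have cv : cauchyp (fun n => (u n)^-1).
  by apply/asboolP/av_cauchyV => //; apply: cauchy_seqP.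
exists (mkcf (CauchySeq cv)) => _; apply/eqP; rewrite -subr_eq0.
rewrite -(rmorph1 mkcf) -rmorphM -rmorphB mkcf_eq0; apply/asboolP => e e0.
have [c c0 [n0 hc]] := av_not_null (@cauchy_seqP u) nu.
exists n0 => n nn0; change (N ((u n)^-1 * u n - 1) < e); rewrite mulVf ?subrr ?av0//.
by rewrite -(av_eq0 N) gt_eqF// (lt_le_trans c0)// hc.
Qed.

Definition cf_inv (x : completion_field) : completion_field :=
  if x == 0 then 0 else sval (cid (cf_inverse x)).

Lemma cf_mulVf x : x != 0 -> cf_inv x * x = 1.
Proof.
by move=> x0; rewrite /cf_inv ifN//; case: cid => y /= /(_ x0).
Qed.

Lemma cf_inv0 : cf_inv 0 = 0. Proof. by rewrite /cf_inv ifT. Qed.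

HB.instance Definition _ := GRing.ComNzRing_isField.Build completion_field
  cf_mulVf cf_inv0.

(* The limit of N (u n) depends only on the class of u. *)
Definition cf_av (x : completion_field) : R := limn (fun n => N (repr x n)).

Lemma av_cauchy_cvg u : av_cauchy u -> cvgn (fun n => N (u n)).
Proof.
move=> cu; apply/cauchy_cvgP/cauchy_exP => e e0.
have [n0 h] := cu _ e0; exists (N (u n0)); exists n0 => // n /= n0n.
rewrite /ball/=; apply: le_lt_trans (av_dist_dist _ _) _.
exact: h.
Qed.

Lemma av_cauchy_distcvg u v : av_cauchy u -> av_cauchy v -> av_null (u - v) ->
  limn (fun n => N (u n)) = limn (fun n => N (v n)).
Proof.
move=> cu cv nuv; apply/eqP; rewrite -subr_eq0.
rewrite -limB; [|exact: av_cauchy_cvg..].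
apply/eqP/cvg_lim => //; apply/cvgrPdist_lt => e /nuv[n0 h].
exists n0 => // n /= n0n; rewrite sub0r normrN.
by apply: le_lt_trans (av_dist_dist _ _) (h _ n0n).
Qed.

Lemma cf_avE (u : cauchy_seq) : cf_av (mkcf u) = limn (fun n => N (u n)).
Proof.
rewrite /cf_av; apply: av_cauchy_distcvg; [exact: cauchy_seqP..|].
apply/asboolP; rewrite -(mkcf_eq0 (repr (mkcf u) - u)) rmorphB.
by rewrite /= mkcfK subrr.
Qed.

Lemma cf_av_ge0 x : 0 <= cf_av x.
Proof.
have [u ->] := mkcf_surj x; rewrite cf_avE.
apply: limr_ge; first by apply/av_cauchy_cvg/cauchy_seqP.
by apply: nearW => n; apply: av_ge0.
Qed.

Lemma cf_av_eq0 x : (cf_av x == 0) = (x == 0).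
Proof.
have [u ->] := mkcf_surj x; rewrite cf_avE mkcf_eq0.
have cu := av_cauchy_cvg (@cauchy_seqP u).
apply/eqP/asboolP => [l0 e e0|nu].
  move: cu => /[!l0] /cvgrPdist_lt/(_ e e0)[n0 _ h]; exists n0 => n n0n.
  by have := h n n0n; rewrite /= sub0r normrN ger0_norm ?av_ge0.
apply/cvg_lim => //; apply/cvgrPdist_lt => e /nu[n0 h].
by exists n0 => // n /= n0n; rewrite sub0r normrN ger0_norm ?av_ge0 ?h.
Qed.

Lemma cf_avM x y : cf_av (x * y) = cf_av x * cf_av y.
Proof.
have [u ->] := mkcf_surj x; have [v ->] := mkcf_surj y.
rewrite -rmorphM !cf_avE -limM; [|exact/av_cauchy_cvg/cauchy_seqP..].
by congr (limn _); apply/funext => n; apply: avM.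
Qed.

Lemma cf_av_triangle x y : cf_av (x + y) <= cf_av x + cf_av y.
Proof.
have [u ->] := mkcf_surj x; have [v ->] := mkcf_surj y.
have cu := av_cauchy_cvg (@cauchy_seqP u).
have cv := av_cauchy_cvg (@cauchy_seqP v).
rewrite -rmorphD !cf_avE -limD//.
apply: ler_lim; [exact/av_cauchy_cvg/cauchy_seqP|exact: is_cvgD|].
by apply: nearW => n; apply: av_triangle.
Qed.

Definition cf_absval : absval R completion_field :=
  AbsVal cf_av_ge0 cf_av_eq0 cf_avM cf_av_triangle.

Definition const_seq x : cauchy_seq :=
  @CauchySeq (fun=> x) (asboolT (av_cauchy_const x)).

Definition cf_emb x : completion_field := mkcf (const_seq x).

Lemma cf_emb_is_zmod_morphism : zmod_morphism cf_emb.
Proof. by move=> x y; rewrite /cf_emb -rmorphB; congr mkcf; apply/val_inj. Qed.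
Lemma cf_emb_is_monoid_morphism : monoid_morphism cf_emb.
Proof.
split=> [|x y]; first by rewrite -(rmorph1 mkcf); congr mkcf; apply/val_inj.
by rewrite /cf_emb -rmorphM; congr mkcf; apply/val_inj.
Qed.
HB.instance Definition _ := GRing.isZmodMorphism.Build _ _ cf_emb cf_emb_is_zmod_morphism.
HB.instance Definition _ := GRing.isMonoidMorphism.Build _ _ cf_emb cf_emb_is_monoid_morphism.

Lemma cf_embE x : cf_absval (cf_emb x) = N x.
Proof. rewrite /= cf_avE; apply/cvg_lim => //.
by rewrite [X in X @ _](_ : _ = fun=> N x); first exact: cvg_cst. Qed.

Lemma cf_approx (u : cauchy_seq) e : 0 < e ->
  exists n0 : nat, forall n, (n0 <= n)%N -> cf_av (mkcf u - cf_emb (u n)) < e.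
Proof.
move=> e0; have e20 : 0 < e / 2 by lra.
have [n0 h] := @cauchy_seqP u _ e20; exists n0 => n n0n.
rewrite -rmorphB cf_avE; apply: (@le_lt_trans _ _ (e / 2)); last by lra.
apply: limr_le; first exact/av_cauchy_cvg/cauchy_seqP.
by exists n0 => // m /= n0m; apply: ltW; apply: h.
Qed.

Lemma cf_dense (y : completion_field) e : 0 < e -> exists x, cf_absval (y - cf_emb x) < e.
Proof.
move=> e0; have [u ->] := mkcf_surj y; have [n h] := cf_approx u e0.
by exists (u n); apply: h.
Qed.

End AbsValTheory.

Section Completion.
Context {R : realType} {F : fieldType} (N : absval R F).

(* The completion of (F, N) is unique up to isometric isomorphism;
   completion_of below is the one by Cauchy sequences modulo null sequences. *)
Record completion := Completion {
  comp_field :> fieldType;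
  comp_av : absval R comp_field;
  comp_emb : {rmorphism F -> comp_field};
  comp_embE : forall x, comp_av (comp_emb x) = N x;
  comp_dense : forall (y : comp_field) (e : R), 0 < e ->
    exists x, comp_av (y - comp_emb x) < e;
  comp_complete : forall u : nat -> comp_field, av_cauchy comp_av u ->
    exists l, av_null comp_av (fun n => u n - l) }.

Lemma cf_complete (u : nat -> completion_field N) : av_cauchy (cf_absval N) u ->
    exists l, av_null (cf_absval N) (fun n => u n - l).
Proof.
move=> cu.
have /choice[f hf] : forall n, exists x, cf_absval N (u n - cf_emb N x) < n.+1%:R^-1.
  by move=> n; apply: cf_dense; rewrite invr_gt0.
have inv_small (e : R) : 0 < e -> exists n0 : nat, forall n, (n0 <= n)%N -> n.+1%:R^-1 < e.
  move=> e0; have [n0 h] := ltr_add_invr (ltac:(by rewrite e0) : 0 < e).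
  exists n0 => n n0n; apply: le_lt_trans (_ : n0.+1%:R^-1 < _); last by move: h; rewrite add0r.
  by rewrite lef_pV2 ?posrE// ler_nat ltnS.
have cf : av_cauchy N f.
  move=> e e0; have e30 : 0 < e / 3 by lra.
  have [n1 h1] := cu _ e30; have [n2 h2] := inv_small _ e30.
  exists (maxn n1 n2) => m n; rewrite !geq_max => /andP[m1 m2] /andP[n1' n2'].
  have -> : N (f m - f n) = cf_absval N (cf_emb N (f m) - cf_emb N (f n)).
    by rewrite -(cf_embE N) rmorphB.
  have := av_split (cf_absval N) (u m) (cf_emb N (f m)) (cf_emb N (f n)).
  have := av_split (cf_absval N) (u n) (u m) (cf_emb N (f n)).
  rewrite (av_distC (cf_absval N) (cf_emb N (f m)) (u m)).
  move: (hf m) (hf n) (h2 _ m2) (h2 _ n2') (h1 _ _ m1 n1').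
  move=> a1 a2 a3 a4 a5 a6 a7; apply: (le_lt_trans a7).
  have b1 := lt_trans a1 a3; have b2 := lt_trans a2 a4.
  have b3 := le_lt_trans a6 (ltrD a5 b2).
  by apply: (lt_le_trans (ltrD b1 b3)); lra.
pose v := CauchySeq (asboolT cf : cauchyp N f).
exists (mkcf v) => e e0; have e20 : 0 < e / 2 by lra.
have [n1 h1] := cf_approx v e20; have [n2 h2] := inv_small _ e20.
exists (maxn n1 n2) => n; rewrite geq_max => /andP[n1n n2n].
move: (h1 _ n1n) (hf n) (h2 _ n2n) => a1 a2 a3.
apply: le_lt_trans (av_split (cf_absval N) (cf_emb N (f n)) (u n) (mkcf v)) _.
rewrite (av_distC (cf_absval N) _ (mkcf v)).
by apply: (lt_le_trans (ltrD (lt_trans a2 a3) a1)); lra.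
Qed.

Definition completion_of : completion :=
  @Completion (completion_field N) (cf_absval N) (@cf_emb R F N)
    (@cf_embE R F N) (@cf_dense R F N) cf_complete.

End Completion.

(* |q|_p = p^(-ord_p q); prime p is assumed wherever this is used. *)
Definition padic_abs (R : realType) (p : nat) (q : rat) : R :=
  if q == 0 then 0 else
  p%:R ^ ((logn p `|denq q|)%:Z - (logn p `|numq q|)%:Z).

Section NumberField.
Context {R : realType} {k : fieldExtType rat}.

Definition archimedean (v : absval R k) :=
  forall q : rat, v q%:A = `|ratr q|.

Definition lies_over (v : absval R k) (p : nat) :=
  prime p /\ forall q : rat, v q%:A = padic_abs R p q.

Definition nonarchimedean (v : absval R k) := exists p, lies_over v p.

End NumberField.

(* Every class of nontrivial absolute values on k contains exactly one whose
   restriction to Q is the usual or a p-adic absolute value; a place is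
   represented by this normalized member ||.||_v of its class. *)
Record place (R : realType) (k : fieldExtType rat) := Place {
  place_absval :> absval R k;
  place_normalized : archimedean place_absval \/ nonarchimedean place_absval }.

HB.instance Definition _ R k := gen_eqMixin (place R k).
HB.instance Definition _ R k := gen_choiceMixin (place R k).

Section Places.
Context {R : realType} {k : fieldExtType rat}.
Implicit Types (v : place R k) (x : k).

Definition real_place v :=
  archimedean v /\
  exists sigma : {rmorphism k -> R}, forall x, v x = `|sigma x|.

Definition complex_place v :=
  archimedean v /\
  exists sigma : {rmorphism k -> R[i]},
    (forall x, (v x)%:C%C = `|sigma x|) /\ exists x, complex.Im (sigma x) != 0.

Definition compl v : completion v := completion_of v.

(* Q_v, as the topological closure of Q in k_v *)
Definition compl_rat v : set (compl v) :=
  [set y | forall e : R, 0 < e ->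
     exists q : rat, comp_av (compl v) (y - comp_emb (compl v) q%:A) < e].

Definition basis_over (K : fieldType) (A : set K) n (b : 'I_n -> K) :=
  forall y : K, exists! c : {ffun 'I_n -> K},
    (forall i, A (c i)) /\ y = \sum_i c i * b i.

(* d_v = [k_v : Q_v]; the default value 0 is not attained. *)
Definition local_degree v : nat :=
  xget 0%N [set n : nat | exists b : 'I_n -> compl v, basis_over (@compl_rat v) b].

(* |y|_v = ||y||_v^(d_v / d) on k_v, and its restriction to k *)
Definition abs_compl v (y : compl v) : R :=
  comp_av (compl v) y `^ ((local_degree v)%:R / (\dim {:k})%:R).

Definition abs_place v x : R := abs_compl (comp_emb (compl v) x).

(* pi generates the maximal ideal of the valuation ring of k_v. *)
Definition uniformizer v (pi : compl v) :=
  forall y : compl v, comp_av (compl v) y < 1 <->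
    exists2 z, comp_av (compl v) z <= 1 & y = pi * z.

(* The product has finite support, as the big operator requires. *)
Definition height x : R :=
  \big[*%R/1]_(v \in [set: place R k]) Num.max 1 (abs_place v x).

Definition alg_integer x := integralOver (intr : int -> k) x.

(* f_v = [O_k/P_v : F_p] for P_v = {x in O_k | ||x||_v < 1}, through an
   F_p-basis of O_k/P_v; F_p is represented by the integers 0, ..., p - 1.
   The default value 0 is not attained at nonarchimedean v. *)
Definition residue_degree v : nat :=
  xget 0%N [set f : nat | exists p, lies_over v p /\
    exists2 b : 'I_f -> k, (forall i, alg_integer (b i)) &
      forall x, alg_integer x ->
        exists! c : {ffun 'I_f -> 'I_p}, v (x - \sum_i (c i)%:R * b i) < 1].

End Places.

Section Discriminant.
Context {k : fieldExtType rat}.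

Definition integral_basis n (w : 'I_n -> k) :=
  (forall i, alg_integer (w i)) /\
  forall x, alg_integer x ->
    exists! c : {ffun 'I_n -> int}, x = \sum_i (c i)%:~R * w i.

Definition field_trace (x : k) : rat := \tr (passmx.mxof (vbasis {:k}) (vbasis {:k}) (amull x)).

End Discriminant.

Definition discriminant (k : fieldExtType rat) : int :=
  xget 0 [set D : int | exists2 w : 'I_(\dim {:k}) -> k, integral_basis w &
    D%:~R = \det (\matrix_(i, j) field_trace (w i * w j))].

(* c_k, where s is the number of complex places of k *)
Definition field_const (R : realType) (k : fieldExtType rat) (s : nat) : R :=
  (2 / trigo.pi) `^ (s%:R / (\dim {:k})%:R) *
  `|(discriminant k)%:~R| `^ (2 * (\dim {:k})%:R)^-1.

Definition admissible (R : realType) (k : fieldExtType rat) (S : set (place R k))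
    (pi_ : forall v : place R k, compl v) (alpha : k) :=
  [/\ alpha != 0,
      forall v : place R k, archimedean v -> abs_place v alpha < 1,
      forall v : place R k, nonarchimedean v -> ~ S v -> abs_place v alpha <= 1 &
      forall v, S v -> abs_place v alpha <= (abs_compl (pi_ v))^-1].

(* Main.v *)
From HB Require Import structures.
Require Import Defs.
From mathcomp Require Import all_boot all_order all_algebra all_field.
From mathcomp Require Import all_classical all_reals all_analysis.
From mathcomp Require Import perm complex finmap ring lra.
Set Implicit Arguments.
Unset Strict Implicit.
Unset Printing Implicit Defensive.
Import Order.TTheory GRing.Theory Num.Theory.
Import numFieldNormedType.Exports.
Local Open Scope classical_set_scope.
Local Open Scope ring_scope.

(** For each p in P choose delta_p in k whose only pole is a simple one at the
    place of S above p, put delta = sum_p delta_p and q = prod_p p.  The lattice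
    O_k + Z delta contains O_k with index q, so the hypothesis on c_k is what
    Minkowski's theorem requires for a nonzero element of it whose conjugates
    all have absolute value < 1: this is an admissible alpha.

    Conversely let alpha be admissible.  Some absolute value of alpha is > 1 (a
    product formula argument, through the determinant of multiplication by
    alpha), necessarily at a place v of S.  There alpha has a simple pole, and
    the residue field is F_p, so Q(alpha) is dense in k at v.  A conjugate over
    Q(alpha) of a primitive element t, other than t, would give a second place
    of k that agrees with v on Q(alpha); it lies above p and has |alpha| > 1, so
    it belongs to S as well, which is excluded.  Hence Q(alpha) = k.  The height
    is bounded factor by factor.

    Absolute values are extended to a finite extension by taking a minimal
    element among the submultiplicative norms below a given one: minimality
    makes it multiplicative, and it can be made to keep the spectral norm of one
    prescribed element. *)

(** * Extension of absolute values *)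

(** The constant c_k is the ratio in Minkowski's theorem. The points all of whose coordinates have
    absolute value < 1 form a body of volume 2^r pi^s, the lattice O_k + Z delta has covolume 2^(-s)
    sqrt|Delta_k| / q, and 2^d times the covolume is below the volume exactly when (2/pi)^s
    sqrt|Delta_k| < q, the d-th power of the hypothesis.

    Places are given as absolute values and not as prime ideals, so neither ideal factorization nor
    the full product formula is used. The determinant of multiplication by alpha is a nonzero
    rational, bounded at each place of Q by a spectral norm of alpha; it is small at infinity, hence
    large at some p. Extending with a prescribed spectral norm turns that bound into an actual
    absolute value of k.

    The condition f_v = 1 enters twice. It makes d_v the ramification index, so that |pi_v|_v^-1 =
    p^(1/d), and it makes natural numbers a complete set of digits, so that expansions in powers of
    alpha^-1 stay in Q(alpha). *)

Section RingNorm.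
Variables (R : realType) (E : fieldType).

Lemma bernoulli_le (x : R) n : 0 <= x -> 1 + n%:R * x <= (1 + x) ^+ n.
Proof.
move=> x0; elim: n => [|n IH]; first by rewrite mul0r addr0 expr0.
rewrite exprS; apply: (@le_trans _ _ ((1 + x) * (1 + n%:R * x))).
  have : 0 <= n%:R * x * x by rewrite mulr_ge0// mulr_ge0.
  by rewrite -natr1; lra.
by rewrite ler_wpM2l//; lra.
Qed.

(** A constant factor disappears on passing to n-th roots, by Bernoulli's inequality. Many sharp
    estimates below come from a crude one for all powers together with this lemma. *)
Lemma ler_of_expM (a C r : R) : 0 < r -> (forall n, a ^+ n <= C * r ^+ n) -> a <= r.
Proof.
move=> r0 h; rewrite leNgt; apply/negP => ra.
pose x := a / r - 1.
have x0 : 0 < x by rewrite /x subr_gt0 ltr_pdivlMr// mul1r.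
have hx n : 1 + n%:R * x <= C.
  apply: (@le_trans _ _ ((a / r) ^+ n)); last first.
    by rewrite expr_div_n ler_pdivrMr ?exprn_gt0.
  have -> : a / r = 1 + x by rewrite /x; lra.
  exact/bernoulli_le/ltW.
have C1 : 1 <= C by have := hx 0%N; rewrite mul0r addr0.
have := archi_boundP (divr_ge0 (le_trans ler01 C1) (ltW x0)).
by rewrite ltr_pdivrMr//; have := hx (Num.bound (C / x)); lra.
Qed.

(** The condition 1 <= N 1 excludes the zero function and passes to infima, so a minimal norm cannot
    collapse to 0. Requiring N 1 = 1 would exclude norms built from a basis. *)
Definition ring_norm (N : E -> R) :=
  [/\ forall x, 0 <= N x, N 0 = 0, 1 <= N 1,
      forall x y, N (x + y) <= N x + N y & forall x y, N (x * y) <= N x * N y].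

Implicit Types (N M : E -> R) (x y : E).

Lemma ring_norm_mulrn N x n : ring_norm N -> N (x *+ n) <= n%:R * N x.
Proof.
case=> _ N0 _ ND _; elim: n => [|n IH]; first by rewrite mulr0n N0 mul0r.
by rewrite mulrS -natr1 mulrDl mul1r addrC; apply: le_trans (ND _ _) _; rewrite lerD2r.
Qed.

Lemma ring_norm_sum N (I : Type) (s : seq I) (F : I -> E) : ring_norm N ->
  N (\sum_(i <- s) F i) <= \sum_(i <- s) N (F i).
Proof.
case=> _ N0 _ ND _; elim/big_rec2: _ => [|i a b _ h]; first by rewrite N0.
by apply: le_trans (ND _ _) _; rewrite lerD2l.
Qed.

Lemma ring_norm_exp N x n : ring_norm N -> N (x ^+ n) <= N 1 * N x ^+ n.
Proof.
case=> Nge0 _ N1 _ NM; elim: n => [|n IH]; first by rewrite !expr0 mulr1.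
rewrite exprS; apply: le_trans (NM _ _) _.
by rewrite exprS mulrCA ler_wpM2l.
Qed.

Lemma ring_norm_sqr1 N : ring_norm N -> (forall x, N (x ^+ 2) = N x ^+ 2) -> N 1 = 1.
Proof.
case=> _ _ N1 _ _ /(_ 1); rewrite expr1n => /esym h.
have N0 : N 1 != 0 by rewrite gt_eqF// (lt_le_trans ltr01).
by apply: (mulfI N0); rewrite mulr1 -expr2.
Qed.

Lemma le_inf_mul (A B : set R) z : A !=set0 -> B !=set0 ->
    (forall a, A a -> 0 <= a) -> (forall b, B b -> 0 <= b) ->
  (forall a b, A a -> B b -> z <= a * b) -> z <= inf A * inf B.
Proof.
move=> A0 B0 Age0 Bge0 h.
have st (C : set R) (a : R) : C !=set0 -> 0 <= a ->
    (forall c, C c -> z <= a * c) -> z <= a * inf C.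
  move=> C0; rewrite le_eqVlt => /predU1P[<-|a0] hC.
    by case: C0 => c /hC; rewrite !mul0r.
  rewrite -ler_pdivrMl//; apply: lb_le_inf => // c /hC.
  by rewrite ler_pdivrMl.
rewrite mulrC; apply: (st A) => //; first exact: lb_le_inf.
by move=> a Aa; rewrite mulrC; apply: (st B) => // [|b Bb]; [exact: Age0|exact: h].
Qed.

Lemma le_inf_add (A B : set R) z : A !=set0 -> B !=set0 ->
  (forall a b, A a -> B b -> z <= a + b) -> z <= inf A + inf B.
Proof.
move=> A0 B0 h; rewrite -lerBlDr; apply: lb_le_inf => // a Aa.
rewrite lerBlDr -lerBlDl; apply: lb_le_inf => // b Bb.
by rewrite lerBlDl h.
Qed.

(** The members [M i] need not be ring norms: each inequality may pass to another index. This covers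
    chains of norms as well as the quotients that define [twisted_norm]. *)
Lemma inf_ring_norm (I : Type) (M : I -> E -> R) (i0 : I) :
    (forall i x, 0 <= M i x) -> (forall i, M i 0 = 0) -> (forall i, 1 <= M i 1) ->
    (forall i j, exists k, forall x y, M k (x + y) <= M i x + M j y) ->
    (forall i j, exists k, forall x y, M k (x * y) <= M i x * M j y) ->
  ring_norm (fun x => inf (range (M^~ x))).
Proof.
move=> Mge0 M0 M1 MD MM.
have ne x : range (M^~ x) !=set0 by exists (M i0 x), i0.
have hlb x : has_lbound (range (M^~ x)) by exists 0 => _ [i _ <-].
have le x i : inf (range (M^~ x)) <= M i x by apply: ge_inf => //; exists i.
split.
- by move=> x; apply: lb_le_inf => // _ [i _ <-].
- apply/eqP; rewrite eq_le -{1}(M0 i0) le/=.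
  by apply: lb_le_inf => // _ [i _ <-].
- by apply: lb_le_inf => // _ [i _ <-].
- move=> x y; apply: le_inf_add => // _ _ [i _ <-] [j _ <-].
  by have [k hk] := MD i j; apply: le_trans (le _ k) _.
- move=> x y; apply: le_inf_mul => // [_ [i _ <-]//|_ [i _ <-]//|].
  move=> _ _ [i _ <-] [j _ <-].
  by have [k hk] := MM i j; apply: le_trans (le _ k) _.
Qed.

Definition exp_bound N x : set R :=
  [set r | 0 < r /\ exists C, forall n, N (x ^+ n) <= C * r ^+ n].

(** This is lim N (x^n)^(1/n), written as the best exponential growth rate of N (x^n) so that no
    limit has to be shown to exist. *)
Definition spectral_norm N x : R := inf (exp_bound N x).

Section Spectral.
Variables (N : E -> R) (HN : ring_norm N).

Let Nge0 x : 0 <= N x. Proof. by case: HN. Qed.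
Let N0 : N 0 = 0. Proof. by case: HN. Qed.
Let N1 : 1 <= N 1. Proof. by case: HN. Qed.
Let NM x y : N (x * y) <= N x * N y. Proof. by case: HN. Qed.

Lemma exp_bound_of_lt x r : N x < r -> exp_bound N x r.
Proof.
move=> xr; split; first exact: le_lt_trans xr.
exists (N 1) => n; apply: le_trans (ring_norm_exp _ _ HN) _.
by rewrite ler_wpM2l// lerXn2r ?nnegrE ?Nge0 ?(ltW xr)// ltW// (le_lt_trans _ xr).
Qed.

Lemma exp_bound_const x r C : (forall n, N (x ^+ n) <= C * r ^+ n) -> 1 <= C.
Proof. by move=> /(_ 0%N); rewrite !expr0 mulr1; apply: le_trans. Qed.

Lemma exp_bound_neq0 x : exp_bound N x !=set0.
Proof. by exists (N x + 1); apply: exp_bound_of_lt; rewrite ltrDl. Qed.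

Lemma exp_bound_ge0 x : lbound (exp_bound N x) 0.
Proof. by move=> r [/ltW]. Qed.

Lemma spectral_norm_le x r : exp_bound N x r -> spectral_norm N x <= r.
Proof. by move=> h; apply: ge_inf => //; exists 0; apply: exp_bound_ge0. Qed.

Lemma spectral_norm_ge0 x : 0 <= spectral_norm N x.
Proof. by apply: lb_le_inf; [exact: exp_bound_neq0|exact: exp_bound_ge0]. Qed.

Lemma exp_bound_le x r s : exp_bound N x r -> r <= s -> exp_bound N x s.
Proof.
move=> [r0 [C hC]] rs; split; first exact: lt_le_trans rs.
exists C => n; apply: le_trans (hC n) _; rewrite ler_wpM2l//.
  by apply: le_trans (exp_bound_const hC).
by rewrite lerXn2r ?nnegrE ?(ltW r0)// ltW// (lt_le_trans r0).
Qed.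

Lemma exp_bound_lt x r : spectral_norm N x < r -> exp_bound N x r.
Proof.
move=> xr; have h : has_inf (exp_bound N x).
  by split; [exact: exp_bound_neq0|exists 0; exact: exp_bound_ge0].
have e0 : 0 < r - spectral_norm N x by rewrite subr_gt0.
have [s hs hs2] := inf_adherent e0 h.
by apply: (exp_bound_le hs); rewrite ltW// (lt_le_trans hs2)// addrC subrK.
Qed.

Lemma spectral_norm_leN x : spectral_norm N x <= N x.
Proof.
apply/ler_addgt0Pr => e e0; apply: spectral_norm_le; apply: exp_bound_of_lt.
by rewrite ltrDl.
Qed.

Lemma exp_boundD x y r s :
  exp_bound N x r -> exp_bound N y s -> exp_bound N (x + y) (r + s).
Proof.
move=> [r0 [C hC]] [s0 [D hD]]; split; first exact: addr_gt0.
exists (C * D) => n; rewrite !exprDn; apply: le_trans (ring_norm_sum _ _ HN) _.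
rewrite mulr_sumr; apply: ler_sum => i _.
apply: le_trans (ring_norm_mulrn _ _ HN) _.
rewrite -[in leRHS]mulr_natl [leRHS]mulrCA ler_wpM2l//.
apply: le_trans (NM _ _) _; rewrite mulrACA.
by apply: ler_pM.
Qed.

Lemma exp_boundM x y r s :
  exp_bound N x r -> exp_bound N y s -> exp_bound N (x * y) (r * s).
Proof.
move=> [r0 [C hC]] [s0 [D hD]]; split; first exact: mulr_gt0.
exists (C * D) => n; rewrite !exprMn; apply: le_trans (NM _ _) _.
by rewrite mulrACA ler_pM.
Qed.

(** Even powers of x are powers of x^2; an odd one costs one more factor N x, which goes into the
    constant, whose summand 1 serves the even powers. *)
Lemma exp_bound_sqrt x r : exp_bound N (x ^+ 2) r -> exp_bound N x (Num.sqrt r).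
Proof.
move=> [r0 [C hC]]; have s0 : 0 < Num.sqrt r by rewrite sqrtr_gt0.
have C1 := exp_bound_const hC; have C0 : 0 <= C by apply: le_trans C1.
split => //; exists (C * (1 + N x / Num.sqrt r)) => n.
rewrite -(odd_double_half n) exprD -muln2 mulnC exprM.
have -> : Num.sqrt r ^+ (odd n + 2 * n./2) = Num.sqrt r ^+ odd n * r ^+ n./2.
  by rewrite exprD exprM sqr_sqrtr// ltW.
have h1 := hC n./2; have h2 : 0 <= N x / Num.sqrt r by rewrite divr_ge0 // ltW.
have h3 : 0 <= C * r ^+ n./2 by rewrite mulr_ge0// exprn_ge0// ltW.
case: (odd n); rewrite /= ?expr1 ?expr0 ?mul1r.
  apply: le_trans (NM _ _) _.
  apply: le_trans (ler_wpM2l (Nge0 _) h1) _.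
  rewrite [leRHS](_ : _ = (Num.sqrt r + N x) * (C * r ^+ n./2)).
    by rewrite ler_wpM2r// lerDr ltW.
  by field; rewrite gt_eqF.
apply: le_trans h1 _; rewrite mulrAC -[leLHS]mulr1 ler_wpM2l//.
by rewrite lerDl.
Qed.

Lemma spectral_norm_ring_norm : ring_norm (spectral_norm N).
Proof.
split.
- exact: spectral_norm_ge0.
- apply/eqP; rewrite eq_le spectral_norm_ge0 andbT.
  by rewrite -N0; exact: spectral_norm_leN.
- apply: lb_le_inf; first exact: exp_bound_neq0.
  move=> r [r0 [C hC]]; apply: (@ler_of_expM _ C) => // n.
  by rewrite expr1n; apply: le_trans N1 _; have := hC n; rewrite expr1n.
- move=> x y; apply: le_inf_add => [||r s hr hs]; [exact: exp_bound_neq0..|].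
  by apply: spectral_norm_le; apply: exp_boundD.
- move=> x y; apply: le_inf_mul => [||||r s hr hs];
    [exact: exp_bound_neq0..|exact: exp_bound_ge0|exact: exp_bound_ge0|].
  by apply: spectral_norm_le; apply: exp_boundM.
Qed.

Lemma spectral_norm_sqr x : spectral_norm N (x ^+ 2) = spectral_norm N x ^+ 2.
Proof.
apply/eqP; rewrite eq_le; apply/andP; split.
  by rewrite !expr2; case: spectral_norm_ring_norm.
apply: lb_le_inf; first exact: exp_bound_neq0.
move=> r hr; have r0 : 0 < r by case: hr.
rewrite -[leRHS]sqr_sqrtr ?(ltW r0)// lerXn2r ?nnegrE ?sqrtr_ge0 ?spectral_norm_ge0//.
by apply: spectral_norm_le; apply: exp_bound_sqrt.
Qed.

End Spectral.

(* The infimum of the nonincreasing sequence N (y x^n) / N x^n: a smaller norm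
   for which multiplication by x is homothetic. *)
Definition twisted_norm N x y : R := inf (range (fun n => N (y * x ^+ n) / N x ^+ n)).

Section Twist.
Variables (N : E -> R) (HN : ring_norm N) (x : E).
Hypotheses (x0 : 0 < N x) (Nsqr : forall y, N (y ^+ 2) = N y ^+ 2).

Let Nge0 y : 0 <= N y. Proof. by case: HN. Qed.
Let NM y z : N (y * z) <= N y * N z. Proof. by case: HN. Qed.
Let ND y z : N (y + z) <= N y + N z. Proof. by case: HN. Qed.
Let u y n := N (y * x ^+ n) / N x ^+ n.

Lemma twisted_norm_homo y : {homo u y : m n / (m <= n)%N >-> n <= m}.
Proof.
apply: homo_leq => [a|a b c h1 h2|n]; [exact: lexx|exact: le_trans h2 h1|].
rewrite /u exprSr mulrA ler_pdivrMr ?exprn_gt0// exprSr [in leRHS]mulrA.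
by rewrite divfK ?gt_eqF ?exprn_gt0.
Qed.

(** Squaring gives equality for exponents 2^m. A loss at exponent n would, after multiplication by
    x^(2^n - n), be a loss at 2^n. *)
Lemma power_multiplicative n : N (x ^+ n) = N x ^+ n.
Proof.
have Npow m : N (x ^+ (2 ^ m)) = N x ^+ (2 ^ m).
  by elim: m => [|m IH]; rewrite ?expr1// expnSr !exprM Nsqr IH.
have N1 : N 1 = 1 by apply: ring_norm_sqr1.
have Nle m : N (x ^+ m) <= N x ^+ m.
  by apply: le_trans (ring_norm_exp _ _ HN) _; rewrite N1 mul1r.
apply/eqP; rewrite eq_le Nle /=.
have nl : (n <= 2 ^ n)%N by rewrite ltnW// ltn_expl.
have := Npow n; rewrite -(subnKC nl) !exprD => h.
have := NM (x ^+ n) (x ^+ (2 ^ n - n)); rewrite h => h'.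
rewrite -(ler_pM2r (exprn_gt0 (2 ^ n - n) x0)).
by apply: le_trans h' _; rewrite ler_wpM2l.
Qed.

Lemma twisted_norm_ring_norm : ring_norm (twisted_norm N x).
Proof.
have p0 n : 0 < N x ^+ n by rewrite exprn_gt0.
apply: (@inf_ring_norm nat (fun n y => u y n) 0%N) => //.
- by move=> n y; rewrite divr_ge0// ltW.
- by move=> n; rewrite /u mul0r; case: HN => _ -> _ _ _; rewrite mul0r.
- by move=> n; rewrite /u mul1r power_multiplicative divff// gt_eqF.
- move=> i j; exists (maxn i j) => y z.
  apply: (@le_trans _ _ (u y (maxn i j) + u z (maxn i j))).
    by rewrite /u -mulrDl ler_pM2r ?invr_gt0// mulrDl.
  by rewrite lerD// twisted_norm_homo ?leq_maxl ?leq_maxr.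
- move=> i j; exists (i + j)%N => y z.
  rewrite /u [N x ^+ _]exprD [x ^+ _]exprD mulrACA invfM [leRHS]mulrACA.
  by rewrite ler_pM2r// mulr_gt0 ?invr_gt0.
Qed.

Lemma twisted_norm_le y : twisted_norm N x y <= N y.
Proof.
apply: le_trans (_ : u y 0 <= _); last by rewrite /u !expr0 mulr1 divr1.
apply: ge_inf; last by exists 0%N.
by exists 0 => _ [n _ <-]; rewrite divr_ge0// exprn_ge0.
Qed.

Lemma twisted_normM y : twisted_norm N x (x * y) = N x * twisted_norm N x y.
Proof.
have p0 n : 0 < N x ^+ n by rewrite exprn_gt0.
have hlb z : has_lbound (range (u z)).
  by exists 0 => _ [n _ <-]; rewrite divr_ge0// ltW.
have uS n : u (x * y) n = N x * u y n.+1.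
  rewrite /u [x * y]mulrC -mulrA -exprS [N x ^+ n.+1]exprS.
  by field; rewrite !gt_eqF.
apply/eqP; rewrite eq_le; apply/andP; split.
  rewrite -ler_pdivrMl//; apply: lb_le_inf; first by exists (u y 0), 0%N.
  move=> _ [n _ <-]; rewrite ler_pdivrMl//.
  apply: le_trans (_ : u (x * y) n <= _); first by apply: (ge_inf (hlb _)); exists n.
  by rewrite uS ler_pM2l// twisted_norm_homo.
apply: lb_le_inf; first by exists (u (x * y) 0), 0%N.
move=> _ [n _ <-]; rewrite -/(u _ _) uS ler_pM2l//.
by apply: (ge_inf (hlb _)); exists n.+1.
Qed.

End Twist.

(** Zorn's lemma for the reversed order; a chain is bounded by its pointwise infimum, the empty
    chain by N. *)
Lemma minimal_ring_norm N : ring_norm N -> exists M, [/\ ring_norm M,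
  forall x, M x <= N x &
  forall M', ring_norm M' -> (forall x, M' x <= M x) -> M' = M].
Proof.
move=> HN; pose T := {M : E -> R | ring_norm M /\ forall x, M x <= N x}.
pose r (M M' : T) := `[< forall x, sval M' x <= sval M x >].
have [||||M hM] := @Zorn T r.
- by move=> M; apply/asboolP.
- move=> M1 M2 M3 /asboolP h1 /asboolP h2; apply/asboolP => x.
  exact: le_trans (h2 x) (h1 x).
- move=> [M1 h1] [M2 h2] /asboolP /= h12 /asboolP /= h21.
  have e : M1 = M2 by apply/funext => x; apply/eqP; rewrite eq_le h12 h21.
  by case: _ / e h2 {h12 h21} => h2; congr exist; apply: Prop_irrelevance.
- move=> A totA; have [[M0 AM0]|nA] := pselect (exists M : T, A M); last first.
    by exists (exist _ N (conj HN (fun=> lexx _))) => s As; case: nA; exists s.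
  pose I := {M : T | A M}; pose F (i : I) := sval (sval i).
  have HF i : ring_norm (F i) by case: (svalP (sval i)).
  have FN i x : F i x <= N x by have [_ h] := svalP (sval i); apply: h.
  have Fdir (i j : I) : exists k : I, forall x, F k x <= F i x /\ F k x <= F j x.
    case: i j => [i Ai] [j Aj]; have [/asboolP h|/asboolP h] := totA _ _ Ai Aj.
      by exists (exist _ j Aj) => x; split; [exact: h|exact: lexx].
    by exists (exist _ i Ai) => x; split; [exact: lexx|exact: h].
  pose G x := inf (range (F^~ x)).
  have HG : ring_norm G.
    apply: (@inf_ring_norm I F (exist _ M0 AM0)) => [i x|i|i|i j|i j];
      try by case: (HF i).
    - have [k hk] := Fdir i j; exists k => x y.
      case: (HF k) => _ _ _ hD _; apply: le_trans (hD _ _) _.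
      by rewrite lerD//; [case: (hk x)|case: (hk y)].
    - have [k hk] := Fdir i j; exists k => x y.
      case: (HF k) => h0 _ _ _ hM; apply: le_trans (hM _ _) _.
      by rewrite ler_pM//; [case: (hk x)|case: (hk y)].
  have GF i x : G x <= F i x.
    apply: ge_inf; last by exists i.
    by exists 0 => _ [j _ <-]; case: (HF j).
  have GN x : G x <= N x by apply: le_trans (GF (exist _ M0 AM0) x) _.
  exists (exist _ G (conj HG GN)) => s As; apply/asboolP => x /=.
  exact: (GF (exist _ s As)).
exists (sval M); have [HM MN] := svalP M; split => // M' HM' M'M.
have M'N x : M' x <= N x by apply: le_trans (M'M x) _.
have := hM (exist _ M' (conj HM' M'N)); rewrite /r /= => /(_ _)/(congr1 sval) /=.
by apply; apply/asboolP.
Qed.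

(** Minimality forces N to coincide with its spectral norm, hence N (x^2) = (N x)^2, and then with
    its twist by every nonzero x, for which multiplication by x is homothetic. *)
Lemma minimal_ring_norm_mul N : ring_norm N ->
    (forall M, ring_norm M -> (forall x, M x <= N x) -> M = N) ->
  exists v : absval R E, forall x, v x = N x.
Proof.
move=> HN minN.
have Nsqr x : N (x ^+ 2) = N x ^+ 2.
  have <- := minN _ (spectral_norm_ring_norm HN) (spectral_norm_leN HN).
  exact: spectral_norm_sqr.
have [Nge0 N0 N1 ND NM] := HN.
have Npos x : x != 0 -> 0 < N x.
  move=> x0; rewrite lt_def Nge0 andbT; apply/eqP => Nx.
  have := NM x x^-1; rewrite divff// Nx mul0r => h.
  by have := le_trans N1 h; rewrite ler10.
have NMe x y : N (x * y) = N x * N y.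
  have [->|x0] := eqVneq x 0; first by rewrite mul0r N0 mul0r.
  have h := twisted_normM HN (Npos _ x0) y.
  have e := minN _ (twisted_norm_ring_norm HN (Npos _ x0) Nsqr)
    (twisted_norm_le HN x).
  by move: h; rewrite e.
have Neq0 x : (N x == 0) = (x == 0).
  by have [->|/Npos/gt_eqF//] := eqVneq x 0; rewrite N0 eqxx.
by exists (AbsVal Nge0 Neq0 NMe ND).
Qed.

(** The value at y is protected by twisting S by y before minimizing: the twist at y^-1 is at most 1
    / S y, so v y^-1 <= 1 / S y and v y cannot drop below S y. *)
Lemma exists_absval_spectral N y : ring_norm N -> exists v : absval R E,
  (forall x, v x <= spectral_norm N x) /\ v y = spectral_norm N y.
Proof.
move=> HN; set S := spectral_norm N.
have HS : ring_norm S := spectral_norm_ring_norm HN.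
wlog y0 : y / y != 0 => [th|].
  have [->|] := eqVneq y 0; last exact: th.
  have [v [hv _]] := th 1 (oner_neq0 _); exists v; split => //.
  by rewrite av0; case: HS.
have [Sge0 S0 S1 SD SM] := HS.
have Ssqr x : S (x ^+ 2) = S x ^+ 2 by apply: spectral_norm_sqr.
have Sy : 0 < S y.
  rewrite lt_def Sge0 andbT; apply/eqP => Sy.
  have := SM y y^-1; rewrite divff// Sy mul0r => h.
  by have := le_trans S1 h; rewrite ler10.
have HT := twisted_norm_ring_norm HS Sy Ssqr.
have [M [HM MT minM]] := minimal_ring_norm HT.
have [v hv] := minimal_ring_norm_mul HM minM.
have MS x : M x <= S x by apply: le_trans (MT x) (twisted_norm_le HS y x).
exists v; split => [x|]; first by rewrite hv.
apply/eqP; rewrite eq_le [X in X <= _]hv MS /=.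
have h : S y * M y^-1 <= 1.
  apply: le_trans (ler_wpM2l (ltW Sy) (MT _)) _.
  rewrite -(twisted_normM HS Sy) mulfV//.
  apply: le_trans (twisted_norm_le HS _ _) _.
  by rewrite (ring_norm_sqr1 HS).
have vy : v y != 0 by rewrite av_eq0.
rewrite -(hv y^-1) avV in h; move: h.
by rewrite ler_pdivrMr ?mul1r// lt_def vy av_ge0.
Qed.

End RingNorm.

(** * Norms and absolute values on a finite extension *)

Section Extension.
Variables (R : realType) (K : fieldType) (E : fieldExtType K) (w : absval R K).
Local Notation n := (\dim {:E}).
Local Notation b := (vbasis {:E}).
Local Notation co := (coord b).
Implicit Types (x y : E).

Definition coord_norm x : R := \sum_i w (co i x).

Lemma absval_sum (F : fieldType) (v : absval R F) (I : Type) (r : seq I) (P : pred I)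
    (f : I -> F) : v (\sum_(i <- r | P i) f i) <= \sum_(i <- r | P i) v (f i).
Proof.
elim/big_rec2: _ => [|i a c _ h]; first by rewrite av0.
by apply: le_trans (av_triangle _ _ _) _; rewrite lerD2l.
Qed.

Lemma absvalX (F : fieldType) (v : absval R F) (x : F) m : v (x ^+ m) = v x ^+ m.
Proof. by elim: m => [|m IH]; rewrite ?expr0 ?av1// !exprS avM IH. Qed.

Lemma coord_normD x y : coord_norm (x + y) <= coord_norm x + coord_norm y.
Proof.
rewrite /coord_norm -big_split; apply: ler_sum => i _.
by rewrite linearD av_triangle.
Qed.

Lemma coord_norm_sum (I : Type) (r : seq I) (P : pred I) (f : I -> E) :
  coord_norm (\sum_(i <- r | P i) f i) <= \sum_(i <- r | P i) coord_norm (f i).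
Proof.
elim/big_rec2: _ => [|i a c _ h].
  by rewrite /coord_norm big1// => i _; rewrite linear0 av0.
by apply: le_trans (coord_normD _ _) _; rewrite lerD2l.
Qed.

Lemma coord_normZ c x : coord_norm (c *: x) = w c * coord_norm x.
Proof.
by rewrite /coord_norm mulr_sumr; apply: eq_bigr => i _; rewrite linearZ avM.
Qed.

Lemma coord_norm_ge0 x : 0 <= coord_norm x.
Proof. by apply: sumr_ge0 => i _; apply: av_ge0. Qed.

Definition structure_bound : R := \sum_(i < n) \sum_(j < n) coord_norm (b`_i * b`_j).

Lemma coord_normM x y :
  coord_norm (x * y) <= structure_bound * (coord_norm x * coord_norm y).
Proof.
rewrite {1}(coord_vbasis (memvf x)) {1}(coord_vbasis (memvf y)).
rewrite mulr_suml; apply: le_trans (coord_norm_sum _ _ _) _.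
rewrite [leRHS]mulr_suml; apply: ler_sum => i _.
rewrite mulr_sumr mulr_suml; apply: le_trans (coord_norm_sum _ _ _) _.
apply: ler_sum => j _; rewrite -scalerAl -scalerAr !coord_normZ mulrA mulrC.
rewrite ler_wpM2l ?coord_norm_ge0// ler_pM ?av_ge0//.
  by rewrite /coord_norm (bigD1 i)//= lerDl sumr_ge0// => ? _; apply: av_ge0.
by rewrite /coord_norm (bigD1 j)//= lerDl sumr_ge0// => ? _; apply: av_ge0.
Qed.

(** The coordinate norm is submultiplicative only up to the factor [structure_bound]; scaling by
    that factor absorbs it. *)
Definition extension_norm x : R := structure_bound * coord_norm x.

Lemma coord_norm1_gt0 : 0 < coord_norm 1.
Proof.
rewrite lt_def coord_norm_ge0 andbT; apply/eqP => h.
suff : (1 : E) = 0 by move/eqP; rewrite oner_eq0.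
rewrite (coord_vbasis (memvf 1)) big1// => i _.
move/eqP: h; rewrite psumr_eq0 => [/allP/(_ i)|j _]; last exact: av_ge0.
by rewrite mem_index_enum av_eq0 => /(_ isT)/= /eqP ->; rewrite scale0r.
Qed.

Lemma structure_bound_gt0 : 0 < structure_bound.
Proof.
have c0 := coord_norm1_gt0.
have := coord_normM 1 1; rewrite mulr1 => h.
have : 0 < structure_bound * (coord_norm 1 * coord_norm 1) by apply: lt_le_trans h.
by rewrite pmulr_lgt0// mulr_gt0.
Qed.

Lemma extension_norm_ring_norm : ring_norm extension_norm.
Proof.
have s0 := structure_bound_gt0.
have M x y : extension_norm (x * y) <= extension_norm x * extension_norm y.
  rewrite /extension_norm mulrACA -[_ * _ * (_ * _)]mulrA ler_pM2l//.
  exact: coord_normM.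
split => //.
- by move=> x; rewrite mulr_ge0 ?coord_norm_ge0// ltW.
- by rewrite /extension_norm /coord_norm big1 ?mulr0// => i _; rewrite linear0 av0.
- have := M 1 1; rewrite mulr1 -[leLHS]mulr1 ler_pM2l//.
  by rewrite /extension_norm mulr_gt0// coord_norm1_gt0.
- by move=> x y; rewrite -mulrDr ler_pM2l// coord_normD.
Qed.

Lemma extension_normZ c x : extension_norm (c *: x) = w c * extension_norm x.
Proof. by rewrite /extension_norm coord_normZ mulrCA. Qed.

Lemma coord_le_extension_norm i x :
  w (co i x) <= structure_bound^-1 * extension_norm x.
Proof.
rewrite /extension_norm mulKf ?gt_eqF ?structure_bound_gt0//.
by rewrite /coord_norm (bigD1 i)//= lerDl sumr_ge0// => ? _; apply: av_ge0.
Qed.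

(** On K the spectral norm is at most w, so v <= w there; applied to c and to c^-1 this gives
    equality. *)
Lemma absval_extension y : exists v : absval R E,
  (forall c : K, v c%:A = w c) /\ v y = spectral_norm extension_norm y.
Proof.
have HN := extension_norm_ring_norm.
have [v [hv vy]] := exists_absval_spectral y HN; exists v; split => // c.
have le a : v a%:A <= w a.
  apply: le_trans (hv _) _; apply/ler_addgt0Pr => e e0.
  have r0 : 0 < w a + e by rewrite ltr_wpDl// av_ge0.
  apply: spectral_norm_le => //; split => //; exists (extension_norm 1) => m.
  rewrite exprZn expr1n extension_normZ absvalX mulrC ler_wpM2l//.
    by case: HN.
  by rewrite lerXn2r ?nnegrE ?av_ge0 ?(ltW r0)// lerDl ltW.
have [->|c0] := eqVneq c 0; first by rewrite scale0r !av0.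
apply/eqP; rewrite eq_le le /=.
have cA0 : c%:A != 0 :> E by rewrite scaler_eq0 negb_or c0 oner_neq0.
have := le c^-1; have -> : c^-1%:A = (c%:A)^-1 :> E by rewrite -in_algE fmorphV.
by rewrite !avV lef_pV2// posrE lt_def av_ge0 av_eq0 ?c0 ?cA0.
Qed.

(** Its determinant is the norm of y from E to K. Row i holds the coordinates of y b_i, hence the
    reversed order in [mul_matrixM]. *)
Definition mul_matrix y : 'M[K]_n := \matrix_(i, j) co j (y * b`_i).

Lemma mul_matrixM y z : mul_matrix (y * z) = mul_matrix z *m mul_matrix y.
Proof.
apply/matrixP => i j; rewrite !mxE -mulrA {1}(coord_vbasis (memvf (z * b`_i))).
rewrite mulr_sumr linear_sum; apply: eq_bigr => l _.
by rewrite !mxE -scalerAr linearZ.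
Qed.

Lemma mul_matrix1 : mul_matrix 1 = 1%:M.
Proof.
apply/matrixP => i j; rewrite !mxE mul1r coord_free; last exact: basis_free (vbasisP _).
by rewrite eq_sym.
Qed.

Lemma mul_matrixX y m : \det (mul_matrix (y ^+ m)) = \det (mul_matrix y) ^+ m.
Proof.
elim: m => [|m IH]; first by rewrite !expr0 mul_matrix1 det1.
by rewrite !exprSr mul_matrixM det_mulmx IH mulrC.
Qed.

Lemma det_mul_matrix_neq0 y : y != 0 -> \det (mul_matrix y) != 0.
Proof.
move=> y0; apply/eqP => h; have := congr1 determinant (mul_matrixM y y^-1).
rewrite divff// mul_matrix1 det1 det_mulmx h mulr0 => /eqP.
by rewrite oner_eq0.
Qed.

Lemma absval_det (F : fieldType) (v : absval R F) m (A : 'M[F]_m) B :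
  (forall i j, v (A i j) <= B) -> v (\det A) <= (m`!)%:R * B ^+ m.
Proof.
move=> h; apply: le_trans (absval_sum _ _ _ _) _.
rewrite -card_Sn -sum1_card natr_sum mulr_suml.
rewrite [leRHS](eq_bigl xpredT); last by move=> i; rewrite inE.
apply: ler_sum => s _.
rewrite mul1r avM absvalX avN av1 expr1n mul1r.
have -> : B ^+ m = \prod_(i < m) B by rewrite prodr_const card_ord.
rewrite (big_morph v (avM v) (av1 v)).
by apply: ler_prod => i _; rewrite av_ge0 h.
Qed.

(** The entries of the matrix of y^m are O(r^m), so the m-th power of the determinant is O(r^(n m)),
    and [ler_of_expM] removes the constant. This replaces the formula for the norm as a product over
    all extensions of w. *)
Lemma absval_det_mul_matrix y r : 0 < r -> spectral_norm extension_norm y < r ->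
  w (\det (mul_matrix y)) <= r ^+ n.
Proof.
move=> r0 /(exp_bound_lt extension_norm_ring_norm)[_ [C hC]].
have [Nge0 _ _ _ NM] := extension_norm_ring_norm.
have C0 : 0 <= C.
  by have := exp_bound_const extension_norm_ring_norm hC; apply: le_trans.
pose D := \sum_(i < n) (structure_bound^-1 * extension_norm b`_i * C).
have sb0 : 0 < structure_bound^-1 by rewrite invr_gt0 structure_bound_gt0.
have D_ge (i : 'I_n) : structure_bound^-1 * extension_norm b`_i * C <= D.
  rewrite /D (bigD1 i)//= lerDl sumr_ge0// => j _.
  by apply: mulr_ge0 => //; apply: mulr_ge0 => //; apply: ltW.
apply: (@ler_of_expM _ _ ((n`!)%:R * D ^+ n)); first by rewrite exprn_gt0.
move=> m; rewrite -absvalX -mul_matrixX.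
rewrite -mulrA exprAC -exprMn; apply: absval_det => i j; rewrite mxE.
apply: le_trans (coord_le_extension_norm _ _) _.
apply: le_trans (_ : (structure_bound^-1 * extension_norm b`_i * C) * r ^+ m <= _).
  rewrite -[_ * C * _]mulrA -[structure_bound^-1 * _ * _]mulrA ler_pM2l//.
  apply: le_trans (NM _ _) _.
  by rewrite [leLHS]mulrC; apply: ler_wpM2l.
by rewrite ler_wpM2r ?D_ge// exprn_ge0// ltW.
Qed.

End Extension.

(** * Nonarchimedean absolute values on number fields *)

Section Ultrametric.
Variables (R : realType) (F : fieldType) (v : absval R F).
Implicit Types x y : F.

Lemma absval_gt0 x : (0 < v x) = (x != 0).
Proof. by rewrite lt_def av_ge0 av_eq0 andbT. Qed.

Definition ultrametric_absval := forall x y, v (x + y) <= Num.max (v x) (v y).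

(** Binomial coefficients have value at most 1, so v (x + y)^n <= (n + 1) m^n, and n + 1 grows more
    slowly than any (1 + d)^n with d > 0. *)
Lemma ultrametric_of_nat : (forall n, v n%:R <= 1) -> ultrametric_absval.
Proof.
move=> vn x y; set m := Num.max _ _.
have m0 : 0 <= m by rewrite le_max av_ge0.
have vxm : v x <= m by rewrite le_max lexx.
have vym : v y <= m by rewrite le_max lexx orbT.
have pow n : v (x + y) ^+ n <= n.+1%:R * m ^+ n.
  rewrite -absvalX exprDn; apply: le_trans (absval_sum _ _ _ _) _.
  have -> : n.+1%:R * m ^+ n = \sum_(i < n.+1) m ^+ n.
    by rewrite sumr_const card_ord mulr_natl.
  apply: ler_sum => i _; rewrite -mulr_natl !avM !absvalX.
  rewrite -[m ^+ n]mul1r ler_pM ?mulr_ge0 ?exprn_ge0 ?av_ge0//.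
  rewrite -[X in m ^+ X](subnK (ltn_ord i : (i <= n)%N)) exprD.
  by rewrite ler_pM ?exprn_ge0 ?av_ge0// lerXn2r ?nnegrE ?av_ge0.
have [mz|mn] := eqVneq m 0.
  by have := pow 1%N; rewrite !expr1 mz mulr0.
have mp : 0 < m by rewrite lt_def mn.
apply/ler_addgt0Pr => e e0; pose d := e / m.
have d0 : 0 < d by rewrite divr_gt0.
have -> : m + e = (1 + d) * m by rewrite /d mulrDl mul1r divfK.
(* The constant comes from n + 1 <= (1 + 1/d) (1 + n d), with Bernoulli for the second factor. *)
apply: (@ler_of_expM _ _ (1 + d^-1)); first by rewrite mulr_gt0// addr_gt0.
move=> n; apply: le_trans (pow n) _; rewrite exprMn mulrA ler_wpM2r ?exprn_ge0//.
have bern := bernoulli_le n (ltW d0).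
apply: (@le_trans _ _ ((1 + d^-1) * (1 + n%:R * d))); last first.
  by rewrite ler_wpM2l// addr_ge0// invr_ge0 ltW.
have -> : (1 + d^-1) * (1 + n%:R * d) = 1 + n%:R + n%:R * d + d^-1.
  by field; rewrite gt_eqF.
have h1 : 0 <= n%:R * d by rewrite mulr_ge0// ltW.
have h2 : 0 <= d^-1 by rewrite invr_ge0 ltW.
by rewrite -natr1; lra.
Qed.

Hypothesis vU : ultrametric_absval.

Lemma ultrametric_sum (I : Type) (r : seq I) (P : pred I) (f : I -> F) B :
  0 <= B -> (forall i, P i -> v (f i) <= B) -> v (\sum_(i <- r | P i) f i) <= B.
Proof.
move=> B0 h; elim/big_rec: _ => [|i a Pi ha]; first by rewrite av0.
by apply: le_trans (vU _ _) _; rewrite ge_max h.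
Qed.

Lemma ultrametric_sum_lt (I : Type) (r : seq I) (P : pred I) (f : I -> F) B :
  0 < B -> (forall i, P i -> v (f i) < B) -> v (\sum_(i <- r | P i) f i) < B.
Proof.
move=> B0 h; elim/big_rec: _ => [|i a Pi ha]; first by rewrite av0.
by apply: le_lt_trans (vU _ _) _; rewrite gt_max h.
Qed.

Lemma ultrametric_eq x y : v y < v x -> v (x + y) = v x.
Proof.
move=> yx; apply/eqP; rewrite eq_le; apply/andP; split.
  by apply: le_trans (vU _ _) _; rewrite ge_max lexx ltW.
have := vU (x + y) (- y); rewrite addrK avN le_max => /orP[//|h].
by have := lt_le_trans yx h; rewrite ltxx.
Qed.

Lemma ultrametricB x y B : v x <= B -> v y <= B -> v (x - y) <= B.
Proof. by move=> hx hy; apply: le_trans (vU _ _) _; rewrite avN ge_max hx. Qed.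

Lemma ultrametricB_lt x y B : v x < B -> v y < B -> v (x - y) < B.
Proof. by move=> hx hy; apply: le_lt_trans (vU _ _) _; rewrite avN gt_max hx. Qed.

End Ultrametric.

(** * The p-adic absolute value on the rationals *)

Section Padic.
Variables (R : realType) (p : nat) (p_prime : prime p).
Local Notation padic := (padic_abs R p).
Let p_gt0 : 0 < p%:R :> R. Proof. by rewrite ltr0n prime_gt0. Qed.
Let p_neq0 : p%:R != 0 :> R. Proof. by rewrite gt_eqF. Qed.

Lemma padic_abs_frac (a b : int) : a != 0 -> b != 0 ->
  padic (a%:~R / b%:~R) = p%:R ^- logn p `|a| * p%:R ^+ logn p `|b|.
Proof.
move=> a0 b0; set q := a%:~R / b%:~R.
have q0 : q != 0 by rewrite mulf_eq0 invr_eq0 !intr_eq0 negb_or a0.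
rewrite /padic_abs (negbTE q0) expfzDr// -exprnN -exprnP mulrC.
have e : (`|numq q| * `|b| = `|a| * `|denq q|)%N.
  rewrite -!abszM; congr absz; apply/eqP; rewrite -(eqr_int rat) !rmorphM /=.
  have b0' : b%:~R != 0 :> rat by rewrite intr_eq0.
  by rewrite numqE /q mulrAC divfK.
have nq0 : (0 < `|numq q|)%N by rewrite absz_gt0 numq_eq0.
have dq0 : (0 < `|denq q|)%N by rewrite absz_gt0 denq_neq0.
have pa0 : (0 < `|a|)%N by rewrite absz_gt0.
have pb0 : (0 < `|b|)%N by rewrite absz_gt0.
have := congr1 (logn p) e; rewrite !lognM// => h.
rewrite mulrC [RHS]mulrC; apply/eqP; rewrite eqr_div ?expf_neq0// -!exprD.
by rewrite [X in _ ^+ X == _]addnC -h addnC.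
Qed.

Lemma padic_abs_int (a : int) : a != 0 -> padic a%:~R = p%:R ^- logn p `|a|.
Proof. by move=> a0; rewrite -[a%:~R]divr1 (@padic_abs_frac a 1)// logn1 expr0 mulr1. Qed.

Lemma padic_abs_ge0 q : 0 <= padic q.
Proof. by rewrite /padic_abs; case: ifP => // _; rewrite exprz_ge0// ltW. Qed.

Lemma padic_abs_eq0 q : (padic q == 0) = (q == 0).
Proof.
by rewrite /padic_abs; case: ifP => // _; [rewrite eqxx|rewrite gt_eqF// exprz_gt0].
Qed.

Lemma padic_absM q s : padic (q * s) = padic q * padic s.
Proof.
have [->|q0] := eqVneq q 0; first by rewrite mul0r /padic_abs eqxx mul0r.
have [->|s0] := eqVneq s 0; first by rewrite mulr0 /padic_abs eqxx mulr0.
rewrite -(divq_num_den q) -(divq_num_den s) mulf_div -!rmorphM /=.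
rewrite !padic_abs_frac ?mulf_neq0 ?numq_eq0 ?denq_neq0//.
by rewrite !abszM !lognM ?absz_gt0 ?numq_eq0 ?denq_neq0// !exprD invfM mulrACA.
Qed.

Lemma padic_abs_max q s : padic (q + s) <= Num.max (padic q) (padic s).
Proof.
have [->|q0] := eqVneq q 0; first by rewrite add0r le_max lexx orbT.
have [->|s0] := eqVneq s 0; first by rewrite addr0 le_max lexx.
have [->|qs0] := eqVneq (q + s) 0.
  by rewrite {1}/padic_abs eqxx le_max padic_abs_ge0.
have := qs0; have := q0; have := s0.
rewrite -(divq_num_den q) -(divq_num_den s).
set a := numq q; set b := denq q; set c := numq s; set d := denq s.
have b0 : b != 0 by apply: denq_neq0.
have d0 : d != 0 by apply: denq_neq0.
have bd0 : b%:~R != 0 :> rat by rewrite intr_eq0.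
have dd0 : d%:~R != 0 :> rat by rewrite intr_eq0.
have eq1 : a%:~R / b%:~R = (a * d)%:~R / (b * d)%:~R :> rat.
  by rewrite !rmorphM /=; field; rewrite bd0 dd0.
have eq2 : c%:~R / d%:~R = (c * b)%:~R / (b * d)%:~R :> rat.
  by rewrite !rmorphM /=; field; rewrite bd0 dd0.
rewrite eq1 eq2 -mulrDl -rmorphD /=; set x := a * d; set y := c * b; set z := b * d.
rewrite !mulf_eq0 !intr_eq0 !negb_or => /andP[y0 z0] /andP[x0 _] /andP[xy0 _].
have z0' : z != 0 by rewrite mulf_neq0.
rewrite le_max !padic_abs_frac// !ler_pM2r ?exprn_gt0//.
have px : (0 < `|x|)%N by rewrite absz_gt0.
have py : (0 < `|y|)%N by rewrite absz_gt0.
have pxy : (0 < `|(x + y)%R|)%N by rewrite absz_gt0.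
set m := minn (logn p `|x|) (logn p `|y|).
have hm : (m <= logn p `|(x + y)%R|)%N.
  have hx : (p ^ m %| `|x|)%N by rewrite pfactor_dvdn// geq_minl.
  have hy : (p ^ m %| `|y|)%N by rewrite pfactor_dvdn// geq_minr.
  rewrite -pfactor_dvdn//.
  by have : ((p ^ m)%N %| x + y)%Z by apply: rpredD; [exact: hx|exact: hy].
have le1 : forall i j, (i <= j)%N -> p%:R ^- j <= p%:R ^- i :> R.
  by move=> i j ij; rewrite lef_pV2 ?posrE ?exprn_gt0// ler_eXn2l ?ltr1n ?prime_gt1.
by move: hm; rewrite /m geq_min => /orP[] /le1 ->; rewrite ?orbT.
Qed.

Lemma padic_abs_triangle q s : padic (q + s) <= padic q + padic s.
Proof.
apply: le_trans (padic_abs_max q s) _.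
by rewrite ge_max lerDl lerDr !padic_abs_ge0.
Qed.

Definition padic_absval : absval R rat :=
  AbsVal padic_abs_ge0 padic_abs_eq0 padic_absM padic_abs_triangle.

Lemma padic_abs_nat_le1 n : padic n%:R <= 1.
Proof.
case: n => [|n]; first by rewrite /padic_abs eqxx.
rewrite (padic_abs_int (a := n.+1))// invf_le1 ?exprn_gt0//.
by rewrite exprn_ege1// ler1n prime_gt0.
Qed.

Lemma padic_abs_p : padic p%:R = p%:R^-1.
Proof.
rewrite (padic_abs_int (a := p)) /=; last by rewrite eqz_nat -lt0n prime_gt0.
by rewrite logn_prime// eqxx expr1.
Qed.

Lemma padic_abs_coprime (a : int) : ~~ (p %| `|a|)%N -> padic a%:~R = 1.
Proof.
move=> pa; have a0 : a != 0 by apply: contraNneq pa => ->; rewrite dvdn0.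
rewrite padic_abs_int// (_ : logn p _ = 0%N) ?expr0 ?invr1//.
by apply/eqP; rewrite -leqn0 leqNgt logn_gt0 mem_primes p_prime absz_gt0 a0.
Qed.

(** [prime_ideal_inj] uses this to scale by powers of p when comparing absolute values whose value
    groups are unknown. *)
Lemma int_pow_approx (y : R) : 0 < y -> exists a : int, y <= p%:R ^ a <= p%:R * y.
Proof.
have p1 : 1 < p%:R :> R by rewrite ltr1n prime_gt1.
have ge1 (x : R) : 1 <= x -> exists2 n : nat, x <= p%:R ^+ n.+1 & p%:R ^+ n <= x.
  move=> x1; have ex : exists n, x < p%:R ^+ n.+1.
    exists (Num.bound x); apply: lt_trans (archi_boundP (le_trans ler01 x1)) _.
    rewrite -natrX ltr_nat; apply: ltn_trans (ltn_expl _ (prime_gt1 p_prime)) _.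
    by rewrite ltn_exp2l// prime_gt1.
  have [n xn minn] := ex_minnP ex; exists n; first exact: ltW.
  case: n => [|n] in xn minn *; first by rewrite expr0.
  rewrite leNgt; apply/negP => h; have := minn _ h.
  by rewrite ltnn.
move=> y0; have [y1|y1] := leP 1 y.
  have [n h1 h2] := ge1 _ y1; exists n.+1; rewrite -exprnP h1 /= exprS.
  by rewrite ler_pM2l.
have y1' : 1 <= y^-1 by rewrite invf_ge1// ltW.
have [n h1 h2] := ge1 _ y1'; exists (- n%:Z); rewrite -exprnN.
apply/andP; split.
  by rewrite -[y]invrK lef_pV2 ?posrE ?invr_gt0 ?exprn_gt0.
rewrite -[p%:R * y]invrK lef_pV2 ?posrE ?invr_gt0 ?exprn_gt0 ?mulr_gt0// invfM mulrC.
by rewrite ler_pdivrMr// -exprSr.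
Qed.

End Padic.

Section LiesOver.
Variables (R : realType) (k : fieldExtType rat).
Implicit Types (v : absval R k) (x y : k) (p : nat).

Lemma intr_alg (a : int) : (a%:~R : rat)%:A = a%:~R :> k.
Proof. by rewrite -in_algE rmorph_int. Qed.

Lemma natr_alg n : (n%:R : rat)%:A = n%:R :> k.
Proof. by rewrite -in_algE rmorph_nat. Qed.

Lemma lies_over_nat_le1 v p n : lies_over v p -> v n%:R <= 1.
Proof. by move=> [pp h]; rewrite -natr_alg h padic_abs_nat_le1. Qed.

Lemma lies_over_ultrametric v p : lies_over v p -> ultrametric_absval v.
Proof. by move=> h; apply: ultrametric_of_nat => n; apply: lies_over_nat_le1 h. Qed.

Lemma lies_over_p v p : lies_over v p -> v p%:R = p%:R^-1.
Proof. by move=> [pp h]; rewrite -natr_alg h padic_abs_p. Qed.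

Lemma lies_over_coprime v p (a : int) : lies_over v p -> ~~ (p %| `|a|)%N -> v a%:~R = 1.
Proof. by move=> [pp h] pa; rewrite -intr_alg h padic_abs_coprime. Qed.

Lemma lies_over_dvd v p (a : int) : lies_over v p -> (p %| `|a|)%N -> v a%:~R < 1.
Proof.
move=> vp /dvdnP[m hm]; have pp := vp.1.
have -> : v a%:~R = v (m * p)%:R.
  by case: (intP a) hm => [|n|n] /= <- //; rewrite ?avN ?absz0 // rmorphN avN.
rewrite natrM avM (lies_over_p vp) ltr_pdivrMr ?ltr0n ?prime_gt0// mul1r.
apply: le_lt_trans (lies_over_nat_le1 m vp) _.
by rewrite ltr1n prime_gt1.
Qed.

Lemma lies_over_int_le1 v p (a : int) : lies_over v p -> v a%:~R <= 1.
Proof.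
move=> vp; have [/(lies_over_dvd vp)/ltW//|/(lies_over_coprime vp)->//] := boolP (p %| `|a|)%N.
Qed.

Lemma lies_over_uniq v p p' : lies_over v p -> lies_over v p' -> p = p'.
Proof.
move=> vp vp'; apply/eqP/negPn/negP => pp'.
have : v p%:R < 1.
  by rewrite (lies_over_p vp) invf_lt1 ?ltr0n ?ltr1n ?prime_gt0 ?prime_gt1// (vp.1).
have -> : v p%:R = 1.
  have := @lies_over_coprime _ _ p vp'; apply.
  by rewrite /= dvdn_prime2 ?(vp.1) ?(vp'.1)// eq_sym.
by rewrite ltxx.
Qed.

Lemma alg_integer_le1 v p x : lies_over v p -> alg_integer x -> v x <= 1.
Proof.
move=> vp [f fmon fx]; have vU := lies_over_ultrametric vp.
rewrite leNgt; apply/negP => vx.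
have v0 : 0 < v x by apply: lt_trans vx.
have [n hn] : exists n, size f = n.+1.
  by exists (size f).-1; rewrite prednK// lt0n size_poly_eq0 monic_neq0.
have sn : size (map_poly (intr : int -> k) f) = n.+1.
  by rewrite size_map_poly_id0 ?hn// (monicP fmon) oner_eq0.
move: fx; rewrite /root horner_coef sn big_ord_recr /= coef_map /=.
have -> : f`_n = 1 by move/monicP: fmon; rewrite lead_coefE hn.
rewrite mul1r addrC addr_eq0 => /eqP h.
have := congr1 v h; rewrite avN absvalX; case: n => [|n] in hn sn h *.
  by rewrite big_ord0 av0 expr0 => /eqP; rewrite oner_eq0.
move=> e; have : v x ^+ n.+1 <= v x ^+ n.
  rewrite e; apply: ultrametric_sum => //; first by rewrite exprn_ge0// ltW.
  move=> i _; rewrite coef_map avM absvalX.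
  apply: le_trans (_ : 1 * v x ^+ i <= _); last first.
    by rewrite mul1r ler_eXn2l// -ltnS.
  by rewrite ler_wpM2r ?exprn_ge0 ?av_ge0// (lies_over_int_le1 _ vp).
by rewrite exprS ger_pMl ?exprn_gt0// leNgt vx.
Qed.

Lemma place_ext (v w : place R k) : (forall x, v x = w x) -> v = w.
Proof.
case: v w => [[v v0 v1 v2 v3] hv] [[w w0 w1 w2 w3] hw] /= h.
have {h} e : v = w by apply/funext.
move: v0 v1 v2 v3 hv; rewrite e => v0 v1 v2 v3 hv.
have : AbsVal v0 v1 v2 v3 = AbsVal w0 w1 w2 w3 by congr AbsVal; apply: Prop_irrelevance.
by move: hv hw => /[swap] hw /[swap] E; rewrite E in hw * => hv; congr Place; apply: Prop_irrelevance.
Qed.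

End LiesOver.

(** * Algebraic integers and localization at a place *)

Section Fractions.
Variables (R : realType) (k : fieldExtType rat).
Implicit Types (v : absval R k) (x y s : k) (p : nat).

Lemma alg_integer_int (a : int) : alg_integer (a%:~R : k).
Proof. exact: (integral_id (intr : {rmorphism int -> k})). Qed.

Lemma alg_integer_nat n : alg_integer (n%:R : k).
Proof. by have := alg_integer_int n; rewrite pmulrn. Qed.

Lemma alg_integerD x y : alg_integer x -> alg_integer y -> alg_integer (x + y).
Proof. exact: integral_add. Qed.

Lemma alg_integerB x y : alg_integer x -> alg_integer y -> alg_integer (x - y).
Proof. exact: integral_sub. Qed.

Lemma alg_integerM x y : alg_integer x -> alg_integer y -> alg_integer (x * y).
Proof. exact: integral_mul. Qed.

Lemma alg_integerX x n : alg_integer x -> alg_integer (x ^+ n).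
Proof.
move=> hx; elim: n => [|n IH]; first exact: (alg_integer_nat 1).
by rewrite exprS; apply: alg_integerM.
Qed.

Lemma alg_integer_sum (I : Type) (r : seq I) (P : pred I) (f : I -> k) :
  (forall i, P i -> alg_integer (f i)) -> alg_integer (\sum_(i <- r | P i) f i).
Proof.
move=> h; elim/big_rec: _ => [|i a Pi ha]; first exact: (alg_integer_nat 0).
by apply: alg_integerD => //; apply: h.
Qed.

Lemma alg_integer_prod (I : Type) (r : seq I) (P : pred I) (f : I -> k) :
  (forall i, P i -> alg_integer (f i)) -> alg_integer (\prod_(i <- r | P i) f i).
Proof.
move=> h; elim/big_rec: _ => [|i a Pi ha]; first exact: (alg_integer_nat 1).
by apply: alg_integerM => //; apply: h.
Qed.

Lemma alg_integer_horner (g : {poly int}) x :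
  alg_integer x -> alg_integer (map_poly intr g).[x].
Proof.
move=> hx; rewrite horner_coef; apply: alg_integer_sum => i _.
by apply: alg_integerM; [rewrite coef_map; apply: alg_integer_int|apply: alg_integerX].
Qed.

(** Content 1 guarantees, for every prime p, a coefficient prime to p. *)
Lemma primitive_int_poly x :
  exists2 f : {poly int}, zcontents f = 1 & root (map_poly (intr : int -> k) f) x.
Proof.
have /polyOver1P[q hq] := minPolyOver 1%AS x.
have [f [a a0 qf]] := rat_poly_scale q.
have f0 : f != 0.
  apply/eqP => f0; have := monic_neq0 (monic_minPoly 1%AS x).
  by rewrite hq qf f0 rmorph0 scaler0 rmorph0 eqxx.
have hf : map_poly (intr : int -> k) f = a%:~R *: minPoly 1%AS x.
  rewrite hq qf -(rmorph_int (in_alg k)) -map_polyZ scalerA mulfV ?intr_eq0// scale1r.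
  by rewrite -map_poly_comp; apply: eq_map_poly => b; rewrite /= intr_alg.
have fx : root (map_poly (intr : int -> k) f) x.
  by rewrite hf /root hornerZ (eqP (root_minPoly _ _)) mulr0.
exists (zprimitive f); first by rewrite zcontents_primitive f0.
move: fx; rewrite {1}(zpolyEprim f) map_polyZ /root hornerZ mulf_eq0.
case/orP => //=; rewrite -(rmorph_int (in_alg k)) fmorph_eq0 intr_eq0 zcontents_eq0.
by rewrite (negbTE f0).
Qed.

Lemma alg_integer_lead (g : {poly k}) x : (forall i, alg_integer g`_i) ->
  g != 0 -> root g x -> alg_integer (lead_coef g * x).
Proof.
move=> hg g0 gx; set a := lead_coef g.
have [m hm] : exists m, size g = m.+1.
  by exists (size g).-1; rewrite prednK// lt0n size_poly_eq0.
have ag : a = g`_m by rewrite /a lead_coefE hm.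
have gxe : \sum_(i < m) g`_i * x ^+ i + a * x ^+ m = 0.
  by rewrite -[RHS](eqP gx) horner_coef hm big_ord_recr /= ag.
case: m => [|m] in hm ag gxe *.
  move: gxe; rewrite big_ord0 add0r expr0 mulr1 => a0.
  by rewrite a0 mul0r; apply: (alg_integer_nat 0).
(* [h] is monic and [h.[a * x] = a ^+ m * g.[x]]; at this point g has degree m + 1. *)
pose h := 'X^(m.+1) + \poly_(i < m.+1) (g`_i * a ^+ (m - i)).
apply: (@integral_root_monic _ _ _ _ h).
- rewrite monicE lead_coefDl ?lead_coefXn// size_polyXn ltnS.
  exact: size_poly.
- rewrite /root hornerD hornerXn horner_poly.
  have -> : \sum_(i < m.+1) g`_i * a ^+ (m - i) * (a * x) ^+ i =
            a ^+ m * \sum_(i < m.+1) g`_i * x ^+ i.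
    rewrite mulr_sumr; apply: eq_bigr => i _.
    have -> : a ^+ m = a ^+ (m - i) * a ^+ i by rewrite -exprD subnK// -ltnS.
    by rewrite exprMn; ring.
  have -> : \sum_(i < m.+1) g`_i * x ^+ i = - (a * x ^+ m.+1).
    by apply/eqP; rewrite -addr_eq0 gxe.
  by rewrite exprMn [a ^+ m.+1]exprSr; apply/eqP; ring.
- apply/integral_poly => i; rewrite coefD coefXn coef_poly.
  apply: alg_integerD; first exact: alg_integer_nat.
  case: ifP => _; last exact: (alg_integer_nat 0).
  by apply: alg_integerM => //; apply: alg_integerX; rewrite ag.
Qed.

(* If the leading coefficient a is not a unit at v, then a x is integral and a
   nonunit, and absorbing a x^n into the next coefficient lowers the degree. *)
Lemma integral_fraction_poly v p x n (g : {poly k}) : lies_over v p -> v x <= 1 ->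
  (size g <= n)%N -> (forall i, alg_integer g`_i) -> root g x ->
  (exists i, v g`_i = 1) ->
  exists s, [/\ alg_integer s, alg_integer (s * x) & v s = 1].
Proof.
move=> vp vx; have vU := lies_over_ultrametric vp.
elim: n => [|n IH] in g *.
  rewrite leqn0 size_poly_eq0 => /eqP -> _ _; case=> i.
  by rewrite coef0 av0 => /eqP; rewrite eq_sym oner_eq0.
move=> sg hg gx [i vi].
have g0 : g != 0.
  by apply/eqP => g0; move/eqP: vi; rewrite g0 coef0 av0 eq_sym oner_eq0.
have ax := alg_integer_lead hg g0 gx; set a := lead_coef g in ax.
have ha : alg_integer a by rewrite /a lead_coefE.
have := alg_integer_le1 vp ha; rewrite le_eqVlt => /predU1P[va|va].
  by exists a.
have [m hm] : exists m, size g = m.+1.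
  by exists (size g).-1; rewrite prednK// lt0n size_poly_eq0.
have ag : a = g`_m by rewrite /a lead_coefE hm.
have im : (i < m)%N.
  rewrite ltn_neqAle; apply/andP; split.
    by apply: contraTneq va => im; rewrite ag -im vi ltxx.
  rewrite -ltnS -hm ltnNge; apply/negP => /(nth_default 0) gi.
  by move/eqP: vi; rewrite gi av0 eq_sym oner_eq0.
have vax : v (a * x) < 1.
  by rewrite avM; apply: le_lt_trans va; rewrite -[leRHS]mulr1 ler_wpM2l ?av_ge0.
pose g' := \poly_(j < m) (g`_j + (a * x) *+ (j == m.-1)).
apply: (IH g').
- apply: leq_trans (size_poly _ _) _.
  by rewrite -ltnS -hm.
- move=> j; rewrite coef_poly; case: ifP => _; last exact: (alg_integer_nat 0).
  apply: alg_integerD => //; case: eqP => _; rewrite ?mulr1n ?mulr0n//.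
  exact: (alg_integer_nat 0).
- rewrite /root horner_poly.
  rewrite (eq_bigr (fun j : 'I_m => g`_j * x ^+ j + (a * x) *+ (j == m.-1 :> nat) * x ^+ j)).
    rewrite big_split /= -[X in _ == X](eqP gx) horner_coef hm big_ord_recr /= -ag.
    rewrite (inj_eq (addrI _)).
    case: m => [|m] in hm ag im g' *; first by rewrite ltn0 in im.
    rewrite (bigD1 ord_max)//= eqxx big1 => [|j]; first by rewrite addr0 exprS mulrA.
    by rewrite -val_eqE /= => /negbTE ->; rewrite mulr0n mul0r.
  by move=> j _; rewrite mulrDl.
(* Adding the nonunit [a * x] leaves a coefficient of value 1 at value 1. *)
- exists i; rewrite coef_poly im; case: eqP => _; rewrite ?mulr1n ?mulr0n ?addr0//.
  by rewrite (ultrametric_eq vU) ?vi.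
Qed.

(** The valuation ring of v on k is the localization of the ring of integers at the prime ideal of
    v. Primitivity of the equation of x supplies the unit coefficient from which the descent
    starts. *)
Lemma integral_fraction v p x : lies_over v p -> v x <= 1 ->
  exists s, [/\ alg_integer s, alg_integer (s * x) & v s = 1].
Proof.
move=> vp vx; have [f cf fx] := primitive_int_poly x.
apply: (integral_fraction_poly vp vx (leqnn _) _ fx).
  by move=> i; rewrite coef_map; apply: alg_integer_int.
apply: contrapT => /forallNP h.
have : (p%:Z %| zcontents f)%Z.
  rewrite dvdz_contents; apply/polyOverP => i.
  apply: contrapT => pi; apply: (h i); rewrite coef_map.
  by apply: (lies_over_coprime vp); apply/negP.
rewrite cf => h1; have : (p %| 1)%N by [].
by rewrite dvdn1 => /eqP p1; have := vp.1; rewrite p1.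
Qed.

(* The quotient of the ring of integers by the prime ideal of v is a field. *)
Lemma alg_integer_unit v p s : lies_over v p -> alg_integer s -> v s = 1 ->
  exists (t : k) (c : int),
    [/\ alg_integer t, ~~ (p %| `|c|)%N & v (c%:~R + s * t) < 1].
Proof.
move=> vp hs vs; have vU := lies_over_ultrametric vp.
have [f fmon fs] : exists2 f : {poly int}, f \is monic & root (map_poly (intr : int -> k) f) s := hs.
have ex : exists i, ~~ (p %| `|(f`_i)%R|)%N.
  exists (size f).-1; rewrite -lead_coefE (monicP fmon) /= dvdn1.
  by apply/eqP => p1; have := vp.1; rewrite p1.
(* Modulo p, f is X^j (f_j + X h) with f_j a unit and h(s) = t; since s^j is a unit at v, the factor
   f_j + s t must vanish there. *)
have [j fj minj] := ex_minnP ex.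
pose t := (map_poly (intr : int -> k) (drop_poly j.+1 f)).[s].
exists t, f`_j; split => //; first exact: alg_integer_horner.
have dE : drop_poly j f = (f`_j)%:P + drop_poly j.+1 f * 'X.
  apply/polyP => i; rewrite coefD coefC coefMX !coef_drop_poly.
  by case: i => [|i] /=; rewrite ?addr0// add0r addSnnS.
have fE : map_poly (intr : int -> k) f = map_poly intr (take_poly j f) +
    map_poly intr (drop_poly j f) * 'X^j.
  by rewrite -{1}(poly_take_drop j f) rmorphD rmorphM /= map_polyXn.
have e : s ^+ j * ((f`_j)%:~R + s * t) = - (map_poly (intr : int -> k) (take_poly j f)).[s].
  apply/eqP; rewrite -addr_eq0 -(eqP fs) fE hornerD hornerM hornerXn dE.
  rewrite rmorphD rmorphM /= map_polyX map_polyC hornerD hornerM hornerX hornerC.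
  by rewrite -/t; apply/eqP; ring.
have : v (s ^+ j * ((f`_j)%:~R + s * t)) < 1.
  rewrite e avN horner_coef; apply: (ultrametric_sum_lt vU) => // i _.
  rewrite avM absvalX vs expr1n mulr1 coef_map coef_take_poly /=.
  case: ifP => ij; last by rewrite av0.
  apply: (lies_over_dvd vp); apply/negPn/negP => /minj.
  by rewrite leqNgt ij.
by rewrite avM absvalX vs expr1n mul1r.
Qed.

(** Containment suffices because these prime ideals are maximal: by [alg_integer_unit], v s = 1
    forces w s = 1, so the valuation ring of v lies in that of w. Scaling x^n by a power of p then
    gives (w x)^n <= p (v x)^n. *)
Lemma prime_ideal_inj (v w : absval R k) p q : lies_over v p -> lies_over w q ->
  (forall x, alg_integer x -> v x < 1 -> w x < 1) -> forall x, v x = w x.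
Proof.
move=> vp wq vw.
have wp : lies_over w p.
  have h : w p%:R < 1.
    apply: vw; first exact: alg_integer_nat.
    by rewrite (lies_over_p vp) invf_lt1 ?ltr0n ?ltr1n ?prime_gt0 ?prime_gt1 ?(vp.1).
  have [pq|npq] := boolP (q %| p)%N.
    by have := pq; rewrite dvdn_prime2 ?(vp.1) ?(wq.1)// => /eqP <-.
  by have := @lies_over_coprime _ _ _ _ p wq npq; rewrite -pmulrn => h1; rewrite h1 ltxx in h.
have wU := lies_over_ultrametric wp.
have unit s : alg_integer s -> v s = 1 -> w s = 1.
  move=> hs vs; have [t [c [ht pc hst]]] := alg_integer_unit vp hs vs.
  have h : w (c%:~R + s * t) < 1.
    by apply: vw hst; apply: alg_integerD; [exact: alg_integer_int|exact: alg_integerM].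
  have wc := lies_over_coprime wp pc.
  have ws := alg_integer_le1 wp hs; have wt := alg_integer_le1 wp ht.
  apply/eqP; rewrite eq_le ws /= leNgt; apply/negP => ws1.
  have wst : w (s * t) < 1.
    by rewrite avM; apply: le_lt_trans ws1; rewrite -[leRHS]mulr1 ler_wpM2l ?av_ge0.
  have := ultrametricB_lt wU h wst.
  by rewrite addrK wc ltxx.
have le1 x : v x <= 1 -> w x <= 1.
  move=> vx; have [s [hs hsx vs]] := integral_fraction vp vx.
  have := alg_integer_le1 wp hsx; rewrite avM (unit _ hs vs) mul1r //.
have pp := vp.1.
have le x : x != 0 -> w x <= v x.
  move=> x0; have vx0 : 0 < v x by rewrite absval_gt0.
  apply: (@ler_of_expM _ _ p%:R) => // n.
  have [a /andP[h1 h2]] := int_pow_approx pp (exprn_gt0 n vx0).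
  apply: le_trans h2.
  have p0 : 0 < p%:R ^ a :> R by rewrite exprz_gt0// ltr0n prime_gt0.
  have ue u : lies_over u p -> u (p%:R ^ a) = (p%:R ^ a)^-1 :> R.
    move=> up; case: a {h1 p0} => m.
      by rewrite -!exprnP absvalX (lies_over_p up) exprVn.
    by rewrite NegzE -!exprnN avV absvalX (lies_over_p up) exprVn.
  have := le1 (x ^+ n * p%:R ^ a); rewrite !avM !ue// !absvalX.
  by rewrite !ler_pdivrMr// !mul1r; apply.
move=> x; have [->|x0] := eqVneq x 0; first by rewrite !av0.
apply/eqP; rewrite eq_le le// andbT.
have := le _ (invr_neq0 x0); rewrite !avV lef_pV2// posrE absval_gt0//.
Qed.

End Fractions.

(** * Completions and local degrees *)

Section FiniteSpan.
Variables (R : realType) (K : fieldType) (N : absval R K) (A : set K).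
Hypotheses (A1 : A 1) (AB : forall x y, A x -> A y -> A (x - y)).
Hypotheses (AM : forall x y, A x -> A y -> A (x * y)) (AV : forall x, A x -> A x^-1).

Definition complete_set (V : set K) := forall u : nat -> K, (forall n, V (u n)) ->
  av_cauchy N u -> exists2 l, V l & av_null N (fun n => u n - l).

Hypothesis Acomplete : complete_set A.

Definition span (b : nat -> K) n : set K :=
  [set y | exists2 c : nat -> K, (forall i, A (c i)) & y = \sum_(i < n) c i * b i].

Lemma subfield_set0 : A 0. Proof. by rewrite -(subrr 1); apply: AB. Qed.

Lemma subfield_setN x : A x -> A (- x).
Proof. by move=> Ax; rewrite -sub0r; apply: AB => //; apply: subfield_set0. Qed.

Lemma subfield_setD x y : A x -> A y -> A (x + y).
Proof. by move=> Ax Ay; rewrite -[y]opprK; apply: AB => //; apply: subfield_setN. Qed.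

Lemma subfield_set_nat n : A n%:R.
Proof.
elim: n => [|n IH]; first exact: subfield_set0.
by rewrite -natr1; apply: subfield_setD.
Qed.

Lemma subfield_set_sum (I : Type) (r : seq I) (P : pred I) (f : I -> K) :
  (forall i, A (f i)) -> A (\sum_(i <- r | P i) f i).
Proof.
move=> h; elim/big_rec: _ => [|i a _ ha]; first exact: subfield_set0.
exact: subfield_setD.
Qed.

Lemma spanB b n x y : span b n x -> span b n y -> span b n (x - y).
Proof.
move=> [c Ac ->] [d Ad ->]; exists (fun i => c i - d i); first by move=> i; apply: AB.
by rewrite -sumrB; apply: eq_bigr => i _; rewrite mulrBl.
Qed.

Lemma spanZ b n a x : A a -> span b n x -> span b n (a * x).
Proof.
move=> Aa [c Ac ->]; exists (fun i => a * c i); first by move=> i; apply: AM.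
by rewrite mulr_sumr; apply: eq_bigr => i _; rewrite mulrA.
Qed.

Lemma span0 b n : span b n 0.
Proof.
exists (fun=> 0) => [i|]; first exact: subfield_set0.
by rewrite big1// => i _; rewrite mul0r.
Qed.

Lemma spanN b n x : span b n x -> span b n (- x).
Proof. by move=> h; rewrite -sub0r; apply: spanB => //; apply: span0. Qed.

Lemma spanD b n x y : span b n x -> span b n y -> span b n (x + y).
Proof. by move=> hx hy; rewrite -[y]opprK; apply: spanB => //; apply: spanN. Qed.

Lemma spanS b n y : span b n.+1 y <-> exists x a, [/\ span b n x, A a & y = x + a * b n].
Proof.
split=> [[c Ac ->]|[_ [a [[c Ac ->] Aa ->]]]].
  by exists (\sum_(i < n) c i * b i), (c n); split; [exists c| |rewrite big_ord_recr].
exists (fun i => if (i < n)%N then c i else a) => [i|]; first by case: ifP.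
rewrite big_ord_recr /= ltnn; congr (_ + _).
by apply: eq_bigr => i _; rewrite ltn_ord.
Qed.

Lemma null_unique (u : nat -> K) l m :
  av_null N (fun n => u n - l) -> av_null N (fun n => u n - m) -> l = m.
Proof.
move=> ul um; apply/eqP; rewrite -subr_eq0 -(av_eq0 N) eq_le av_ge0 andbT.
apply/ler_addgt0Pr => e e0; rewrite add0r.
have e20 : 0 < e / 2 by rewrite divr_gt0.
have [n1 h1] := ul _ e20; have [n2 h2] := um _ e20.
have := av_split N (u (maxn n1 n2)) l m.
have := h1 _ (leq_maxl n1 n2); have := h2 _ (leq_maxr n1 n2).
by rewrite (av_distC N l (u _)); lra.
Qed.

Lemma inv_nat_small (e : R) : 0 < e ->
  exists n0 : nat, forall n, (n0 <= n)%N -> n.+1%:R^-1 < e.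
Proof.
move=> e0; have [n0 h] := ltr_add_invr (ltac:(by rewrite e0) : 0 < e).
exists n0 => n n0n; apply: le_lt_trans (_ : n0.+1%:R^-1 < _); last first.
  by move: h; rewrite add0r.
by rewrite lef_pV2 ?posrE// ler_nat ltnS.
Qed.

Lemma complete_set_closed V y : complete_set V ->
  (forall e, 0 < e -> exists2 x, V x & N (y - x) < e) -> V y.
Proof.
move=> cV h.
have /choice[u hu] : forall n, exists x, V x /\ N (y - x) < n.+1%:R^-1.
  move=> n; have [|x Vx hx] := h n.+1%:R^-1; first by rewrite invr_gt0.
  by exists x.
have nu : av_null N (fun n => u n - y).
  move=> e /inv_nat_small[n0 hn]; exists n0 => n /hn; apply: lt_trans.
  by rewrite av_distC; case: (hu n).
have cu : av_cauchy N u.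
  move=> e e0; have [n0 hn] := av_null_cauchy nu e0; exists n0 => m n hm hn'.
  have -> : u m - u n = (u m - y) - (u n - y) by ring.
  exact: hn.
have [l Vl nl] := cV u (fun n => (hu n).1) cu.
by rewrite (null_unique nu nl).
Qed.

Lemma av_null_cst (V : K -> K) x : (forall y, N (V y) = N y * x) -> forall u,
  av_null N u -> av_null N (fun n => V (u n)).
Proof.
move=> hV u nu e e0; have x1 : 0 < `|x| + 1 by rewrite ltr_pwDr.
have [n0 h] := nu _ (divr_gt0 e0 x1); exists n0 => n hn; rewrite hV.
have := h n hn; rewrite ltr_pdivlMr//; apply: le_lt_trans.
rewrite ler_wpM2l ?av_ge0//; apply: le_trans (ler_norm _) _.
by rewrite lerDl.
Qed.

(* A finitely generated A-module is complete: adding a generator y outside the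
   complete span V of the others, y is at positive distance from V, so that the
   coefficients of y along a Cauchy sequence are Cauchy. *)
Lemma span_complete b n : complete_set (span b n).
Proof.
elim: n => [|n IH] u Vu cu.
  exists 0; first exact: span0.
  by move=> e e0; exists 0%N => m _; have [c _ ->] := Vu m; rewrite big_ord0 subrr av0.
have [bn|bn] := pselect (span b n (b n)).
  have h x : span b n.+1 x -> span b n x.
    by move=> /spanS[y [a [hy Aa ->]]]; apply: spanD => //; apply: spanZ.
  have [l Vl nl] := IH u (fun m => h _ (Vu m)) cu.
  exists l => //; apply/spanS; exists l, 0; split => //; first exact: subfield_set0.
  by rewrite mul0r addr0.
have [d d0 hd] : exists2 d : R, 0 < d & forall x, span b n x -> d <= N (b n - x).
  apply: contrapT => hno; apply: bn; apply: (complete_set_closed IH) => e e0.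
  apply: contrapT => hn; apply: hno; exists e => // x hx; rewrite leNgt.
  by apply/negP => lt; apply: hn; exists x.
have dist x a : span b n x -> A a -> N a * d <= N (x + a * b n).
  move=> hx Aa; have [->|a0] := eqVneq a 0; first by rewrite av0 mul0r av_ge0.
  have -> : x + a * b n = a * (b n - (- (a^-1 * x))) by field.
  rewrite avM ler_wpM2l ?av_ge0//; apply: hd.
  by apply: spanN; apply: spanZ => //; apply: AV.
have /choice[f hf] : forall m, exists xa : K * K,
    [/\ span b n xa.1, A xa.2 & u m = xa.1 + xa.2 * b n].
  by move=> m; have /spanS[x [a h]] := Vu m; exists (x, a).
pose x m := (f m).1; pose a m := (f m).2.
have hx m : span b n (x m) by case: (hf m).
have ha m : A (a m) by case: (hf m).
have hu m : u m = x m + a m * b n by case: (hf m).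
have ca : av_cauchy N a.
  move=> e e0; have [n0 h] := cu (e * d) (mulr_gt0 e0 d0).
  exists n0 => i j hi hj; rewrite -(ltr_pM2r d0); apply: le_lt_trans (h i j hi hj).
  have -> : u i - u j = (x i - x j) + (a i - a j) * b n by rewrite !hu; ring.
  by apply: dist; [apply: spanB|apply: AB].
have [al Aal nal] := Acomplete ha ca.
have nab : av_null N (fun m => (a m - al) * b n).
  by apply: (av_null_cst (V := fun y => y * b n) (x := N (b n))) nal => y; rewrite avM.
have cx : av_cauchy N x.
  have -> : x = u - (fun m => a m * b n).
    by apply/funext => m; rewrite !fctE hu addrK.
  apply: av_cauchyB => //; apply: (av_cauchyM ca); exact: av_cauchy_const.
have [xl hxl nxl] := IH x hx cx.
exists (xl + al * b n); first by apply/spanS; exists xl, al.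
have -> : (fun m => u m - (xl + al * b n)) = (fun m => x m - xl) + (fun m => (a m - al) * b n).
  by apply/funext => m; rewrite !fctE hu; ring.
exact: av_nullD.
Qed.

Definition independent (b : nat -> K) n := forall c : nat -> K, (forall i, A (c i)) ->
  \sum_(i < n) c i * b i = 0 -> forall i, (i < n)%N -> c i = 0.

Lemma span_eq_prefix b b' n : (forall i, (i < n)%N -> b i = b' i) ->
  span b n `<=` span b' n.
Proof.
move=> h _ [c Ac ->]; exists c => //.
by apply: eq_bigr => i _; rewrite h.
Qed.

Lemma span_independent b n : exists b' m, independent b' m /\ span b n `<=` span b' m.
Proof.
elim: n => [|n [b' [m [ib' sb]]]].
  by exists b, 0%N; split.
have [bn|bn] := pselect (span b' m (b n)).
  exists b', m; split => // y /spanS[x [a [hx Aa ->]]].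
  by apply: spanD; [apply: sb|apply: spanZ].
pose b2 i := if (i < m)%N then b' i else b n.
have b2E i : (i < m)%N -> b' i = b2 i by rewrite /b2 => ->.
have b2m : b2 m = b n by rewrite /b2 ltnn.
exists b2, m.+1; split; last first.
  move=> y /spanS[x [a [hx Aa ->]]]; apply/spanS; exists x, a; split => //.
    by apply: (span_eq_prefix b2E); apply: sb.
  by rewrite b2m.
move=> c Ac; rewrite big_ord_recr /= b2m => h.
have e : \sum_(i < m) c i * b2 i = \sum_(i < m) c i * b' i.
  by apply: eq_bigr => i _; rewrite b2E.
have cm : c m = 0.
  apply/eqP/negPn/negP => cm; apply: bn.
  exists (fun i => - (c m)^-1 * c i).
    by move=> i; apply: AM => //; apply: subfield_setN; apply: AV.
  apply: (mulfI cm); rewrite mulr_sumr.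
  move/eqP: h; rewrite e addrC addr_eq0 => /eqP ->; rewrite -sumrN.
  by apply: eq_bigr => i _; field.
move: h; rewrite cm mul0r addr0 e => h i.
by rewrite ltnS leq_eqVlt => /predU1P[->//|]; apply: ib'.
Qed.

Lemma basis_over_independent b n : independent b n -> (forall y, span b n y) ->
  basis_over A (fun i : 'I_n => b i).
Proof.
move=> ib sb y; have [c Ac ->] := sb y.
exists [ffun i : 'I_n => c i]; split.
  by split=> [i|]; [rewrite ffunE|apply: eq_bigr => i _; rewrite ffunE].
move=> c' [Ac' /eqP]; rewrite -subr_eq0 -sumrB => /eqP h.
pose d i := if insub i is Some j then c i - c' j else 0.
apply/ffunP => i; rewrite ffunE; apply/eqP; rewrite -subr_eq0; apply/eqP.
have := ib d _ _ i (ltn_ord i); rewrite /d valK; apply.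
  by move=> j; case: insubP => [j' _ _|_]; [apply: AB|apply: subfield_set0].
rewrite -[RHS]h; apply: eq_bigr => j _; rewrite valK mulrBl.
by [].
Qed.

(** Uniqueness of coordinates gives C D = 1 for the two change-of-basis matrices, and ranks can be
    taken over K although the coefficients lie in A. This makes [local_degree] well defined. *)
Lemma basis_over_dim m n (b : 'I_m -> K) (b' : 'I_n -> K) :
  basis_over A b -> basis_over A b' -> m = n.
Proof.
suff le i j (c : 'I_i -> K) (c' : 'I_j -> K) :
    basis_over A c -> basis_over A c' -> (i <= j)%N.
  by move=> hb hb'; apply/eqP; rewrite eqn_leq (le _ _ _ _ hb hb') (le _ _ _ _ hb' hb).
move=> hc hc'.
have /choice[f hf] : forall a : 'I_i, exists e : {ffun 'I_j -> K},
    (forall l, A (e l)) /\ c a = \sum_l e l * c' l.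
  by move=> a; have [e [he _]] := hc' (c a); exists e.
have /choice[g hg] : forall l : 'I_j, exists e : {ffun 'I_i -> K},
    (forall a, A (e a)) /\ c' l = \sum_a e a * c a.
  by move=> l; have [e [he _]] := hc (c' l); exists e.
pose C := \matrix_(a, l) f a l; pose D := \matrix_(l, a) g l a.
have CD : C *m D = 1%:M.
  apply/matrixP => a a'; have [e [_ he]] := hc (c a).
  have h1 := he [ffun a' => (C *m D) a a'] _; have h2 := he [ffun a' => (a == a')%:R] _.
  have : [ffun a' => (C *m D) a a'] = [ffun a' => (a == a')%:R : K].
    rewrite -h1; [rewrite -h2//|]; split.
    - by move=> x; rewrite ffunE; apply: subfield_set_nat.
    - rewrite (bigD1 a)//= ffunE eqxx mul1r big1 ?addr0// => x xa.
      by rewrite ffunE eq_sym (negbTE xa) mul0r.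
    - move=> x; rewrite ffunE mxE; apply: subfield_set_sum => l.
      by rewrite !mxE; apply: AM; [case: (hf a)|case: (hg l)].
    - have [_ ->] := hf a; under [RHS]eq_bigr do rewrite ffunE mxE mulr_suml.
      rewrite exchange_big; apply: eq_bigr => l _; have [_ ->] := hg l.
      by rewrite mulr_sumr; apply: eq_bigr => x _; rewrite !mxE mulrA.
  by move=> /ffunP/(_ a'); rewrite !ffunE => ->; rewrite mxE.
rewrite -(mxrank1 K i) -CD; apply: leq_trans (mxrankM_maxl _ _) _.
exact: rank_leq_col.
Qed.

End FiniteSpan.

(** * The closure of Q in a completion *)

Section ClosureOfRat.
Variables (R : realType) (k : fieldExtType rat) (v : absval R k) (C : completion v).
Local Notation N := (comp_av C).
Local Notation emb := (comp_emb C).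

(** This is [compl_rat] for an arbitrary absolute value and an arbitrary completion of it. *)
Definition closure_rat : set C :=
  [set y | forall e : R, 0 < e -> exists q : rat, N (y - emb q%:A) < e].

Local Notation A := closure_rat.

Lemma comp_emb_rat (q : rat) : A (emb q%:A).
Proof. by move=> e e0; exists q; rewrite subrr av0. Qed.

Lemma compl_rat1 : A 1.
Proof. by have := comp_emb_rat 1; rewrite scale1r rmorph1. Qed.

Lemma compl_ratB x y : A x -> A y -> A (x - y).
Proof.
move=> hx hy e e0; have e20 : 0 < e / 2 by rewrite divr_gt0.
have [q hq] := hx _ e20; have [r hr] := hy _ e20; exists (q - r).
rewrite scalerBl rmorphB.
have -> : x - y - (emb q%:A - emb r%:A) = (x - emb q%:A) + - (y - emb r%:A) by ring.
by have := av_triangle N (x - emb q%:A) (- (y - emb r%:A)); rewrite avN; lra.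
Qed.

Lemma compl_ratM x y : A x -> A y -> A (x * y).
Proof.
move=> hx hy e e0; have e20 : 0 < e / 2 by rewrite divr_gt0.
have x1 : 0 < N x + 1 by rewrite ltr_wpDl ?av_ge0.
have y1 : 0 < N y + 1 by rewrite ltr_wpDl ?av_ge0.
have m0 : 0 < Num.min 1 (e / 2 / (N x + 1)) by rewrite lt_min ltr01 !divr_gt0.
have [r] := hy _ m0; rewrite lt_min => /andP[hr1 hr].
have [q hq] := hx _ (divr_gt0 e20 y1); exists (q * r).
have -> : (q * r)%:A = q%:A * r%:A :> k by rewrite -scalerAl mul1r scalerA.
rewrite rmorphM.
have -> : x * y - emb q%:A * emb r%:A = x * (y - emb r%:A) + (x - emb q%:A) * emb r%:A by ring.
apply: le_lt_trans (av_triangle _ _ _) _; rewrite !avM.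
have Nr : N (emb r%:A) <= N y + 1.
  have := av_triangle N y (- (y - emb r%:A)); rewrite avN opprB addrC subrK.
  by lra.
have t1 : N x * N (y - emb r%:A) <= e / 2.
  move: hr; rewrite ltr_pdivlMr// => /ltW; apply: le_trans.
  by rewrite mulrC ler_wpM2l ?av_ge0// lerDl.
have t2 : N (x - emb q%:A) * N (emb r%:A) < e / 2.
  move: hq; rewrite ltr_pdivlMr//; apply: le_lt_trans.
  by rewrite ler_wpM2l ?av_ge0.
by rewrite [e]splitr ler_ltD.
Qed.

Lemma compl_ratV x : A x -> A x^-1.
Proof.
have [->|x0] := eqVneq x 0; first by rewrite invr0.
move=> hx e e0; have Nx : 0 < N x by rewrite absval_gt0.
(* The first bound keeps the approximation q away from 0, with N q >= N x / 2; the second is the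
   error allowed before inversion. *)
have m0 : 0 < Num.min (N x / 2) (e * (N x * (N x / 2))).
  by rewrite lt_min divr_gt0//= mulr_gt0// mulr_gt0// divr_gt0.
have [q] := hx _ m0; rewrite lt_min => /andP[h1 h2]; exists q^-1.
have Nq : N x / 2 <= N (emb q%:A).
  have := av_triangle N (x - emb q%:A) (emb q%:A); rewrite subrK.
  by lra.
have Nq0 : 0 < N (emb q%:A) by apply: lt_le_trans Nq; rewrite divr_gt0.
have q0 : emb q%:A != 0 by rewrite -(absval_gt0 N).
have -> : emb (q^-1)%:A = (emb q%:A)^-1 by rewrite -!in_algE !fmorphV.
have -> : x^-1 - (emb q%:A)^-1 = - (x - emb q%:A) / (x * emb q%:A).
  by field; rewrite x0 q0.
rewrite avM avV avN avM ltr_pdivrMr ?mulr_gt0//; apply: lt_le_trans h2 _.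
by rewrite ler_wpM2l ?(ltW e0)// ler_wpM2l ?(ltW Nx).
Qed.

Lemma compl_rat_complete : complete_set N A.
Proof.
move=> u Au cu; have [l nl] := comp_complete cu; exists l => // e e0.
have e20 : 0 < e / 2 by rewrite divr_gt0.
have [n0 h] := nl _ e20; have [q hq] := Au n0 _ e20; exists q.
have := av_split N (u n0) l (emb q%:A); have := h n0 (leqnn _).
by rewrite (av_distC N l (u _)); lra.
Qed.

(** The image of k is dense and lies in the span of a Q-basis of k over the closure of Q; that span
    is complete, hence closed, hence everything. *)
Lemma exists_local_basis : exists n (b : 'I_n -> C), basis_over A b.
Proof.
pose b i := emb (vbasis {:k})`_i.
have dense y : span A b (\dim {:k}) y.
  have cV := @span_complete _ _ N A compl_rat1 compl_ratB compl_ratM compl_ratV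
    compl_rat_complete b (\dim {:k}).
  apply: (complete_set_closed cV) => e e0.
  have [x hx] := comp_dense y e0; exists (emb x) => //.
  pose c i := if insub i is Some j then coord (vbasis {:k}) j x else 0.
  exists (fun i => emb (c i)%:A); first by move=> i; apply: comp_emb_rat.
  rewrite {1}(coord_vbasis (memvf x)) rmorph_sum; apply: eq_bigr => i _ /=.
  by rewrite -rmorphM /c valK -scalerAl mul1r.
have [b' [m [ib' sb]]] := span_independent compl_rat1 compl_ratB compl_ratM compl_ratV b (\dim {:k}).
exists m, (fun i => b' i); apply: basis_over_independent => //.
- exact: compl_rat1.
- exact: compl_ratB.
- by move=> y; apply: sb.
Qed.

End ClosureOfRat.

Section LocalDegree.
Variables (R : realType) (k : fieldExtType rat) (v : place R k).

Lemma local_degreeE n (b : 'I_n -> compl v) :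
  basis_over (@compl_rat R k v) b -> local_degree v = n.
Proof.
move=> hb; rewrite /local_degree; case: xgetP => [m _ [b' hb']|/(_ n)]; last first.
  by case; exists b.
exact: (basis_over_dim (@compl_rat1 _ _ _ (compl v)) (@compl_ratB _ _ _ (compl v))
  (@compl_ratM _ _ _ (compl v)) hb' hb).
Qed.

Lemma local_degree_gt0 : (0 < local_degree v)%N.
Proof.
have [n [b hb]] := exists_local_basis (compl v); rewrite (local_degreeE hb) lt0n.
apply/eqP => n0; move: b hb; rewrite n0 => b hb.
have [c [[_ /eqP]]] := hb 1.
by rewrite big_ord0 oner_eq0.
Qed.

End LocalDegree.

Lemma exprn_small (R : realType) (r e : R) : 0 < r < 1 -> 0 < e -> exists n : nat, r ^+ n < e.
Proof.
move=> /andP[r0 r1] e0; apply: contrapT => /forallNP h.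
suff : 1 <= r by rewrite leNgt r1.
apply: (@ler_of_expM _ _ e^-1) => // n; rewrite expr1n mulrC ler_pdivlMr// mul1r leNgt.
exact/negP/h.
Qed.

(** * Powers of a uniformizer when the residue field is F_p *)

Section Ramification.
Variables (R : realType) (k : fieldExtType rat) (v : absval R k) (C : completion v).
Local Notation N := (comp_av C).
Local Notation emb := (comp_emb C).
Local Notation A := (@closure_rat R k v C).
Variables (p : nat) (vp : lies_over v p) (pi : C).
Hypothesis pi_unif : forall y : C, N y < 1 <-> exists2 z, N z <= 1 & y = pi * z.
Hypothesis residue : forall x : k, alg_integer x -> exists n : nat, v (x - n%:R) < 1.

Let pp : prime p := vp.1.
Let vU := lies_over_ultrametric vp.

Lemma comp_nat n : N n%:R = v n%:R.
Proof. by rewrite -(rmorph_nat emb) comp_embE. Qed.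

Lemma comp_ultrametric : ultrametric_absval N.
Proof. by apply: ultrametric_of_nat => n; rewrite comp_nat (lies_over_nat_le1 _ vp). Qed.

Lemma inverse_mod (a : nat) : v a%:R = 1 -> exists a' : nat, v ((a * a')%:R - 1) < 1.
Proof.
move=> va; have pa : ~~ (p %| a)%N.
  by apply/negP => /(lies_over_dvd (a := a) vp); rewrite -pmulrn va ltxx.
have a0 : (0 < a)%N by rewrite lt0n; apply: contraNneq pa => ->.
have : coprime a p by rewrite coprime_sym prime_coprime.
move=> /(coprimeP _ a0)[[u w] /= h].
have hu : (u * a = 1 + w * p)%N by rewrite -h subnK// ltnW// -subn_gt0 h.
exists u; rewrite mulnC hu natrD addrAC subrr add0r.
by have := @lies_over_dvd _ _ _ _ (w * p)%N vp; apply; rewrite dvdn_mull.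
Qed.

Lemma residue_local (x : k) : v x <= 1 -> exists n : nat, v (x - n%:R) < 1.
Proof.
move=> vx; have [s [hs hsx vs]] := integral_fraction vp vx.
have [a ha] := residue hs; have [b hb] := residue hsx.
have va : v a%:R = 1.
  rewrite -vs -[RHS](avN v) -(ultrametric_eq vU (x := - s) (y := s - a%:R)).
    by rewrite addKr avN.
  by rewrite avN vs.
have [a' ha'] := inverse_mod va; exists (b * a')%N.
suff : v (s * (x - (b * a')%:R)) < 1 by rewrite avM vs mul1r.
have -> : s * (x - (b * a')%:R) = (s * x - b%:R) -
    (b%:R * ((a * a')%:R - 1) + b%:R * a'%:R * (s - a%:R)).
  by rewrite !natrM; ring.
have le1 m := lies_over_nat_le1 m vp.
apply: (ultrametricB_lt vU) => //; apply: le_lt_trans (vU _ _) _; rewrite gt_max !avM.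
apply/andP; split.
  by apply: le_lt_trans ha'; rewrite -[leRHS]mul1r ler_wpM2r ?av_ge0 ?le1.
apply: le_lt_trans ha; rewrite -[leRHS]mul1r ler_wpM2r ?av_ge0//.
by rewrite -avM -natrM le1.
Qed.

Lemma residue_comp y : N y <= 1 -> exists n : nat, N (y - n%:R) < 1.
Proof.
move=> Ny; have [x hx] := comp_dense y ltr01.
have vx : v x <= 1.
  rewrite -(comp_embE C) -[emb x](subKr y).
  by apply: (ultrametricB comp_ultrametric) => //; apply: ltW.
have [n hn] := residue_local vx; exists n.
have -> : y - n%:R = (y - emb x) + emb (x - n%:R) by rewrite rmorphB rmorph_nat addrA subrK.
apply: le_lt_trans (comp_ultrametric _ _) _.
by rewrite gt_max hx comp_embE.
Qed.

Lemma unif_lt1 : N pi < 1.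
Proof. by apply/pi_unif; exists 1; rewrite ?av1// mulr1. Qed.

Lemma comp_p : N p%:R = p%:R^-1.
Proof. by rewrite comp_nat (lies_over_p vp). Qed.

Lemma p_inv_lt1 : 0 < (p%:R^-1 : R) < 1.
Proof.
by rewrite invr_gt0 ltr0n prime_gt0//= invf_lt1 ?ltr0n ?prime_gt0// ltr1n prime_gt1.
Qed.

Lemma unif_gt0 : 0 < N pi.
Proof.
have [p0 p1] := andP p_inv_lt1.
have /pi_unif[z _ hz] : N p%:R < 1 by rewrite comp_p.
rewrite absval_gt0; apply/eqP => pi0.
by have := comp_p; rewrite hz pi0 mul0r av0 => h; rewrite -h ltxx in p0.
Qed.

(** [M] bounds the number of times pi can be divided out of y. *)
Lemma value_group M y : N pi ^+ M < N y -> N y <= 1 -> exists m : nat, N y = N pi ^+ m.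
Proof.
elim: M => [|M IH] in y *.
  by rewrite expr0 => h1 h2; have := lt_le_trans h1 h2; rewrite ltxx.
move=> h; rewrite le_eqVlt => /predU1P[->|]; first by exists 0%N; rewrite expr0.
move=> /pi_unif[z z1 yE]; move: h; rewrite yE avM exprS ltr_pM2l ?unif_gt0// => h.
have [m ->] := IH z h z1; exists m.+1; by rewrite exprS.
Qed.

Lemma ramification_index : exists2 e : nat, (0 < e)%N & N pi ^+ e = p%:R^-1.
Proof.
have [p0 p1] := andP p_inv_lt1.
have u01 : 0 < N pi < 1 by rewrite unif_gt0 unif_lt1.
have [M hM] := exprn_small u01 p0.
rewrite -comp_p in hM; have Np1 : N p%:R <= 1 by rewrite comp_p ltW.
have [m hm] := value_group hM Np1.
exists m; last by rewrite -hm comp_p.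
by rewrite lt0n; apply/eqP => m0; have := p1; rewrite -comp_p hm m0 expr0 ltxx.
Qed.

Variables (e : nat) (e0 : (0 < e)%N) (pi_e : N pi ^+ e = p%:R^-1).
Local Notation b := (fun i => pi ^+ i).

Let AM := (@compl_ratM _ _ _ C).
Let AB := (@compl_ratB _ _ _ C).
Let A1 := (@compl_rat1 _ _ _ C).
Let AV := (@compl_ratV _ _ _ C).
Let A_nat := subfield_set_nat A1 AB.

Lemma digit_expansion j y : N y <= 1 ->
  exists x z, [/\ span A b j x, N z <= 1 & y = x + pi ^+ j * z].
Proof.
move=> Ny; elim: j => [|j [x [z [hx hz yE]]]].
  by exists 0, y; split; rewrite ?add0r ?mul1r//; apply: span0.
have [n /pi_unif[z' hz' zE]] := residue_comp hz.
exists (x + n%:R * pi ^+ j), z'; split => //.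
  by apply/spanS => //; exists x, n%:R.
rewrite yE -addrA; congr (_ + _); rewrite exprSr -mulrA -zE.
by ring.
Qed.

(** After e digits the remainder pi^e z equals p z' with N z' <= 1, so the expansion restarts on z',
    and its digits join the same e coefficients, scaled by p. *)
Lemma span_approx M y : N y <= 1 -> exists2 x, span A b e x & N (y - x) <= p%:R^-1 ^+ M.
Proof.
elim: M => [|M IH] in y * => Ny.
  by exists 0; [exact: span0|rewrite subr0 expr0].
have [x [z [hx hz yE]]] := digit_expansion e Ny.
have p0 : p%:R != 0 :> C.
  by rewrite -(absval_gt0 N) comp_p; case/andP: p_inv_lt1.
pose z' := pi ^+ e * z / p%:R.
have hz' : N z' <= 1.
  by rewrite /z' !avM absvalX pi_e avV comp_p mulrAC divff ?mul1r// gt_eqF//; case/andP: p_inv_lt1.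
have [x' hx' h] := IH _ hz'; exists (x + p%:R * x').
  by apply: spanD => //; apply: spanZ.
have -> : y - (x + p%:R * x') = p%:R * (z' - x').
  by rewrite yE /z'; field.
by rewrite avM comp_p exprS ler_wpM2l// ltW//; case/andP: p_inv_lt1.
Qed.

Lemma span_unif_powers y : span A b e y.
Proof.
have cV := span_complete A1 AB AM AV (@compl_rat_complete _ _ _ C) (b := b) (n := e).
have small x : N x <= 1 -> span A b e x.
  move=> Nx; apply: (complete_set_closed cV) => eps eps0.
  have [M hM] := exprn_small p_inv_lt1 eps0.
  have [x' hx' h] := span_approx M Nx; exists x' => //.
  exact: le_lt_trans h hM.
have p0 : p%:R != 0 :> C.
  by rewrite -(absval_gt0 N) comp_p; case/andP: p_inv_lt1.
have [->|y0] := eqVneq y 0; first exact: span0.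
have Ny : 0 < (N y)^-1 by rewrite invr_gt0 absval_gt0.
have [M hM] := exprn_small p_inv_lt1 Ny.
have -> : y = p%:R^-1 ^+ M * (p%:R ^+ M * y) by rewrite mulrA -exprMn mulVf// expr1n mul1r.
apply: spanZ => //; first by rewrite exprVn; apply: AV; rewrite -natrX.
apply: small; rewrite avM absvalX comp_p -[N y]invrK ltW//.
by rewrite ltr_pdivrMr// mul1r.
Qed.

Lemma value_closure_rat c : A c -> c != 0 -> exists a : int, N c = N pi ^ (e%:Z * a).
Proof.
move=> Ac c0; have [q hq] := Ac (N c) ltac:(by rewrite absval_gt0).
have Ncq : N c = v q%:A.
  rewrite -(comp_embE C) (_ : emb q%:A = c + - (c - emb q%:A)); last by ring.
  by rewrite (ultrametric_eq comp_ultrametric)// avN.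
have q0 : q != 0 by apply: contraNneq c0 => q0; rewrite -(av_eq0 N) Ncq q0 scale0r av0.
rewrite Ncq (vp.2) /padic_abs (negbTE q0); set m := (_ - _).
by exists (- m); rewrite -exprz_exp -exprnP pi_e exprz_inv opprK.
Qed.

(** Nonzero elements of A have powers of (N pi)^e as values, so the nonzero terms c_j pi^j have
    exponents in distinct classes modulo e. The largest term is therefore unique and the sum cannot
    vanish. *)
Lemma independent_unif_powers : independent A b e.
Proof.
move=> c Ac sum0 i ie; apply/eqP/negPn/negP => ci.
have u0 := unif_gt0; have u1 : N pi != 1 by rewrite lt_eqF// unif_lt1.
pose F (j : 'I_e) := N (c j * pi ^+ j).
have [j0 _ jmax'] := @Order.TotalTheory.arg_maxP _ _ 'I_e (Ordinal ie) xpredT F isT.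
have jmax j : F j <= F j0 := jmax' j isT.
have Fj0 : 0 < F j0.
  apply: lt_le_trans (jmax (Ordinal ie)).
  by rewrite /F absval_gt0 mulf_neq0// expf_neq0// -(absval_gt0 N).
have lt j : j != j0 -> F j < F j0.
  move=> jj0; rewrite lt_neqAle jmax// andbT; apply/eqP => eF.
  have val (l : 'I_e) : 0 < F l -> exists a : int, F l = N pi ^ (e%:Z * a + l%:Z).
    move=> Fl; have cl : c l != 0.
      by apply: contraTneq Fl => cl; rewrite /F cl mul0r av0 ltxx.
    have [a ha] := value_closure_rat (Ac l) cl; exists a.
    by rewrite /F avM absvalX ha expfzDr// gt_eqF.
  have [a ha] := val j ltac:(by rewrite eF); have [a' ha'] := val j0 Fj0.
  have : N pi ^ (e%:Z * a + j%:Z) = N pi ^ (e%:Z * a' + j0%:Z) by rewrite -ha -ha'.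
  move=> /(ieexprIz u0 u1) h.
  have : (j%:Z = j0%:Z %[mod e])%Z.
    by have := congr1 (modz^~ e%:Z) h; rewrite ![(e%:Z * _)%R]mulrC !modzMDl.
  rewrite !modz_small ?ltz_nat ?ltn_ord// => -[] jj; move/eqP: jj0; apply.
  exact/val_inj.
move: sum0; rewrite (bigD1 j0)//= => h.
have := ultrametric_eq comp_ultrametric (x := c j0 * pi ^+ j0)
  (y := \sum_(j < e | j != j0) c j * pi ^+ j).
rewrite h av0 => h2; have := Fj0; rewrite /F -h2 ?ltxx//.
by apply: (ultrametric_sum_lt comp_ultrametric) => // j /lt.
Qed.

Lemma basis_unif_powers : basis_over A (fun i : 'I_e => pi ^+ i).
Proof.
apply: (basis_over_independent A1 AB independent_unif_powers).
exact: span_unif_powers.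
Qed.

(** An element of k closer to pi than N pi has the same value as pi, and clearing its denominator by
    a unit at v does not change that value. *)
Lemma integer_unif : exists2 x : k, alg_integer x & v x = N pi.
Proof.
have [x hx] := comp_dense pi unif_gt0.
have vx : v x = N pi.
  rewrite -(comp_embE C) (_ : emb x = pi + - (pi - emb x)); last by ring.
  by rewrite (ultrametric_eq comp_ultrametric)// avN.
have [|s [hs hsx vs]] := integral_fraction vp (x := x); first by rewrite vx ltW// unif_lt1.
by exists (s * x) => //; rewrite avM vs mul1r.
Qed.

Lemma unif_max (x : k) : v x < 1 -> v x <= N pi.
Proof.
rewrite -(comp_embE C) => /pi_unif[z hz ->].
by rewrite avM -[leRHS]mulr1 ler_wpM2l ?av_ge0.
Qed.

End Ramification.

Section ResidueDegreeOne.
Variables (R : realType) (k : fieldExtType rat) (v : place R k) (p : nat).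
Hypotheses (vp : lies_over v p) (f1 : residue_degree v = 1%N).

(** The basis element b of the residue field over F_p need not be 1. Writing 1 as n1 b and inverting
    n1 modulo p shows that b is itself congruent to a natural number. *)
Lemma residue_degree1 x : alg_integer x -> exists n : nat, v (x - n%:R) < 1.
Proof.
have [q [vq [b hb hres]]] : exists q, lies_over v q /\ exists2 b : 'I_1 -> k,
    (forall i, alg_integer (b i)) & forall x, alg_integer x ->
    exists! c : {ffun 'I_1 -> 'I_q}, v (x - \sum_i (c i)%:R * b i) < 1.
  move: f1; rewrite /residue_degree; case: xgetP => [y yE hy y1|_ //].
  by rewrite y1 in hy.
have qp := lies_over_uniq vq vp; move: hres; rewrite qp => hres {q vq qp}.
have vU := lies_over_ultrametric vp.
have res y : alg_integer y -> exists n : nat, v (y - n%:R * b ord0) < 1.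
  by move=> /hres[c [+ _]]; rewrite big_ord1; exists (c ord0).
have [n1 h1] := res 1 (alg_integer_nat _ 1).
have vb := alg_integer_le1 vp (hb ord0).
have le1 m := lies_over_nat_le1 m vp.
have v1 : v (n1%:R * b ord0) = 1.
  rewrite -(av1 v) -[RHS](avN v) -(ultrametric_eq vU (x := - 1) (y := 1 - n1%:R * b ord0)).
    by rewrite addKr avN.
  by rewrite avN av1.
have vn1 : v n1%:R = 1.
  apply/eqP; rewrite eq_le le1 /= -v1 avM -[leRHS]mulr1 ler_wpM2l ?av_ge0//.
have [n2 h2] := inverse_mod vp vn1.
have bn : v (b ord0 - n2%:R) < 1.
  have -> : b ord0 - n2%:R = - (b ord0 * ((n1 * n2)%:R - 1)) - n2%:R * (1 - n1%:R * b ord0).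
    by rewrite natrM; ring.
  apply: (ultrametricB_lt vU); rewrite ?avN avM.
    by apply: le_lt_trans h2; rewrite -[leRHS]mul1r ler_wpM2r ?av_ge0.
  by apply: le_lt_trans h1; rewrite -[leRHS]mul1r ler_wpM2r ?av_ge0 ?le1.
move=> hx; have [n hn] := res x hx; exists (n * n2)%N.
have -> : x - (n * n2)%:R = (x - n%:R * b ord0) - - (n%:R * (b ord0 - n2%:R)).
  by rewrite natrM; ring.
apply: (ultrametricB_lt vU) => //; rewrite avN avM.
by apply: le_lt_trans bn; rewrite -[leRHS]mul1r ler_wpM2r ?av_ge0 ?le1.
Qed.

Variables (pi : compl v) (pi_unif : uniformizer pi).

(** With f = 1 the local degree is the ramification index e, because the powers pi^i with i < e form
    a basis over the closure of Q. *)
Lemma local_degree_ramification : exists e : nat, [/\ (0 < e)%N, local_degree v = e &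
  comp_av (compl v) pi ^+ e = p%:R^-1].
Proof.
have [e e0 he] := ramification_index vp pi_unif.
exists e; split => //; apply: local_degreeE.
exact: (basis_unif_powers vp pi_unif residue_degree1 he).
Qed.

Lemma abs_compl_uniformizer : (abs_compl pi)^-1 = p%:R `^ (\dim {:k})%:R^-1.
Proof.
have [e [e0 de he]] := local_degree_ramification.
have p0 : 0 < p%:R :> R by rewrite ltr0n prime_gt0// (vp.1).
rewrite /abs_compl de powRrM powR_mulrn ?av_ge0// he.
have h : (p%:R^-1 `^ (\dim {:k})%:R^-1) * (p%:R `^ (\dim {:k})%:R^-1) = 1 :> R.
  by rewrite -powRM ?invr_ge0 ?ler0n// mulVf ?gt_eqF// powR1.
by apply: (mulfI (x := p%:R^-1 `^ (\dim {:k})%:R^-1));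
  rewrite ?h ?divff// gt_eqF// powR_gt0// invr_gt0.
Qed.

End ResidueDegreeOne.

(** * Embeddings and the discriminant *)

(** The universal property of a simple extension, stated through the relations of t so that the
    target can be any field. It yields both the complex embeddings of k and, in
    [dense_subfield_full], a conjugation over a subfield. *)
Lemma rmorphism_adjoin (K0 K E : fieldType) (j : {rmorphism K0 -> K})
    (i : {rmorphism K0 -> E}) (t : K) (z : E) :
    (forall x, exists q, x = (map_poly j q).[t]) ->
    (forall q, (map_poly j q).[t] = 0 -> (map_poly i q).[z] = 0) ->
  exists tau : {rmorphism K -> E}, tau t = z /\ forall c, tau (j c) = i c.
Proof.
move=> gen rel; have /choice[P hP] := gen.
pose tau x := (map_poly i (P x)).[z].
have tauE q : tau (map_poly j q).[t] = (map_poly i q).[z].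
  apply/eqP; rewrite -subr_eq0 -hornerN -hornerD -rmorphB; apply/eqP/rel.
  by rewrite rmorphB hornerD hornerN -hP subrr.
have tauB : zmod_morphism tau.
  by move=> x y; rewrite (hP x) (hP y) -hornerN -hornerD -rmorphB !tauE rmorphB hornerD hornerN.
have tauM : monoid_morphism tau.
  split=> [|x y]; first by have := tauE 1; rewrite !rmorph1 -!polyC1 !hornerC.
  by rewrite (hP x) (hP y) -hornerM -rmorphM !tauE rmorphM hornerM.
pose a := GRing.isZmodMorphism.Build K E tau tauB.
pose m := GRing.isMonoidMorphism.Build K E tau tauM.
exists (HB.pack tau a m : {rmorphism K -> E}); split => /=.
  by rewrite -{1}(hornerX t) -(map_polyX j) tauE map_polyX hornerX.
by move=> c; have := tauE c%:P; rewrite !map_polyC !hornerC.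
Qed.

Lemma exists_primitive (k : fieldExtType rat) : exists t : k, <<1; t>>%VS = fullv.
Proof.
have sep : separable 1%AS {:k}.
  apply/separableP => y _; apply: pcharf0_separable => p.
  rewrite !inE; apply/negP => /andP[p_pr]; rewrite -natr_alg -in_algE fmorph_eq0.
  by rewrite pnatr_eq0 => /eqP p0; rewrite p0 in p_pr.
by exists (separable_generator 1%AS {:k}); rewrite -eq_adjoin_separable_generator// sub1v.
Qed.

Section Embeddings.
Variables (R : realType) (k : fieldExtType rat).
Local Notation n := (\dim {:k}).

Lemma mul_complexI (z : R[i]) : conjc (conjc z) = z.
Proof. by case: z => a b; rewrite /= opprK. Qed.

(* The embeddings are linearly independent: apply a vanishing combination to
   the Lagrange polynomials at the images of a primitive element. *)
Lemma exists_embeddings : exists s : 'I_n -> {rmorphism k -> R[i]},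
  (forall tau : {rmorphism k -> R[i]}, exists i, forall x, tau x = s i x) /\
  (forall a : 'I_n -> R[i], (forall x, \sum_i a i * s i x = 0) -> forall i, a i = 0).
Proof.
have [t ft] := exists_primitive k.
have /polyOver1P[q hq] := minPolyOver 1%AS t.
have sq : size q = n.+1.
  have <- : size (minPoly 1%AS t) = n.+1.
    rewrite size_minPoly; congr _.+1; have := dim_Fadjoin 1%AS t.
    by rewrite ft dimv1 muln1 => ->.
  by rewrite hq size_map_poly.
have qmon : q \is monic.
  by have := monic_minPoly 1%AS t; rewrite hq map_monic.
have qsep : separable_poly q.
  rewrite -(separable_map (in_alg k)) -hq; apply: pcharf0_separable => p.
  rewrite !inE; apply/negP => /andP[p_pr]; rewrite -natr_alg -in_algE fmorph_eq0.
  by rewrite pnatr_eq0 => /eqP p0; rewrite p0 in p_pr.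
pose qC := map_poly (ratr : rat -> R[i]) q.
have [rs hrs] := closed_field_poly_normal qC.
have lc1 : lead_coef qC = 1 by rewrite lead_coef_map (monicP qmon) rmorph1.
rewrite lc1 scale1r in hrs.
have urs : uniq rs by rewrite -separable_prod_XsubC -hrs separable_map.
have srs : size rs = n.
  by have := size_prod_XsubC rs id; rewrite -hrs size_map_poly sq => -[].
have rootP z : root qC z = (z \in rs) by rewrite hrs root_prod_XsubC.
have gen x : exists g, x = (map_poly (in_alg k) g).[t].
  have xt : x \in <<1%AS; t>>%VS by rewrite ft memvf.
  have /polyOver1P[g hg] := Fadjoin_polyOver 1%AS t x.
  by exists g; rewrite -hg Fadjoin_poly_eq.
have rel z : z \in rs -> forall g, (map_poly (in_alg k) g).[t] = 0 ->
    (map_poly (ratr : rat -> R[i]) g).[z] = 0.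
  move=> zrs g gt.
  have : minPoly 1%AS t %| map_poly (in_alg k) g.
    by apply: minPoly_dvdp; [apply/polyOver1P; exists g|apply/eqP].
  rewrite hq dvdp_map => /(dvdpP _ _)[h ->]; rewrite rmorphM hornerM.
  have : root qC z by rewrite rootP.
  by move=> /eqP; rewrite /qC => ->; rewrite mulr0.
pose z (i : 'I_n) := rs`_i.
have zrs i : z i \in rs by rewrite mem_nth// srs.
have /choice[s hs] : forall i, exists tau : {rmorphism k -> R[i]},
    tau t = z i /\ forall c, tau (in_alg k c) = ratr c.
  by move=> i; apply: (rmorphism_adjoin gen (rel _ (zrs i))).
have rm_horner (tau : {rmorphism k -> R[i]}) g :
    tau (map_poly (in_alg k) g).[t] = (map_poly (ratr : rat -> R[i]) g).[tau t].
  rewrite -horner_map -map_poly_comp; congr (_.[_]); apply: eq_map_poly => c.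
  by rewrite /= -[LHS]/((tau \o in_alg k) c) fmorph_eq_rat.
exists s; split=> [tau|a ha i].
  have : root qC (tau t).
    rewrite /root /qC -rm_horner -hq (eqP (root_minPoly _ _)) rmorph0 eqxx//.
  rewrite rootP => trs; have ni : (index (tau t) rs < n)%N by rewrite -srs index_mem.
  have ti : z (Ordinal ni) = tau t by rewrite /z nth_index.
  exists (Ordinal ni) => x; have [g ->] := gen x.
  by rewrite !rm_horner (hs _).1 ti.
have hpoly (g : {poly R[i]}) : \sum_l a l * g.[z l] = 0.
  under eq_bigr => l _ do rewrite horner_coef mulr_sumr.
  rewrite exchange_big big1//= => j _.
  under eq_bigr => l _ do rewrite mulrCA -(hs l).1 -rmorphXn.
  by rewrite -mulr_sumr ha mulr0.
have := hpoly (\prod_(j | j != i) ('X - (z j)%:P)).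
rewrite (bigD1 i)//= [X in _ + X]big1 ?addr0 => [|l li]; last first.
  by rewrite horner_prod (bigD1 l)//= hornerXsubC subrr mul0r mulr0.
move/eqP; rewrite mulf_eq0 => /orP[/eqP//|].
rewrite horner_prod prodf_seq_eq0 => /hasP[j _ /andP[ji]].
rewrite hornerXsubC subr_eq0 nth_uniq ?srs// => /eqP e.
by move/eqP: ji; case; apply/val_inj/esym.
Qed.

Section Fixed.
Variable s : 'I_n -> {rmorphism k -> R[i]}.
Hypothesis s_all : forall tau : {rmorphism k -> R[i]}, exists i, forall x, tau x = s i x.
Hypothesis s_ind : forall a : 'I_n -> R[i],
  (forall x, \sum_i a i * s i x = 0) -> forall i, a i = 0.

Lemma embeddings_inj i j : (forall x, s i x = s j x) -> i = j.
Proof.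
move=> h; apply/eqP/negPn/negP => ij.
have := s_ind (a := fun l => (l == i)%:R - (l == j)%:R) _ i.
rewrite eqxx (negbTE ij) subr0 => /(_ _)/eqP; rewrite oner_eq0 => /(_ _)/negP; apply => // x.
rewrite (eq_bigr (fun l => (l == i)%:R * s i x - (l == j)%:R * s j x)).
  have E (l : 'I_n) (f : R[i]) : \sum_l' (l' == l)%:R * f = f.
    by rewrite (bigD1 l)//= eqxx mul1r big1 ?addr0// => l' /negbTE ->; rewrite mul0r.
  by rewrite sumrB !E h subrr.
move=> l _; rewrite mulrBl; congr (_ - _).
  by case: eqP => [->|]; rewrite ?mul0r.
by case: eqP => [->|]; rewrite ?mul0r.
Qed.

Lemma conj_embedding : exists c : 'I_n -> 'I_n,
  (forall i x, s (c i) x = conjc (s i x)) /\ involutive c.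
Proof.
have /choice[c hc] : forall i, exists j, forall x, conjc (s i x) = s j x.
  by move=> i; have [j hj] := s_all (conjc \o s i); exists j => x; rewrite -hj.
exists c; split=> [i x|i]; first by rewrite hc.
by apply: embeddings_inj => x; rewrite -!hc mul_complexI.
Qed.

Lemma embedding_rat i (q : rat) : s i q%:A = ratr q.
Proof. by rewrite -[LHS]/((s i \o in_alg k) q) fmorph_eq_rat. Qed.

Definition emb_matrix (w : 'I_n -> k) : 'M[R[i]]_n := \matrix_(i, j) s i (w j).

Definition rat_spanning (w : 'I_n -> k) := forall x, exists c : 'I_n -> rat, x = \sum_j c j *: w j.

Lemma embeddingZ i (q : rat) x : s i (q *: x) = ratr q * s i x.
Proof. by rewrite -[x in LHS]mul1r scalerAl rmorphM embedding_rat. Qed.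

Lemma det_emb_matrix_neq0 w : rat_spanning w -> \det (emb_matrix w) != 0.
Proof.
move=> hw; apply/det0P => -[a a0 ha].
have h : forall i, a 0 i = 0.
  apply: (s_ind (a := fun i => a 0 i)) => x; have [c ->] := hw x.
  under eq_bigr => i _ do rewrite rmorph_sum mulr_sumr.
  rewrite exchange_big big1//= => j _.
  under eq_bigr => i _ do rewrite embeddingZ mulrCA.
  rewrite -mulr_sumr; have /rowP/(_ j) := ha; rewrite !mxE => hj.
  by rewrite -[RHS](mulr0 (ratr (c j))) -[in RHS]hj; congr (_ * _); apply: eq_bigr => i _; rewrite mxE.
by move/eqP: a0; apply; apply/rowP => i; rewrite mxE h.
Qed.

Lemma vbasis_spanning : rat_spanning (fun j : 'I_n => (vbasis {:k})`_j).
Proof. by move=> x; exists (fun j => coord (vbasis {:k}) j x); apply/coord_vbasis/memvf. Qed.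

Lemma spanning_of_det w : \det (emb_matrix w) != 0 -> rat_spanning w.
Proof.
move=> dw; pose X := [tuple w i | i < n].
have fX : free X.
  apply/freeP => c hc i; apply/eqP; rewrite -(fmorph_eq0 (ratr : {rmorphism rat -> R[i]})).
  pose a := \col_j (ratr (c j) : R[i]).
  have : emb_matrix w *m a = 0.
    apply/colP => l; have := congr1 (s l) hc; rewrite rmorph0 rmorph_sum => hcl.
    rewrite [RHS]mxE -[RHS]hcl mxE; apply: eq_bigr => j _.
    rewrite !mxE (nth_map j) ?size_enum_ord// nth_ord_enum.
    by rewrite embeddingZ mulrC.
  move=> /(congr1 (mulmx (invmx (emb_matrix w)))); rewrite mulmx0 mulKmx.
    by move=> /colP/(_ i); rewrite !mxE => h; apply/eqP; exact: h.
  by rewrite unitmxE unitfE.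
have bX : basis_of fullv X by rewrite basisEfree fX subvf size_tuple leqnn.
move=> x; exists (fun j => coord X j x); rewrite {1}(coord_basis bX (memvf x)).
by apply: eq_bigr => j _; rewrite (nth_map j) ?size_enum_ord// nth_ord_enum.
Qed.

Lemma field_traceE (x : k) : field_trace x = \tr (mul_matrix x).
Proof.
apply: eq_bigr => i _; rewrite /passmx.mxof !mxE /=.
congr (coord _ _ _); rewrite lfunE /= /passmx.vecof; congr (_ * _).
rewrite (bigD1 i)//= mxE !eqxx scale1r big1 ?addr0// => j ji.
by rewrite mxE (negbTE ji) andbF scale0r.
Qed.

(** The columns of W^T are common eigenvectors of all multiplication matrices, with the s_i x as
    eigenvalues. *)
Lemma ratr_field_trace x : ratr (field_trace x) = \sum_i s i x.
Proof.
pose W := emb_matrix (fun j : 'I_n => (vbasis {:k})`_j).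
have Wu : W^T \in unitmx.
  by rewrite unitmx_tr unitmxE unitfE det_emb_matrix_neq0//; apply: vbasis_spanning.
pose M := map_mx (ratr : rat -> R[i]) (mul_matrix x).
have MW : M *m W^T = W^T *m diag_mx (\row_i s i x).
  apply/matrixP => j i; rewrite mul_mx_diag !mxE -rmorphM mulrC.
  rewrite (coord_vbasis (memvf (x * _))) rmorph_sum; apply: eq_bigr => l _.
  by rewrite !mxE embeddingZ.
have -> : ratr (field_trace x) = \tr M.
  by rewrite field_traceE rmorph_sum; apply: eq_bigr => i _; rewrite !mxE.
rewrite -[M](mulmxK Wu) MW mxtrace_mulC mulmxA mulVmx// mul1mx mxtrace_diag.
by apply: eq_bigr => i _; rewrite mxE.
Qed.

Definition disc_rat (w : 'I_n -> k) : rat := \det (\matrix_(i, j) field_trace (w i * w j)).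

Lemma ratr_disc_rat w : ratr (disc_rat w) = \det (emb_matrix w) ^+ 2.
Proof.
rewrite expr2 -{1}det_tr -det_mulmx /disc_rat -det_map_mx; congr (\det _).
apply/matrixP => i j; rewrite !mxE /= ratr_field_trace; apply: eq_bigr => l _.
by rewrite !mxE rmorphM.
Qed.

Lemma rat_int_of_padic (q : rat) :
  (forall p, prime p -> padic_abs R p q <= 1) -> exists a : int, q = a%:~R.
Proof.
move=> h; exists (numq q); rewrite -[LHS]divq_num_den.
suff -> : denq q = 1 by rewrite divr1.
have d0 : (0 < `|denq q|)%N by rewrite absz_gt0 denq_neq0.
suff d1 : `|denq q|%N = 1%N by rewrite -absz_denq d1.
apply/eqP; rewrite eqn_leq d0 andbT leqNgt; apply/negP => d1.
have pp := pdiv_prime d1; set p := pdiv _ in pp.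
have pd : (p %| `|denq q|)%N by apply: pdiv_dvd.
have q0 : q != 0 by apply: contraTneq d1 => ->.
have pn : logn p `|numq q| = 0%N.
  apply/eqP; rewrite -leqn0 leqNgt logn_gt0 mem_primes; apply/negP => /and3P[_ _ pn].
  have := coprime_num_den q; rewrite /coprime => /eqP g1.
  have : (p %| 1)%N by rewrite -g1 dvdn_gcd pn.
  by rewrite dvdn1 => /eqP p1; rewrite p1 in pp.
have := h p pp; rewrite /padic_abs (negbTE q0) pn subr0 -exprnP leNgt => /negP; apply.
by rewrite exprn_egt1 ?ltr1n ?prime_gt1// -lt0n logn_gt0 mem_primes pp d0.
Qed.

Lemma exists_lies_over p : prime p -> exists v : absval R k, lies_over v p.
Proof.
by move=> pp; have [v [hv _]] := absval_extension (E := k) (padic_absval R pp) 1; exists v.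
Qed.

(** Each p-adic absolute value extends to k, where algebraic integers have value at most 1; so no
    prime divides the denominator of q. *)
Lemma alg_integer_rat (q : rat) : alg_integer (q%:A : k) -> exists a : int, q = a%:~R.
Proof.
move=> hq; apply: rat_int_of_padic => p pp; have [v vp] := exists_lies_over pp.
by rewrite -(vp.2); apply: alg_integer_le1 vp hq.
Qed.

Lemma field_trace_int (x : k) : alg_integer x -> exists a : int, field_trace x = a%:~R.
Proof.
move=> hx; apply: alg_integer_rat.
have hs i : integralOver (intr : int -> R[i]) (s i x).
  have [f fm fx] := hx; exists f => //.
  have -> : map_poly (intr : int -> R[i]) f = map_poly (s i) (map_poly (intr : int -> k) f).
    by rewrite -map_poly_comp; apply: eq_map_poly => a; rewrite /= rmorph_int.
  by rewrite /root horner_map (eqP fx) rmorph0.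
have : integralOver (intr : int -> R[i]) (\sum_i s i x).
  elim/big_rec: _ => [|i a _ ha]; first exact: mxpoly.integral0.
  exact: integral_add.
rewrite -ratr_field_trace => -[f fm fx]; exists f => //.
have -> : map_poly (intr : int -> k) f = map_poly (in_alg k) (map_poly (intr : int -> rat) f).
  by rewrite -map_poly_comp; apply: eq_map_poly => a; rewrite /= intr_alg.
rewrite /root horner_map fmorph_eq0 -(fmorph_eq0 (ratr : {rmorphism rat -> R[i]})).
rewrite -horner_map -map_poly_comp.
rewrite (_ : map_poly _ f = map_poly (intr : int -> R[i]) f); first exact: fx.
by apply: eq_map_poly => a; rewrite /= ratr_int.
Qed.

Lemma disc_rat_int w : (forall i, alg_integer (w i)) -> exists D : int, disc_rat w = D%:~R.
Proof.
move=> hw; have /choice[f hf] : forall ij : 'I_n * 'I_n,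
    exists a : int, field_trace (w ij.1 * w ij.2) = a%:~R.
  by move=> ij; apply: field_trace_int; apply: alg_integerM.
exists (\det (\matrix_(i, j) f (i, j))); rewrite -det_map_mx.
by congr (\det _); apply/matrixP => i j; rewrite !mxE (hf (i, j)).
Qed.

Lemma det_emb_matrix_replace w i (c : 'I_n -> rat) :
  \det (emb_matrix (fun j => if j == i then \sum_l c l *: w l else w j)) =
  ratr (c i) * \det (emb_matrix w).
Proof.
pose B : 'M[R[i]]_n := \matrix_(l, j) if j == i then ratr (c l) else (l == j)%:R.
have -> : emb_matrix (fun j => if j == i then \sum_l c l *: w l else w j) = emb_matrix w *m B.
  apply/matrixP => a j; rewrite !mxE; have [ji|ji] := eqVneq j i.
    by rewrite rmorph_sum; apply: eq_bigr => l _; rewrite !mxE ji eqxx embeddingZ mulrC.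
  rewrite (bigD1 j)//= !mxE (negbTE ji) eqxx mulr1 big1 ?addr0// => l lj.
  by rewrite !mxE (negbTE ji) (negbTE lj) mulr0.
rewrite det_mulmx mulrC; congr (_ * _).
rewrite (expand_det_row _ i) (bigD1 i)//= big1 => [|j ji]; last first.
  by rewrite mxE (negbTE ji) eq_sym (negbTE ji) mul0r.
rewrite addr0 mxE eqxx /cofactor -signr_odd oddD addbb expr0 mul1r.
rewrite (_ : row' i (col' i B) = 1%:M) ?det1 ?mulr1//.
apply/matrixP => a b; rewrite !mxE (negbTE (_ : lift i b != i)) 1?eq_sym ?neq_lift//.
by rewrite (inj_eq lift_inj) eq_sym.
Qed.

Lemma scale_to_integer (x : k) : exists2 a : int, a != 0 & alg_integer (a%:~R * x).
Proof.
have [f cf fx] := primitive_int_poly x.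
have f0 : f != 0 by apply/eqP => f0; move: cf; rewrite f0 zcontents0.
have fk0 : map_poly (intr : int -> k) f != 0.
  apply: contra_neq f0 => h; apply/polyP => i; have /polyP/(_ i) := h.
  rewrite coef_map !coef0 /= -intr_alg -in_algE => /eqP.
  by rewrite fmorph_eq0 intr_eq0 => /eqP.
have intr0 (a : int) : (a%:~R == 0 :> k) = (a == 0).
  by rewrite -intr_alg -in_algE fmorph_eq0 intr_eq0.
exists (lead_coef f); first by rewrite lead_coef_eq0.
rewrite -lead_coef_map_eq ?intr0 ?lead_coef_eq0//.
by apply: alg_integer_lead => // i; rewrite coef_map; apply: alg_integer_int.
Qed.

Lemma coordinates_unique w (c d : 'I_n -> rat) : \det (emb_matrix w) != 0 ->
  \sum_j c j *: w j = \sum_j d j *: w j -> forall j, c j = d j.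
Proof.
move=> dw h j; pose a := \col_j (ratr (c j - d j) : R[i]).
have : emb_matrix w *m a = 0.
  apply/colP => l; have := congr1 (s l) (subrr (\sum_j d j *: w j)).
  rewrite -{1}h -sumrB rmorph0 rmorph_sum => hcl.
  rewrite [RHS]mxE -[RHS]hcl mxE; apply: eq_bigr => i _; rewrite !mxE.
  by rewrite -scalerBl embeddingZ mulrC.
move=> /(congr1 (mulmx (invmx (emb_matrix w)))); rewrite mulmx0 mulKmx; last first.
  by rewrite unitmxE unitfE.
move=> /colP/(_ j); rewrite !mxE => /eqP; rewrite fmorph_eq0 subr_eq0.
by move/eqP.
Qed.

(** Among integral families spanning k over Q, take one whose discriminant has least absolute value.
    If an algebraic integer had a coordinate with fractional part f in (0, 1), exchanging that basis
    vector would multiply the discriminant by f^2 < 1. *)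
Lemma exists_integral_basis : exists w : 'I_n -> k, integral_basis w.
Proof.
pose good (w : 'I_n -> k) := (forall i, alg_integer (w i)) /\ \det (emb_matrix w) != 0.
pose isdisc m := `[< exists2 w, good w & m = `|numq (disc_rat w)|%N >].
have ex : exists m, isdisc m.
  have /choice[a ha] : forall j : 'I_n, exists a : int,
      a != 0 /\ alg_integer (a%:~R * (vbasis {:k})`_j).
    by move=> j; have [a a0 h] := scale_to_integer (vbasis {:k})`_j; exists a.
  pose w j := (a j)%:~R * (vbasis {:k})`_j.
  exists `|numq (disc_rat w)|%N; apply/asboolP; exists w => //; split=> [i|].
    by case: (ha i).
  apply: det_emb_matrix_neq0 => x; have [c ->] := vbasis_spanning x.
  exists (fun j => c j / (a j)%:~R); apply: eq_bigr => j _.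
  rewrite /w -intr_alg -scalerAl mul1r scalerA divfK// intr_eq0.
  by case: (ha j).
have [m /asboolP[w [wint dw] mE] mmin] := ex_minnP ex.
exists w; split=> // x hx; have [c xE] := spanning_of_det dw x.
have cint i : (Num.floor (c i))%:~R = c i.
  apply/eqP/negPn/negP => ci.
  pose f := c i - (Num.floor (c i))%:~R.
  have /andP[f1 f2] := floor_itv (c i).
  have f0 : 0 < f by rewrite subr_gt0 lt_neqAle ci.
  have f_lt1 : f < 1 by move: f2; rewrite /f rmorphD /=; lra.
  pose c' l := if l == i then f else c l.
  pose w' j := if j == i then \sum_l c' l *: w l else w j.
  have w'i : \sum_l c' l *: w l = x - (Num.floor (c i))%:~R * w i.
    rewrite xE (bigD1 i)//= [in RHS](bigD1 i)//= /c' eqxx /f scalerBl addrAC.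
    rewrite -intr_alg -scalerAl mul1r; congr (_ + _ - _).
    by apply: eq_bigr => l /negbTE ->.
  have dw' : \det (emb_matrix w') = ratr f * \det (emb_matrix w).
    by rewrite det_emb_matrix_replace /c' eqxx.
  have gw' : good w'.
    split=> [j|]; last by rewrite dw' mulf_neq0// fmorph_eq0 gt_eqF.
    rewrite /w'; case: eqP => // _; rewrite w'i; apply: alg_integerB => //.
    by apply: alg_integerM => //; apply: alg_integer_int.
  have [D hD] := disc_rat_int wint; have [D' hD'] := disc_rat_int gw'.1.
  have DD : D'%:~R = f ^+ 2 * D%:~R :> rat.
    apply: (fmorph_inj (ratr : {rmorphism rat -> R[i]})).
    by rewrite /= -hD' rmorphM -hD /= !ratr_disc_rat dw' exprMn rmorphXn.
  have D0 : D != 0.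
    have : ratr (disc_rat w) != 0 :> R[i] by rewrite ratr_disc_rat expf_neq0.
    by rewrite fmorph_eq0 hD intr_eq0.
  have /mmin : isdisc `|numq (disc_rat w')|%N by apply/asboolP; exists w'.
  rewrite mE hD hD' !numq_int leqNgt => /negP; apply.
  rewrite -(ltr_nat rat) !natr_absz !intr_norm DD normrM gtr_pMl ?normr_gt0 ?intr_eq0//.
  by rewrite ger0_norm ?sqr_ge0// expr_lt1// ltW.
exists [ffun j => Num.floor (c j)]; split=> [|c' xE'].
  rewrite {1}xE; apply: eq_bigr => j _.
  by rewrite ffunE -intr_alg -scalerAl mul1r cint.
apply/ffunP => j; rewrite ffunE; apply/eqP; rewrite -(eqr_int rat) cint; apply/eqP.
apply: (coordinates_unique (d := fun j => (c' j)%:~R) dw); rewrite -xE xE'.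
by apply: eq_bigr => l _; rewrite -intr_alg -scalerAl mul1r.
Qed.

Lemma discriminantP : exists2 w : 'I_n -> k, integral_basis w &
  (discriminant k)%:~R = disc_rat w.
Proof.
have [w hw] := exists_integral_basis; have [D hD] := disc_rat_int hw.1.
rewrite /discriminant; case: xgetP => [D' _ [w' h1 h2]|/(_ D)]; first by exists w'.
by case; exists w.
Qed.

Lemma integral_basis_det w : integral_basis w -> \det (emb_matrix w) != 0.
Proof.
move=> [_ hw]; apply: det_emb_matrix_neq0 => x.
have [a a0 /hw[c [xE _]]] := scale_to_integer x.
exists (fun j => (c j)%:~R / a%:~R).
have a0k : a%:~R != 0 :> k by rewrite -intr_alg -in_algE fmorph_eq0 intr_eq0.
apply: (mulfI a0k); rewrite xE mulr_sumr; apply: eq_bigr => j _.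
by rewrite -!intr_alg -!scalerAl !mul1r scalerA mulrCA divff ?mulr1// intr_eq0.
Qed.

End Fixed.
End Embeddings.

(** * Minkowski's theorem *)

Section Pigeonhole.

Lemma unit_int_abs (a : int) : a \is a GRing.unit -> `|a|%N = 1%N.
Proof.
rewrite unitrE => /eqP h; have := congr1 absz h.
by rewrite abszM => /eqP; rewrite muln_eq1 => /andP[/eqP].
Qed.

(* By the Smith normal form, Z^d / A Z^d has exactly |det A| elements. *)
Lemma lattice_pigeonhole d (A : 'M[int]_d) (X : finType) (f : X -> 'cV[int]_d) :
  \det A != 0 -> (`|\det A| < #|X|)%N ->
  exists x y (u : 'cV[int]_d), x != y /\ f x - f y = A *m u.
Proof.
move=> A0 cX; have [L Lu [M Mu [e _ AE]]] := int_Smith_normal_form A.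
pose D : 'M[int]_d := \matrix_(i, j) (e`_i *+ (i == j :> nat)).
have DE : D = diag_mx (\row_i e`_i) by apply/matrixP => i j; rewrite !mxE.
have detA : `|\det A|%N = (\prod_(i < d) `|(e`_i)%R|)%N.
  rewrite AE -/D !det_mulmx !abszM (unit_int_abs (a := \det L)) -?unitmxE//.
  rewrite (unit_int_abs (a := \det M)) -?unitmxE// mul1n muln1 DE det_diag.
  rewrite (big_morph absz abszM (erefl : `|1%R|%N = 1%N)).
  by apply: eq_bigr => i _; rewrite mxE.
have e0 (i : 'I_d) : e`_i != 0.
  rewrite -absz_eq0 -lt0n; move: A0; rewrite -absz_gt0 detA.
  by rewrite (bigD1 i)//= muln_gt0 => /andP[].
pose c x := invmx L *m f x.
have lt x (i : 'I_d) : (`|(c x i ord0 %% e`_i)%Z| < `|(e`_i)%R|)%N.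
  by rewrite -ltz_nat gez0_abs ?modz_ge0// ltz_mod.
(* [g] records the residues of L^-1 f(x) modulo the elementary divisors; its target has |det A|
   elements. *)
pose g x : {dffun forall i : 'I_d, 'I_(`|(e`_i)%R|)} := [ffun i => Ordinal (lt x i)].
have /injectivePn[x [y xy gxy]] : ~~ injectiveb g.
  apply/negP => /injectiveP/leq_card; rewrite leqNgt => /negP; apply.
  rewrite card_dep_ffun foldrE big_image /=; under eq_bigr do rewrite card_ord.
  by rewrite -detA.
have /fin_all_exists[t ht] : forall i : 'I_d, exists t : int, c x i ord0 - c y i ord0 = e`_i * t.
  move=> i; have /ffunP/(_ i) := gxy; rewrite !ffunE => /(congr1 val) /= h.
  have : (c x i ord0 = c y i ord0 %[mod e`_i])%Z.
    by rewrite -[LHS]gez0_abs ?modz_ge0// h gez0_abs ?modz_ge0.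
  move/eqP; rewrite eqz_mod_dvd => /dvdzP[t ht]; exists t.
  by rewrite ht mulrC.
exists x, y, (invmx M *m \col_i t i); split => //.
rewrite AE -/D -mulmxA mulKVmx// -mulmxA.
suff <- : c x - c y = D *m \col_i t i by rewrite -mulmxBr mulKVmx.
by apply/colP => i; rewrite DE mul_diag_mx !mxE -ht !mxE.
Qed.

End Pigeonhole.

(** * Integer points in a disc *)

Section DiscCount.
Variable R : realType.
Local Notation pi := (@trigo.pi R).

(** The left side is the area below the unit circle between the abscissas sin u and sin w, the right
    side the rectangle over the same interval with the height at sin u. Their difference, as a
    function of the upper angle x, has derivative cos x (cos u - cos x) >= 0. *)
Lemma arc_le (u w : R) : 0 <= u -> u <= w -> w <= pi / 2 ->
  (w - u) / 2 + (sin w * cos w - sin u * cos u) / 2 <= (sin w - sin u) * cos u.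
Proof.
move=> u0 uw wpi; have pi0 : 0 < pi by exact: pi_gt0.
pose H (x : R) := sin x * cos u - x / 2 - sin x * cos x / 2.
pose dH (x : R) := cos x * (cos u - cos x).
have dHE (x : R) : is_derive x (1 : R) H (dH x).
  rewrite /H; apply: is_derive_eq; rewrite /dH /GRing.scale /=.
  have := cos2Dsin2 x; lra.
have [|c] := MVT_segment uw (fun x _ => dHE x).
  apply: continuous_subspaceT => x; apply: differentiable_continuous.
  by apply/derivable1_diffP; have [] := dHE x.
rewrite in_itv /= => /andP[uc cw] hH.
have : 0 <= H w - H u.
  rewrite hH; apply: mulr_ge0; last by rewrite subr_ge0.
  apply: mulr_ge0; first by apply: cos_ge0_pihalf; lra.
  rewrite subr_ge0; have [->//|uc'] := eqVneq u c.
  by apply: ltW; rewrite ltr_cos ?in_itv /= ?lt_neqAle ?uc' ?uc//; lra.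
by rewrite /H; lra.
Qed.

Lemma asin_monotone (x y : R) : -1 <= x -> x <= y -> y <= 1 -> asin x <= asin y.
Proof.
move=> x1 xy y1; rewrite leNgt; apply/negP => h.
have hx : -1 <= x <= 1 by rewrite x1 (le_trans xy).
have hy : -1 <= y <= 1 by rewrite (le_trans x1 xy).
have : sin (asin y) < sin (asin x).
  by rewrite ltr_sin// in_itv /= ?asin_geNpi2 ?asin_lepi2.
by rewrite !asinK ?in_itv//= ltNge xy.
Qed.

(** The sum is an upper Riemann sum for the area of a quarter disc. [arc_le] at the angles asin (i /
    n) compares each strip with its rectangle, and the areas of the strips telescope. *)
Lemma sum_sqrt_ge n : (0 < n)%N ->
  pi / 4 * n%:R ^+ 2 <= \sum_(i < n) Num.sqrt (n%:R ^+ 2 - i%:R ^+ 2).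
Proof.
move=> n0; have n0R : 0 < n%:R :> R by rewrite ltr0n.
pose a (i : nat) := asin (i%:R / n%:R : R).
have itv i : (i <= n)%N -> -1 <= (i%:R / n%:R : R) <= 1.
  move=> le; rewrite ler_pdivrMr// mul1r ler_nat le andbT.
  by apply: le_trans (_ : 0 <= _); [lra|apply: divr_ge0].
pose f i := a i / 2 + sin (a i) * cos (a i) / 2.
have pi0 : 0 < pi by exact: pi_gt0.
have f0 : f 0%N = 0.
  rewrite /f (_ : a 0%N = 0); last first.
    by rewrite /a mul0r -[X in asin X]sin0 sinK// in_itv /=; lra.
  by rewrite sin0 !mul0r addr0.
have fn : f n = pi / 4.
  rewrite /f (_ : a n = pi / 2); last first.
    by rewrite /a divff ?gt_eqF// -[X in asin X]sin_pihalf sinK// in_itv /=; lra.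
  by rewrite cos_pihalf; lra.
have <- : \sum_(0 <= i < n) (f i.+1 - f i) = pi / 4.
  by rewrite telescope_sumr// f0 fn subr0.
rewrite big_mkord mulr_suml; apply: ler_sum => i _.
have hi := itv i (ltnW (ltn_ord i)); have hi1 := itv i.+1 (ltn_ord i).
have a0 : 0 <= a i.
  rewrite -[X in X <= _](_ : asin 0 = 0); last first.
    by rewrite -[X in asin X]sin0 sinK// in_itv /=; lra.
  by apply: asin_monotone; [lra|apply: divr_ge0|case/andP: hi].
have aa : a i <= a i.+1.
  apply: asin_monotone; [by case/andP: hi| |by case/andP: hi1].
  by rewrite ler_pM2r ?invr_gt0// ler_nat.
have := arc_le a0 aa (asin_lepi2 hi1).
have -> : sin (a i.+1) - sin (a i) = n%:R^-1.
  by rewrite /a !asinK ?in_itv// -natr1; field; rewrite gt_eqF.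
move=> h.
apply: (@le_trans _ _ (n%:R^-1 * cos (a i) * n%:R ^+ 2)).
  by rewrite ler_wpM2r ?sqr_ge0//; apply: le_trans h; rewrite /f; lra.
rewrite [cos (a i)]cos_asin//.
have -> : n%:R ^+ 2 - i%:R ^+ 2 = n%:R ^+ 2 * (1 - (i%:R / n%:R) ^+ 2) :> R.
  by field; rewrite gt_eqF.
rewrite sqrtrM ?sqr_ge0// sqrtr_sqr ger0_norm// expr2 mulrACA mulrA mulVf ?gt_eqF//.
by rewrite mul1r mulrC.
Qed.

Lemma count_squares n m : (m <= n ^ 2)%N ->
  Num.sqrt (m%:R : R) - 1 <= (\sum_(j < n) (j.+1 ^ 2 <= m)%N)%:R.
Proof.
move=> mn; set b := Num.truncn (Num.sqrt (m%:R : R)).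
have /andP[b1 b2] := truncn_itv (sqrtr_ge0 (m%:R : R)).
have bm : (b ^ 2 <= m)%N.
  rewrite -(ler_nat R) natrX -[leRHS]sqr_sqrtr ?ler0n//.
  by rewrite lerXn2r ?nnegrE ?sqrtr_ge0.
have bn : (b <= n)%N by rewrite -(@leq_exp2r _ _ 2)// (leq_trans bm).
have : (b <= \sum_(j < n) (j.+1 ^ 2 <= m))%N.
  apply: (@leq_trans (\sum_(j < n) (j < b))%N); last first.
    apply: leq_sum => j _; case: ltnP => // jb.
    by rewrite (leq_trans _ bm)// leq_exp2r.
  rewrite -big_mkcond /= -(big_ord_widen n (fun=> 1%N) bn).
  by rewrite sum1_card card_ord.
rewrite -(ler_nat R); apply: le_trans.
by rewrite lerBlDr natr1 ltW.
Qed.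

(** Coordinates start at 1, so that the four choices of signs give distinct points of the disc; the
    axes are left out. *)
Definition quarter_disc n : pred ('I_n * 'I_n) :=
  fun ij => (ij.1.+1 ^ 2 + ij.2.+1 ^ 2 <= n ^ 2)%N.

(** One n is lost by passing from S i to S (i + 1), the other by rounding n square roots down. *)
Lemma card_quarter_disc n : (0 < n)%N ->
  pi / 4 * n%:R ^+ 2 - 2 * n%:R <= #|@quarter_disc n|%:R.
Proof.
move=> n0; have h := sum_sqrt_ge n0.
pose S (i : nat) : R := Num.sqrt (n%:R ^+ 2 - i%:R ^+ 2).
have card : #|@quarter_disc n| = (\sum_(i < n) \sum_(j < n) (j.+1 ^ 2 <= n ^ 2 - i.+1 ^ 2))%N.
  rewrite pair_big /= -sum1_card big_mkcond; apply: eq_bigr => -[i j] _ /=.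
  rewrite unfold_in /quarter_disc /= addnC leq_subRL ?leq_exp2r//.
  by rewrite addnC; case: ifP.
have hS : \sum_(i < n) S i - n%:R <= \sum_(i < n) S i.+1.
  rewrite lerBlDr -(big_mkord xpredT S) -(big_mkord xpredT (fun i => S i.+1)).
  have e : \sum_(0 <= i < n.+1) S i = S 0%N + \sum_(0 <= i < n) S i.+1 by rewrite big_nat_recl.
  have e' : \sum_(0 <= i < n.+1) S i = \sum_(0 <= i < n) S i + S n by rewrite big_nat_recr.
  have S0 : S 0%N = n%:R by rewrite /S expr0n subr0 sqrtr_sqr ger0_norm.
  have Sn : S n = 0 by rewrite /S subrr sqrtr0.
  by move: e; rewrite e' S0 Sn; lra.
rewrite card natr_sum.
apply: (@le_trans _ _ (\sum_(i < n) (S i.+1 - 1))); last first.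
  apply: ler_sum => i _; have := @count_squares n (n ^ 2 - i.+1 ^ 2) (leq_subr _ _).
  by rewrite natrB ?leq_exp2r// !natrX.
rewrite sumrB sumr_const card_ord; move: h hS; rewrite -/S; lra.
Qed.

End DiscCount.

Section DetLimit.
Variable R : realType.

Lemma cvg_sum_seq (I : Type) (r : seq I) (f : I -> nat -> R) (l : I -> R) :
  (forall i, f i n @[n --> \oo] --> l i) ->
  (\sum_(i <- r) f i n) @[n --> \oo] --> \sum_(i <- r) l i.
Proof.
move=> h; elim: r => [|i r IH].
  by rewrite big_nil; under eq_fun do rewrite big_nil; apply: cvg_cst.
by rewrite big_cons; under eq_fun do rewrite big_cons; apply: cvgD.
Qed.

Lemma cvg_prod_seq (I : Type) (r : seq I) (f : I -> nat -> R) (l : I -> R) :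
  (forall i, f i n @[n --> \oo] --> l i) ->
  (\prod_(i <- r) f i n) @[n --> \oo] --> \prod_(i <- r) l i.
Proof.
move=> h; elim: r => [|i r IH].
  by rewrite big_nil; under eq_fun do rewrite big_nil; apply: cvg_cst.
by rewrite big_cons; under eq_fun do rewrite big_cons; apply: cvgM.
Qed.

Lemma cvg_det d (A : nat -> 'M[R]_d) (T : 'M[R]_d) :
  (forall i j, A n i j @[n --> \oo] --> T i j) -> \det (A n) @[n --> \oo] --> \det T.
Proof.
move=> h; apply: cvg_sum_seq => s; apply: cvgM; first exact: cvg_cst.
by apply: cvg_prod_seq => i; apply: h.
Qed.

End DetLimit.

(** * Integer points of a product of intervals and discs *)

Section Body.
Variables (R : realType) (d : nat) (c : 'I_d -> 'I_d) (cK : involutive c).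
Local Notation pi := (@trigo.pi R).

Local Notation fixed_index := {i : 'I_d | c i == i}.
Local Notation paired_index := {i : 'I_d | (i < c i)%N}.
Local Notation disc_point n := (bool * bool * {ij | @quarter_disc n ij})%type.

Lemma card_index : (#|{: fixed_index}| + #|{: paired_index}|.*2)%N = d.
Proof.
rewrite !card_sig -!sum1_card !(big_mkcond (fun i : 'I_d => i \in _)) /= -addnn.
rewrite [X in (_ + (_ + X))%N](reindex_inj (inv_inj cK)) -!big_split /=.
rewrite -[RHS]card_ord -sum1_card; apply: eq_bigr => i _.
by rewrite !inE cK -val_eqE /=; case: ltngtP.
Qed.

Definition signed_succ (b : bool) (m : nat) : int := if b then - m.+1%:Z else m.+1%:Z.

Lemma signed_succ_inj b b' m m' : signed_succ b m = signed_succ b' m' -> b = b' /\ m = m'.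
Proof. by case: b; case: b' => //; [move=> /oppr_inj[->]|move=> [->]]. Qed.

Definition disc_fst n (x : disc_point n) : int := signed_succ x.1.1 (val x.2).1.
Definition disc_snd n (x : disc_point n) : int := signed_succ x.1.2 (val x.2).2.

Lemma disc_point_inj n (x y : disc_point n) :
  disc_fst x = disc_fst y -> disc_snd x = disc_snd y -> x = y.
Proof.
case: x y => [[b1 b2] [[i j] hx]] [[b1' b2'] [[i' j'] hy]].
move=> /signed_succ_inj /= [-> /val_inj ii] /signed_succ_inj /= [-> /val_inj jj].
by congr pair; apply: val_inj; rewrite /= ii jj.
Qed.

Lemma disc_point_norm n (x : disc_point n) :
  (disc_fst x)%:~R ^+ 2 + (disc_snd x)%:~R ^+ 2 <= n%:R ^+ 2 :> R.
Proof.
case: x => [[b1 b2] [[i j] hx]]; rewrite /disc_fst /disc_snd /=.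
have sq b m : (signed_succ b m)%:~R ^+ 2 = m.+1%:R ^+ 2 :> R.
  by case: b; rewrite /= ?rmorphN ?sqrrN.
by rewrite !sq -!natrX -natrD ler_nat.
Qed.

Lemma card_disc_point n : #|{: disc_point n}| = (4 * #|@quarter_disc n|)%N.
Proof. by rewrite !card_prod !card_bool card_sig. Qed.

(** Fixed points of c stand for real embeddings, pairs i < c i for complex ones. The former take a
    coordinate in [-n, n]; the latter take a disc point whose entries go to i and c i. The final 0
    is never reached. *)
Definition body_point n (f : {ffun fixed_index -> 'I_(n.*2.+1)})
    (g : {ffun paired_index -> disc_point n}) : 'cV[int]_d :=
  \col_i (if (insub i : option fixed_index) is Some a then (f a)%:Z - n%:Z else
          if (insub i : option paired_index) is Some a then disc_fst (g a) else
          if (insub (c i) : option paired_index) is Some a then disc_snd (g a) else 0).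

Section BodyPoint.
Variables (n : nat) (f : {ffun fixed_index -> 'I_(n.*2.+1)}).
Variable g : {ffun paired_index -> disc_point n}.

Lemma body_point_fixed a : body_point f g (val a) 0 = (f a)%:Z - n%:Z.
Proof. by rewrite mxE valK. Qed.

Lemma body_point_fst a : body_point f g (val a) 0 = disc_fst (g a).
Proof.
by rewrite mxE insubF ?valK//; case: a => i /= ii; rewrite -val_eqE gtn_eqF.
Qed.

Lemma body_point_snd a : body_point f g (c (val a)) 0 = disc_snd (g a).
Proof.
rewrite mxE insubF; last by case: a => i /= ii; rewrite cK -val_eqE ltn_eqF.
rewrite insubF; last by case: a => i /= ii; rewrite cK ltnNge ltnW.
by rewrite cK valK.
Qed.

End BodyPoint.

Lemma body_point_inj n f g f' g' :
  @body_point n f g = @body_point n f' g' -> f = f' /\ g = g'.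
Proof.
move=> h; split; apply/ffunP => a.
  apply: val_inj; apply/eqP; rewrite -eqz_nat; apply/eqP/(addIr (- n%:Z)).
  by rewrite -(body_point_fixed f g) -(body_point_fixed f' g') h.
apply: disc_point_inj.
  by rewrite -(body_point_fst f) -(body_point_fst f') h.
by rewrite -(body_point_snd f) -(body_point_snd f') h.
Qed.

Definition body_diff n f g f' g' i : R := (@body_point n f g i 0 - @body_point n f' g' i 0)%:~R.

Lemma body_diff_fixed n f g f' g' i : c i = i -> `|@body_diff n f g f' g' i| <= 2 * n%:R.
Proof.
move=> ci; pose a : fixed_index := exist _ i (introT eqP ci).
rewrite /body_diff (body_point_fixed f g a) (body_point_fixed f' g' a) opprB addrA subrK.
rewrite rmorphB /= -!pmulrn.
have h1 : (f a)%:R <= 2 * n%:R :> R by rewrite -natrM mul2n ler_nat -ltnS.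
have h2 : (f' a)%:R <= 2 * n%:R :> R by rewrite -natrM mul2n ler_nat -ltnS.
have := ler0n R (f a); have := ler0n R (f' a).
by rewrite ler_norml; lra.
Qed.

Lemma body_diff_paired n f g f' g' i : c i != i ->
  @body_diff n f g f' g' i ^+ 2 + @body_diff n f g f' g' (c i) ^+ 2 <= (2 * n%:R) ^+ 2.
Proof.
move=> ci; wlog ii : i ci / (i < c i)%N => [th|].
  have [|ic|/val_inj ic] := ltngtP i (c i); first exact: th.
    by have := th (c i); rewrite cK addrC eq_sym ci => /(_ isT ic).
  by move: ci; rewrite -ic eqxx.
pose a : paired_index := exist _ i ii.
rewrite /body_diff (body_point_fst f g a) (body_point_fst f' g' a).
rewrite (body_point_snd f g a) (body_point_snd f' g' a) !rmorphB /=.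
have := disc_point_norm (g a); have := disc_point_norm (g' a).
move: (_%:~R) (_%:~R) (_%:~R) (_%:~R) => x y z t h1 h2.
have := sqr_ge0 (z + x); have := sqr_ge0 (t + y); nra.
Qed.

(** The hypothesis on D says that D has order exactly q modulo q Z^d. Adding A D j for j < q to the
    body points amounts to counting modulo the lattice spanned by q A and A D, whose index is q^d
    |det A| / q. *)
Lemma body_pigeonhole n (A : 'M[int]_d) (q : nat) (D : 'cV[int]_d) :
    \det A != 0 -> (0 < q)%N ->
    (forall m, (0 < m < q)%N -> forall u : 'cV[int]_d, D *+ m <> u *+ q) ->
    (q ^ d * `|\det A| <
       n.*2.+1 ^ #|{: fixed_index}| * (4 * #|@quarter_disc n|) ^ #|{: paired_index}| * q)%N ->
  exists (u : 'cV[int]_d) (m : int) f g f' g',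
    [/\ u *+ q + D *~ m != 0 & A *m (u *+ q + D *~ m) = @body_point n f g - @body_point n f' g'].
Proof.
move=> A0 q0 hD cardX.
pose X : finType :=
  ({ffun fixed_index -> 'I_(n.*2.+1)} * {ffun paired_index -> disc_point n} * 'I_q)%type.
pose phi (x : X) := body_point x.1.1 x.1.2 + A *m (D *+ x.2).
have dA : \det (q%:Z *: A) != 0 by rewrite detZ mulf_neq0// expf_neq0// eqz_nat -lt0n.
have [|x [y [u [xy hu]]]] := @lattice_pigeonhole d _ X phi dA.
  by rewrite detZ abszM abszX /= card_prod card_prod !card_ffun !card_ord card_disc_point.
exists u, (y.2%:Z - x.2%:Z), x.1.1, x.1.2, y.1.1, y.1.2.
have e : A *m (u *+ q + D *~ (y.2%:Z - x.2%:Z)) = body_point x.1.1 x.1.2 - body_point y.1.1 y.1.2.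
  rewrite mulmxDr (raddfMn (mulmx A)) /= -scaler_nat natz scalemxAl -hu /phi.
  rewrite mulrzBr -!pmulrn mulmxBr.
  move: (body_point _ _) (body_point _ _) (A *m _) (A *m _) => a b a' b'.
  by apply/colP => i; rewrite !mxE; ring.
split => //; apply/eqP => z0.
have Yxy : body_point x.1.1 x.1.2 = body_point y.1.1 y.1.2.
  by apply/eqP; rewrite -subr_eq0 -e z0 mulmx0.
have [f1 g1] := body_point_inj Yxy.
move: z0; rewrite mulrzBr -!pmulrn => z0.
have [xy2|xy2|xy2] := ltngtP (x.2 : nat) y.2.
- have m0 : (0 < y.2 - x.2 < q)%N.
    by rewrite subn_gt0 xy2 (leq_ltn_trans (leq_subr _ _)).
  apply: (hD _ m0 (- u)); apply/eqP; rewrite mulrnBr ?(ltnW xy2)// -subr_eq0.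
  by rewrite mulNrn opprK addrC z0.
- have m0 : (0 < x.2 - y.2 < q)%N.
    by rewrite subn_gt0 xy2 (leq_ltn_trans (leq_subr _ _)).
  apply: (hD _ m0 u); apply/eqP; rewrite mulrnBr ?(ltnW xy2)// eq_sym -subr_eq0.
  by rewrite opprB z0.
- move/eqP: xy; apply; case: x y f1 g1 xy2 {hu e Yxy z0} => [[f g] j] [[f' g'] j'] /=.
  by move=> -> -> /val_inj ->.
Qed.

End Body.

Section Minkowski.
Variables (R : realType) (d : nat).
Local Notation pi := (@trigo.pi R).

(** Bounding b through the inverse of T gives S <= C (1 + S / M), where S is the sum of the |b_j|.
    With C / M <= 1/2 the right-hand S is absorbed, so S <= 2 C without inverting A. *)
Lemma perturbed_image (T : 'M[R]_d) (eta : R) : \det T != 0 -> 0 < eta ->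
  exists2 M1 : R, 0 < M1 & forall (M : R) (A : 'M[R]_d) (b y : 'cV[R]_d), M1 <= M ->
    (forall i j, `|T i j - A i j| <= M^-1) -> A *m b = y -> (forall i, `|y i 0| <= 1) ->
    forall i, `|(T *m b) i 0 - y i 0| <= eta.
Proof.
move=> dT eta0; pose B := invmx T; pose C := \sum_j \sum_i `|B j i|.
have C0 : 0 <= C by apply: sumr_ge0 => j _; apply: sumr_ge0 => i _; exact: normr_ge0.
(* The terms ensure, in order, C / M <= 1/2, the final error 2 C / M <= eta, and M > 0. *)
exists (2 * C + 2 * C / eta + 1).
  by rewrite ltr_wpDl// addr_ge0 ?divr_ge0 ?mulr_ge0// ltW.
move=> M A b y hM hTA Ab y1.
have M0 : 0 < M.
  by apply: lt_le_trans hM; rewrite ltr_wpDl// addr_ge0 ?divr_ge0 ?mulr_ge0// ltW.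
pose S := \sum_j `|b j 0|.
have S0 : 0 <= S by apply: sumr_ge0 => j _; exact: normr_ge0.
have errE i : (T *m b) i 0 - y i 0 = \sum_j (T i j - A i j) * b j 0.
  by rewrite -Ab !mxE -sumrB; apply: eq_bigr => j _; rewrite mulrBl.
have err i : `|(T *m b) i 0 - y i 0| <= M^-1 * S.
  rewrite errE; apply: le_trans (ler_norm_sum _ _ _) _; rewrite mulr_sumr.
  by apply: ler_sum => j _; rewrite normrM ler_wpM2r.
have Tb i : `|(T *m b) i 0| <= 1 + M^-1 * S.
  rewrite -[X in `|X|](subrK (y i 0)) addrC.
  by apply: le_trans (ler_normD _ _) _; apply: lerD.
have bE : b = B *m (T *m b) by rewrite mulKmx// unitmxE unitfE.
have SC : S <= C * (1 + M^-1 * S).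
  rewrite /S /C mulr_suml; apply: ler_sum => j _; rewrite {1}bE mxE mulr_suml.
  apply: le_trans (ler_norm_sum _ _ _) _; apply: ler_sum => i _.
  by rewrite normrM ler_wpM2l.
have MC : C * M^-1 <= 2^-1.
  rewrite ler_pdivrMr//; have : 0 <= 2 * C / eta by rewrite divr_ge0 ?mulr_ge0// ltW.
  by move: hM; lra.
have S2C : S <= 2 * C.
  have : C * M^-1 * S <= 2^-1 * S by rewrite ler_wpM2r.
  by move: SC; rewrite mulrDr mulr1 mulrA; lra.
move=> i; apply: le_trans (err i) _; rewrite ler_pdivrMl//.
apply: le_trans S2C _; rewrite -ler_pdivrMr//.
by move: hM; lra.
Qed.

Lemma floor_div_approx (x t : R) : 0 < x -> `|t - (Num.floor (x * t))%:~R / x| <= x^-1.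
Proof.
move=> x0; rewrite -{1}[t](mulfK (lt0r_neq0 x0)) -mulrBl normrM [X in _ * X]gtr0_norm ?invr_gt0//.
rewrite -[leRHS]mul1r ler_pM2r ?invr_gt0// [t * _]mulrC.
have := floor_itv (x * t); rewrite rmorphD /= => /andP[h1 h2].
by rewrite ger0_norm; lra.
Qed.

Lemma floor_matrix_cvg (T : 'M[R]_d) (L : R) : 0 < L ->
  \det (\matrix_(i, j) ((Num.floor (L * n%:R * T i j))%:~R / (L * n%:R)))
    @[n --> \oo] --> \det T.
Proof.
move=> L0; apply: cvg_det => i j; apply/cvgrPdist_le => e e0.
near=> n.
have n0 : 0 < n%:R :> R by near: n; exact: nbhs_infty_gtr.
have Ln : 0 < L * n%:R by rewrite mulr_gt0.
rewrite mxE; apply: le_trans (_ : (L * n%:R)^-1 <= _).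
  exact: floor_div_approx.
rewrite -[e]invrK lef_pV2 ?posrE ?invr_gt0//.
rewrite -ler_pdivrMl// mulrC; near: n; exact: nbhs_infty_ger.
Unshelve. all: by end_near.
Qed.

Lemma exprn1D_lt (a b : R) N : 0 < a -> a < b ->
  exists2 e : R, 0 < e <= 1 & (1 + e) ^+ N * a < b.
Proof.
move=> a0 ab; have bound (e : R) : 0 <= e <= 1 -> (1 + e) ^+ N <= 1 + 3 ^+ N * e.
  move=> /andP[e0 e1]; elim: N => [|N IH]; first by rewrite !expr0 mul1r lerDl.
  have t0 : 1 <= 3 ^+ N :> R by rewrite exprn_ege1//; lra.
  rewrite exprS; apply: le_trans (_ : (1 + e) * (1 + 3 ^+ N * e) <= _).
    by rewrite ler_wpM2l//; lra.
  rewrite exprS; move: t0; move: (3 ^+ N) => t t0.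
  have : 0 <= (t - 1) * e by rewrite mulr_ge0// subr_ge0.
  have : 0 <= t * e * (1 - e) by rewrite mulr_ge0 ?subr_ge0// mulr_ge0//; lra.
  by nra.
have t0 : 0 < 3 ^+ N :> R by rewrite exprn_gt0//; lra.
pose f := (b - a) / (2 * 3 ^+ N * a).
have f0 : 0 < f by rewrite divr_gt0 ?subr_gt0// !mulr_gt0.
exists (Num.min 1 f); first by rewrite lt_min ltr01 f0 /= ge_min lexx.
have m01 : 0 <= Num.min 1 f <= 1 by rewrite le_min ler01 ltW //= ge_min lexx.
apply: le_lt_trans (ler_wpM2r (ltW a0) (bound _ m01)) _.
have mf : Num.min 1 f <= f by rewrite ge_min lexx orbT.
apply: le_lt_trans (_ : (1 + 3 ^+ N * f) * a < b).
  by rewrite ler_pM2r// lerD2l ler_pM2l.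
have -> : (1 + 3 ^+ N * f) * a = a + (b - a) / 2.
  by rewrite /f; field; rewrite !gt_eqF.
by lra.
Qed.

Lemma square_perturb (h eta y x : R) : 0 <= h <= 1 -> 0 <= eta <= 1 ->
  `|y| <= h -> `|x - y| <= eta -> x ^+ 2 <= y ^+ 2 + 3 * eta.
Proof.
move=> /andP[h0 h1] /andP[e0 e1]; rewrite !ler_norml => /andP[y1 y2] /andP[x1 x2].
have -> : x ^+ 2 = y ^+ 2 + (2 * y * (x - y) + (x - y) ^+ 2) by ring.
rewrite lerD2l; move: x1 x2; move: (x - y) => z z1 z2.
have : y * z <= eta.
  have [y0|y0] := leP 0 y.
    by apply: le_trans (_ : y * eta <= _); [rewrite ler_wpM2l|rewrite -[leRHS]mul1r ler_wpM2r//; lra].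
  by apply: le_trans (_ : - y * eta <= _); [nra|rewrite -[leRHS]mul1r ler_wpM2r//; lra].
have : z ^+ 2 <= eta by nra.
by lra.
Qed.

Variables (c : 'I_d -> 'I_d) (cK : involutive c).

(* Minkowski's theorem for products of intervals and discs, for the lattice
   spanned by the columns of q T and the vector T D.  An approximation of T by
   a multiple of an integer matrix A reduces it to counting the integer points
   of the body modulo the lattice of A. *)
Theorem minkowski_discs (T : 'M[R]_d) (q : nat) (D : 'cV[int]_d) :
    \det T != 0 -> (0 < q)%N ->
    (forall m, (0 < m < q)%N -> forall u : 'cV[int]_d, D *+ m <> u *+ q) ->
    4 ^+ #|[pred i : 'I_d | (i < c i)%N]| * `|\det T| <
      q%:R * pi ^+ #|[pred i : 'I_d | (i < c i)%N]| ->
  exists (u : 'cV[int]_d) (m : int), let z := u *+ q + D *~ m in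
    let y := T *m map_mx intr z in
    [/\ z != 0, forall i, c i = i -> `|y i 0| < q%:R &
        forall i, c i != i -> y i 0 ^+ 2 + y (c i) 0 ^+ 2 < q%:R ^+ 2].
Proof.
move=> dT q0 hD; have cI := card_index cK; rewrite !card_sig in cI.
set s := #|[pred i : 'I_d | (i < c i)%N]| in cI *; set r := #|_| in cI.
move=> hvol; have pi0 : 0 < pi by exact: pi_gt0.
have t0 : 0 < `|\det T| by rewrite normr_gt0.
have q0R : 0 < q%:R :> R by rewrite ltr0n.
have vol0 : 0 < 4 ^+ s * `|\det T| by rewrite mulr_gt0// exprn_gt0.
(* Of the d + s + 1 factors 1 + e, d pay for the scale L, s for the factor h lost in the disc count,
   and one for replacing det T by det (A n). *)
have [e /andP[e0 e1] he] := exprn1D_lt (d + s).+1 vol0 hvol.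
have e10 : 0 < 1 + e by rewrite addr_gt0.
pose h := (1 + e)^-1.
have h0 : 0 < h by rewrite invr_gt0.
have h1 : h < 1 by rewrite invf_lt1// ltrDl.
have hh1 : h ^+ 2 < 1 by rewrite expr_lt1// ltW.
(* Each of the two squared coordinates of a disc may grow by 3 eta, in total by at most (1 - h^2) /
   2. *)
pose eta := Num.min 1 ((1 - h ^+ 2) / 12).
have eta0 : 0 < eta by rewrite lt_min ltr01 divr_gt0// subr_gt0.
have eta1 : eta <= 1 by rewrite ge_min lexx.
have eta2 : eta <= (1 - h ^+ 2) / 12 by rewrite ge_min lexx orbT.
have [M1 M10 hM1] := perturbed_image dT eta0.
(* With this scale q L n = 2 (1 + e) n, so differences of body points, of size at most 2 n, shrink
   to size at most h = 1 / (1 + e). *)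
pose L := 2 * (1 + e) / q%:R.
have L0 : 0 < L by rewrite divr_gt0// mulr_gt0.
pose A0 n : 'M[int]_d := \matrix_(i, j) Num.floor (L * n%:R * T i j).
pose A n : 'M[R]_d := \matrix_(i, j) ((A0 n i j)%:~R / (L * n%:R)).
have cvgA : \det (A n) @[n --> \oo] --> \det T.
  rewrite (_ : (fun n => \det (A n)) = fun n => \det (\matrix_(i, j)
    ((Num.floor (L * n%:R * T i j))%:~R / (L * n%:R)))); first exact: floor_matrix_cvg.
  by apply/funext => n; congr (\det _); apply/matrixP => i j; rewrite !mxE.
(* The third condition lets pi (1 - h) n^2 absorb the error 8 n of four quarter discs. *)
have [n [n0 nM n8 nA]] : exists n : nat, [/\ (0 < n)%N, M1 <= L * n%:R,
    8 <= (pi - pi * h) * n%:R & `|\det T - \det (A n)| < e * `|\det T|].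
  have near1 : \forall n \near \oo, (0 < n)%N by exact: nbhs_infty_gt.
  have near2 : \forall n \near \oo, M1 / L <= n%:R by exact: nbhs_infty_ger.
  have near3 : \forall n \near \oo, 8 / (pi - pi * h) <= n%:R by exact: nbhs_infty_ger.
  have near4 : \forall n \near \oo, `|\det T - \det (A n)| < e * `|\det T|.
    by move/cvgrPdist_lt : cvgA; apply; rewrite mulr_gt0.
  have pp : 0 < pi - pi * h by rewrite subr_gt0 -[ltRHS]mulr1 ltr_pM2l.
  near \oo => n; exists n; split.
  - by near: n.
  - by rewrite mulrC -ler_pdivrMr//; near: n.
  - by rewrite mulrC -ler_pdivrMr//; near: n.
  - by near: n.
have n0R : 0 < n%:R :> R by rewrite ltr0n.
have Ln0 : 0 < L * n%:R by rewrite mulr_gt0.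
have A0E : map_mx intr (A0 n) = (L * n%:R) *: A n.
  by apply/matrixP => i j; rewrite !mxE [RHS]mulrC divfK// gt_eqF.
have detA0 : (\det (A0 n))%:~R = (L * n%:R) ^+ d * \det (A n) :> R.
  by rewrite -detZ -A0E det_map_mx.
have detA_le : `|\det (A n)| <= (1 + e) * `|\det T|.
  by have := lerB_dist (\det (A n)) (\det T); rewrite distrC; move: nA; lra.
have detA_neq0 : \det (A n) != 0.
  apply: contraTneq nA => ->; rewrite subr0 -leNgt -[leRHS]mul1r.
  by rewrite ler_pM2r.
have dA0 : \det (A0 n) != 0.
  by rewrite -(intr_eq0 R) detA0 mulf_neq0// expf_neq0// gt_eqF.
have count : (q ^ d * `|\det (A0 n)| <
    n.*2.+1 ^ r * (4 * #|@quarter_disc n|) ^ s * q)%N.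
  rewrite -(ltr_nat R) !natrM !natrX natr_absz intr_norm detA0 normrM normrX.
  rewrite (gtr0_norm Ln0).
  have Q : pi * h * n%:R ^+ 2 <= (4 * #|@quarter_disc n|)%:R.
    have := @card_quarter_disc R n n0; rewrite natrM.
    have : 0 <= ((pi - pi * h) * n%:R - 8) * n%:R by rewrite mulr_ge0 ?subr_ge0// ltW.
    by move: (#|_|%:R) => x; rewrite expr2; lra.
  have N2 : 2 * n%:R <= n.*2.+1%:R :> R by rewrite -natrM mul2n ler_nat.
  apply: lt_le_trans (_ : (2 * n%:R) ^+ r * (pi * h * n%:R ^+ 2) ^+ s * q%:R <= _); last first.
    rewrite ler_pM2r// ler_pM ?exprn_ge0 ?mulr_ge0 ?sqr_ge0 ?(ltW n0R) ?(ltW pi0) ?(ltW h0)//.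
      by rewrite lerXn2r ?nnegrE// mulr_ge0.
    by rewrite lerXn2r ?nnegrE ?mulr_ge0 ?sqr_ge0 ?(ltW pi0) ?(ltW h0).
  rewrite mulrA -exprMn.
  have -> : q%:R * (L * n%:R) = 2 * (1 + e) * n%:R.
    by rewrite /L; field; rewrite gt_eqF.
  apply: le_lt_trans (ler_wpM2l _ detA_le) _.
    by rewrite exprn_ge0// !mulr_ge0// ltW.
  have expd (x : R) : x ^+ d = x ^+ r * (x ^+ s * x ^+ s) by rewrite -cI -addnn !exprD.
  rewrite expd; have -> : (2 * (1 + e) * n%:R) ^+ r *
     ((2 * (1 + e) * n%:R) ^+ s * (2 * (1 + e) * n%:R) ^+ s) *
     ((1 + e) * `|\det T|) =
     (2 * n%:R) ^+ r * (n%:R ^+ 2 * h) ^+ s * ((1 + e) ^+ (d + s).+1 * (4 ^+ s * `|\det T|)).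
    have hs : h ^+ s * (1 + e) ^+ s = 1 by rewrite -exprMn mulVf ?gt_eqF// expr1n.
    have four : 4 ^+ s = 2 ^+ s * 2 ^+ s :> R by rewrite -exprMn; congr (_ ^+ _); ring.
    have E : (1 + e) ^+ (d + s).+1 =
        (1 + e) * ((1 + e) ^+ r * ((1 + e) ^+ s * (1 + e) ^+ s) * (1 + e) ^+ s).
      by rewrite exprS exprD expd.
    rewrite E four !exprMn.
    move: hs; move: (h ^+ s) ((1 + e) ^+ s) ((1 + e) ^+ r) (2 ^+ s) (2 ^+ r) (n%:R ^+ s) (n%:R ^+ r).
    move=> a1 a2 a3 a4 a5 a6 a7 hs.
    by rewrite -[LHS]mulr1 -hs; ring.
  have -> : (2 * n%:R) ^+ r * (pi * h * n%:R ^+ 2) ^+ s * q%:R =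
     (2 * n%:R) ^+ r * (n%:R ^+ 2 * h) ^+ s * (q%:R * pi ^+ s).
    by rewrite !exprMn; ring.
  by rewrite ltr_pM2l// mulr_gt0// exprn_gt0// mulr_gt0// exprn_gt0.
rewrite /r /s -(card_sig [pred i | c i == i]) -(card_sig [pred i : 'I_d | (i < c i)%N]) in count.
have [u [m [f [g [f' [g' [z0 hz]]]]]]] := body_pigeonhole cK dA0 q0 hD count.
exists u, m; set z := u *+ q + D *~ m in z0 hz *.
pose b : 'cV[R]_d := q%:R^-1 *: map_mx intr z; pose y := A n *m b.
have zE : map_mx intr z = q%:R *: b by rewrite /b scalerA divff ?scale1r// gt_eqF.
have qLn : q%:R * (L * n%:R) = 2 * (1 + e) * n%:R.
  by rewrite /L; field; rewrite gt_eqF.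
have yE i : y i 0 = body_diff R f g f' g' i * (h / (2 * n%:R)).
  have -> : y = (q%:R * (L * n%:R))^-1 *: map_mx intr (A0 n *m z).
    rewrite map_mxM A0E -scalemxAl /y /b -scalemxAr scalerA invfM mulrAC.
    by rewrite mulfK// gt_eqF.
  rewrite hz qLn !mxE mulrC /body_diff !mxE /h; congr (_ * _).
  by field; rewrite !gt_eqF.
have n2 : 0 < 2 * n%:R :> R by rewrite mulr_gt0.
have hn0 : 0 < h / (2 * n%:R) by rewrite divr_gt0.
have yfix i : c i = i -> `|y i 0| <= h.
  move=> /(body_diff_fixed R f g f' g'); rewrite yE normrM (gtr0_norm hn0) => hb.
  apply: le_trans (ler_wpM2r (ltW hn0) hb) _.
  by rewrite mulrC divfK// gt_eqF.
have ypair i : c i != i -> y i 0 ^+ 2 + y (c i) 0 ^+ 2 <= h ^+ 2.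
  move=> /(body_diff_paired R cK f g f' g') => hb; rewrite !yE.
  rewrite ![(_ * (h / _)) ^+ 2]exprMn -mulrDl.
  apply: le_trans (ler_wpM2r _ hb) _; first exact: sqr_ge0.
  by rewrite -exprMn mulrC divfK// gt_eqF.
have yh i : `|y i 0| <= h.
  have [/yfix//|/ypair hi] := eqVneq (c i) i.
  rewrite -(ler_pXn2r (_ : (0 < 2)%N)) ?nnegrE ?(ltW h0)// real_normK ?num_real//.
  by have := sqr_ge0 (y (c i) 0); lra.
have TA i j : `|T i j - A n i j| <= (L * n%:R)^-1 by rewrite !mxE floor_div_approx.
have close i : `|(T *m b) i 0 - y i 0| <= eta.
  by apply: (hM1 (L * n%:R) (A n)) => // l; apply: le_trans (yh l) (ltW h1).
have sq i : (T *m b) i 0 ^+ 2 <= y i 0 ^+ 2 + 3 * eta.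
  by apply: (square_perturb _ _ (yh i) (close i)); rewrite ?(ltW h0) ?(ltW h1) ?(ltW eta0).
have q2 : 0 < q%:R ^+ 2 :> R by rewrite exprn_gt0.
split=> // [i /yfix yi|i /ypair yi]; rewrite zE -scalemxAr.
  rewrite mxE normrM (gtr0_norm q0R) -[ltRHS]mulr1 ltr_pM2l//.
  rewrite -(ltr_pXn2r (_ : (0 < 2)%N)) ?nnegrE// real_normK ?num_real// expr1n.
  have yi2 : y i 0 ^+ 2 <= h ^+ 2.
    by rewrite -[y i 0 ^+ 2]real_normK ?num_real// lerXn2r ?nnegrE ?(ltW h0).
  by have := sq i; lra.
have ZE j : (q%:R *: (T *m b)) j 0 = q%:R * (T *m b) j 0 by rewrite [LHS]mxE.
rewrite !ZE !exprMn -mulrDr -[ltRHS]mulr1 ltr_pM2l//.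
by have := sq i; have := sq (c i); lra.
Unshelve. all: by end_near.
Qed.

End Minkowski.

(** * Construction of an admissible element *)

Section Denominator.
Variables (R : realType) (k : fieldExtType rat).
Implicit Types (v : absval R k) (x y : k).
Local Notation n := (\dim {:k}).

(* Modulo p the prime ideal of v has finitely many classes y, and for each one
   x^e y / p is v-integral, so an integer s outside the prime ideal clears
   all its denominators away from v; then s x^e / p has a simple pole at v
   and no other pole. *)
Lemma exists_simple_pole v p e x (rho : R) : lies_over v p -> alg_integer x -> v x = rho ->
    0 < rho -> rho ^+ e.+1 = p%:R^-1 -> (forall y, v y < 1 -> v y <= rho) ->
  exists delta : k, [/\ alg_integer (p%:R * delta), ~ alg_integer delta, v delta <= rho^-1 &
    forall (w : absval R k) q, lies_over w q -> (exists y, w y != v y) -> w delta <= 1].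
Proof.
move=> vp hx vx rho0 rhoe hmax; have pp := vp.1; have p0 : 0 < p%:R :> R by rewrite ltr0n prime_gt0.
have vU := lies_over_ultrametric vp; have vpE := lies_over_p vp.
have pk0 : p%:R != 0 :> k by rewrite -(absval_gt0 v) vpE invr_gt0.
have [emb [emb_all emb_ind]] := exists_embeddings R k.
have [b [bint hb]] := exists_integral_basis emb_ind.
pose rep (c : {ffun 'I_n -> 'I_p}) : k := \sum_j (c j)%:R * b j.
have rep_int c : alg_integer (rep c).
  by apply: alg_integer_sum => j _; apply: alg_integerM => //; apply: alg_integer_nat.
have /choice[s hs] : forall c, exists s : k, [/\ alg_integer s, v s = 1 &
    v (rep c) < 1 -> alg_integer (s * (x ^+ e * rep c / p%:R))].
  move=> c; have [vr|vr] := ltP (v (rep c)) 1; last first.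
    by exists 1; split => //; [exact: (alg_integer_nat _ 1)|exact: av1].
  have [|s [h1 h2 h3]] := integral_fraction vp (x := x ^+ e * rep c / p%:R); last by exists s; split.
  rewrite !avM avV vpE invrK absvalX vx.
  apply: le_trans (_ : rho ^+ e * rho * p%:R <= _).
    by rewrite ler_pM2r// ler_pM2l ?exprn_gt0// hmax.
  by rewrite -exprSr rhoe mulVf// gt_eqF.
pose S := \prod_c s c.
have hS : alg_integer S by apply: alg_integer_prod => c _; case: (hs c).
have vS : v S = 1.
  by rewrite /S (big_morph v (avM v) (av1 v)) big1// => c _; case: (hs c).
pose delta := S * x ^+ e / p%:R.
have rho1 : rho^-1 = rho ^+ e * p%:R.
  by apply: (mulfI (lt0r_neq0 rho0)); rewrite divff ?gt_eqF// mulrA -exprS rhoe mulVf// gt_eqF.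
have vd : v delta = rho^-1.
  by rewrite /delta !avM avV vpE invrK vS mul1r absvalX vx rho1.
have rho_lt1 : rho < 1.
  rewrite ltNge; apply/negP => h; have : 1 <= p%:R^-1 :> R by rewrite -rhoe exprn_ege1.
  by rewrite leNgt invf_lt1 ?ltr1n ?prime_gt1.
have dy y : alg_integer y -> v y < 1 -> alg_integer (delta * y).
  move=> hy vy; have [a [yE _]] := hb y hy.
  have p0' : p%:Z != 0 by rewrite eqz_nat -lt0n prime_gt0.
  have cp j : (`|(a j %% p)%Z| < p)%N.
    by rewrite -ltz_nat gez0_abs ?modz_ge0// ltz_pmod// ltz_nat prime_gt0.
  pose c := [ffun j => Ordinal (cp j)].
  pose t := \sum_j ((a j %/ p)%Z)%:~R * b j.
  have ht : alg_integer t.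
    by apply: alg_integer_sum => j _; apply: alg_integerM => //; apply: alg_integer_int.
  have yc : y = rep c + p%:R * t.
    rewrite yE /rep /t mulr_sumr -big_split; apply: eq_bigr => j _ /=.
    rewrite ffunE /= {1}(divz_eq (a j) p) rmorphD rmorphM /= -pmulrn mulrDl addrC.
    have -> : `|(a j %% p)%Z|%:R = (a j %% p)%Z%:~R :> k by rewrite pmulrn gez0_abs ?modz_ge0.
    by ring.
  have vrep : v (rep c) < 1.
    have -> : rep c = y - p%:R * t by rewrite yc addrK.
    apply: (ultrametricB_lt vU) => //; rewrite avM vpE.
    apply: le_lt_trans (_ : p%:R^-1 < 1); last by rewrite invf_lt1 ?ltr1n ?prime_gt1.
    by rewrite -[leRHS]mulr1 ler_pM2l ?invr_gt0// (alg_integer_le1 vp ht).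
  (* In the first summand s_c clears the denominator; in the second the factor p of p t cancels that
     of delta. *)
  have -> : delta * y = (\prod_(c' | c' != c) s c') * (s c * (x ^+ e * rep c / p%:R)) +
      S * x ^+ e * t.
    rewrite yc /delta /S (bigD1 c)//=; field; exact: pk0.
  apply: alg_integerD; apply: alg_integerM => //.
  - by apply: alg_integer_prod => c' _; case: (hs c').
  - by case: (hs c) => _ _; apply.
  - by apply: alg_integerM => //; apply: alg_integerX.
exists delta; split.
- have -> : p%:R * delta = S * x ^+ e by rewrite /delta mulrC divfK.
  by apply: alg_integerM => //; apply: alg_integerX.
- by move=> /(alg_integer_le1 vp); rewrite vd leNgt invf_gt1 // rho_lt1.
- by rewrite vd.
- move=> w q wq [y0 wv]; rewrite leNgt; apply/negP => wd.
  (* A pole of delta at w would force w y < 1 for every y in the prime ideal of v, because delta y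
     is integral; then w = v. *)
  move/eqP: wv; apply; apply/esym; apply: (prime_ideal_inj vp wq) => y hy vy.
  have := alg_integer_le1 wq (dy y hy vy); rewrite avM => h.
  rewrite ltNge; apply/negP => wy; have : 1 < w delta * w y.
    by rewrite (lt_le_trans wd)// -[leLHS]mulr1 ler_pM2l// (lt_trans _ wd).
  by rewrite ltNge h.
Qed.

End Denominator.

(** * The order of a sum of simple poles modulo the integers *)

Section SimplePoles.
Variables (k : fieldExtType rat) (P : {fset nat}) (delta : nat -> k).
Hypotheses (P_prime : forall p, p \in P -> prime p).
Hypothesis p_delta : forall p, p \in P -> alg_integer (p%:R * delta p).
Hypothesis delta_nint : forall p, p \in P -> ~ alg_integer (delta p).
Local Notation q := (\prod_(p <- P) p)%N.

Lemma primes_prod_dvd (s : seq nat) m : uniq s -> {in s, forall p, prime p} ->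
  {in s, forall p, p %| m}%N -> (\prod_(p <- s) p %| m)%N.
Proof.
elim: s => [|p s IH] /=; first by rewrite big_nil dvd1n.
move=> /andP[ps us] hp hd; rewrite big_cons Gauss_dvd.
  rewrite hd ?mem_head// IH// => p' p's; [apply: hp|apply: hd]; by rewrite inE p's orbT.
have pp : prime p by apply: hp; rewrite mem_head.
have : {in s, forall p', coprime p p'}.
  move=> p' p's; have pp' : prime p' by apply: hp; rewrite inE p's orbT.
  by rewrite prime_coprime// dvdn_prime2//; apply: contraNneq ps => ->.
elim: s {IH ps us hp hd} => [|p' s IH] h; first by rewrite big_nil coprimen1.
rewrite big_cons coprimeMr h ?mem_head// IH// => p'' p''s.
by apply: h; rewrite inE p''s orbT.
Qed.

Lemma coprime_alg_integer (x : k) (a p : nat) : prime p -> ~~ (p %| a)%N ->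
  alg_integer (a%:R * x) -> alg_integer (p%:R * x) -> alg_integer x.
Proof.
move=> pp pa hax hpx; have a0 : (0 < a)%N by rewrite lt0n; apply: contraNneq pa => ->.
have : coprime a p by rewrite coprime_sym prime_coprime.
move=> /(coprimeP _ a0)[[u w] /= h].
have hu : (u * a = 1 + w * p)%N by rewrite -h subnK// ltnW// -subn_gt0 h.
have -> : x = u%:R * (a%:R * x) - w%:R * (p%:R * x).
  by rewrite !mulrA -!natrM hu natrD; ring.
by apply: alg_integerB; apply: alg_integerM => //; apply: alg_integer_nat.
Qed.

Lemma sum_poles_int : alg_integer (q%:R * \sum_(p <- P) delta p).
Proof.
rewrite mulr_sumr big_seq; apply: alg_integer_sum => p pP.
rewrite (big_rem p)//= natrM mulrAC.
by apply: alg_integerM; [exact: p_delta|exact: alg_integer_nat].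
Qed.

(** If some p in P does not divide m, multiply by the product q' of the other primes: this makes the
    other delta_p' integral while p stays prime to q' m, so delta_p would be integral. *)
Lemma sum_poles_order m : (0 < m < q)%N -> ~ alg_integer (m%:R * \sum_(p <- P) delta p).
Proof.
move=> /andP[m0 mq] h; suff : (q %| m)%N by move=> /(dvdn_leq m0); rewrite leqNgt mq.
apply: primes_prod_dvd (fset_uniq P) _ _ => // p pP; apply/negPn/negP => pm.
have pp := P_prime pP.
pose q' := (\prod_(p' <- P | p' != p) p')%N.
apply: (delta_nint pP); apply: (@coprime_alg_integer _ (q' * m) p) => //; last exact: p_delta.
  rewrite Euclid_dvdM// negb_or pm andbT /q' big_seq_cond.
  elim/big_ind: _ => [|a b pa pb|p' /andP[p'P p'p]].
  - by rewrite dvdn1; apply: contraTneq pp => ->.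
  - by rewrite Euclid_dvdM// negb_or pa.
  - by rewrite dvdn_prime2 ?P_prime// eq_sym.
have -> : (q' * m)%:R * delta p = q'%:R * (m%:R * \sum_(p <- P) delta p) -
    m%:R * \sum_(p' <- P | p' != p) q'%:R * delta p'.
  by rewrite -mulr_sumr (bigD1_seq p pP (fset_uniq P))/= natrM; ring.
apply: alg_integerB; first by apply: alg_integerM => //; apply: alg_integer_nat.
apply: alg_integerM; first exact: alg_integer_nat.
rewrite big_seq_cond; apply: alg_integer_sum => p' /andP[p'P p'p].
rewrite /q' (big_rem p')//= p'p natrM mulrAC.
by apply: alg_integerM; [exact: p_delta|exact: alg_integer_nat].
Qed.

End SimplePoles.

Section ComplexAbs.
Variable R : realType.

Lemma normc_eq0 (z : R[i]) : (Normc.normc z == 0) = (z == 0).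
Proof. by apply/eqP/eqP => [/Normc.eq0_normc//|->]; exact: Normc.normc0. Qed.

Lemma normc_ge0 (z : R[i]) : 0 <= Normc.normc z.
Proof. by case: z => a b; apply: sqrtr_ge0. Qed.

Definition complex_absval : absval R R[i] :=
  AbsVal normc_ge0 normc_eq0 (@Normc.normcM R) (@le_normcD R).

Lemma complex_absvalE z : `|z| = (complex_absval z)%:C%C.
Proof. by case: z. Qed.

Lemma complex_absval_real (a : R) : complex_absval a%:C%C = `|a|.
Proof. by rewrite /= expr0n addr0 sqrtr_sqr. Qed.

Lemma complex_absval_rat (q : rat) : complex_absval (ratr q) = `|ratr q|.
Proof. by rewrite -(fmorph_rat (real_complex R)) complex_absval_real. Qed.

Lemma complex_absval_conj z : complex_absval (conjc z) = complex_absval z.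
Proof. by case: z => a b /=; rewrite sqrrN. Qed.

Lemma complex_absval_sqr z : complex_absval z ^+ 2 = complex.Re z ^+ 2 + complex.Im z ^+ 2.
Proof. by case: z => a b /=; rewrite sqr_sqrtr// addr_ge0// sqr_ge0. Qed.

End ComplexAbs.

(** * Archimedean places and the real form of the embedding matrix *)

Section Archimedean.
Variables (R : realType) (k : fieldExtType rat).
Local Notation n := (\dim {:k}).
Variable s : 'I_n -> {rmorphism k -> R[i]}.
Hypothesis s_all : forall tau : {rmorphism k -> R[i]}, exists i, forall x, tau x = s i x.
Hypothesis s_ind : forall a : 'I_n -> R[i],
  (forall x, \sum_i a i * s i x = 0) -> forall i, a i = 0.
Local Notation N := (complex_absval R).

(* The rational coordinates of x^m are bounded linear functions of the
   conjugates of x^m, so v(x)^m = O(rho^m). *)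
Lemma archimedean_le (v : absval R k) x (rho : R) : archimedean v -> 0 < rho ->
  (forall i, N (s i x) <= rho) -> v x <= rho.
Proof.
move=> va rho0 hx.
pose w (j : 'I_n) : k := (vbasis {:k})`_j; pose W := emb_matrix s w.
have W0 : W \in unitmx by rewrite unitmxE unitfE det_emb_matrix_neq0//; apply: vbasis_spanning.
pose G := invmx W.
pose C := \sum_j (\sum_i N (G j i)) * v (w j).
apply: (@ler_of_expM R _ C _ rho0) => m; rewrite -absvalX.
have [a aE] := vbasis_spanning (x ^+ m); rewrite {1}aE.
apply: le_trans (absval_sum _ _ _ _) _; rewrite /C mulr_suml; apply: ler_sum => j _.
rewrite -[_ *: _]mulr_algl avM va [leRHS]mulrAC ler_wpM2r ?av_ge0//.
have -> : `|ratr (a j)| = N (\sum_i G j i * s i (x ^+ m)).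
  rewrite -complex_absval_rat; congr (N _).
  pose A : 'cV[R[i]]_n := \col_l ratr (a l).
  have WA : W *m A = \col_i s i (x ^+ m).
    apply/colP => i; rewrite !mxE aE rmorph_sum; apply: eq_bigr => l _ /=.
    by rewrite !mxE embeddingZ mulrC.
  have : A = G *m \col_i s i (x ^+ m) by rewrite -WA mulKmx.
  move=> /colP/(_ j); rewrite !mxE => ->; apply: eq_bigr => i _.
  by rewrite mxE.
apply: le_trans (absval_sum _ _ _ _) _; rewrite mulr_suml; apply: ler_sum => i _.
rewrite avM ler_wpM2l ?av_ge0// rmorphXn absvalX lerXn2r ?nnegrE ?av_ge0//.
exact: ltW.
Qed.

Variable c : 'I_n -> 'I_n.
Hypotheses (c_conj : forall i x, s (c i) x = conjc (s i x)) (cK : involutive c).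
Local Notation s' := #|[pred i : 'I_n | (i < c i)%N]|.

(** The Minkowski embedding in real coordinates: of a conjugate pair, the smaller index holds the
    real part and the larger one the imaginary part. *)
Definition real_emb_matrix (w : 'I_n -> k) : 'M[R]_n := \matrix_(i, j)
  if (i <= c i)%N then complex.Re (s i (w j)) else complex.Im (s i (w j)).

Lemma sum_two_deltas (C : comNzRingType) (F : 'I_n -> C) a b i i' :
  \sum_l (a * (l == i)%:R + b * (l == i')%:R) * F l = a * F i + b * F i'.
Proof.
have E x j : \sum_l x * (l == j)%:R * F l = x * F j.
  rewrite (bigD1 j)//= eqxx mulr1 big1 ?addr0// => l /negbTE ->.
  by rewrite mulr0 mul0r.
by rewrite -!E -big_split /=; apply: eq_bigr => l _; rewrite mulrDl.
Qed.

(* Re z = (z + conj z) / 2 and Im z = (- i z + i conj z) / 2. *)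
Definition emb_coef (i : 'I_n) : R[i] := if (i <= c i)%N then (2^-1)%:C%C else (0 +i* - 2^-1)%C.
Definition conj_coef (i : 'I_n) : R[i] := if (i <= c i)%N then (2^-1)%:C%C else (0 +i* 2^-1)%C.
Definition real_emb_change : 'M[R[i]]_n :=
  \matrix_(i, j) (emb_coef i * (j == i)%:R + conj_coef i * (j == c i)%:R).
(** The bilinear, not Hermitian, square of row i of [real_emb_change]; distinct rows are orthogonal
    for this form. *)
Definition gram_entry (i : 'I_n) : R := if c i == i then 1 else if (i < c i)%N then 2^-1 else - 2^-1.

Lemma real_emb_matrixE w :
  map_mx (real_complex R) (real_emb_matrix w) = real_emb_change *m emb_matrix s w.
Proof.
apply/matrixP => i j; rewrite !mxE.
under eq_bigr do rewrite mxE.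
rewrite sum_two_deltas !mxE c_conj /emb_coef /conj_coef; case: (s i (w j)) => a b /=.
by case: ifP => _; apply/eqP; rewrite eq_complex /=; apply/andP; split; apply/eqP; field.
Qed.

Lemma gram_conj_matrix :
  real_emb_change *m real_emb_change^T = map_mx (real_complex R) (diag_mx (\row_i gram_entry i)).
Proof.
apply/matrixP => i j; rewrite !mxE.
under eq_bigr do rewrite mxE [real_emb_change^T _ _]mxE.
rewrite sum_two_deltas !mxE /gram_entry.
have [->|ij] := eqVneq i j.
  rewrite !eqxx mulr1n /emb_coef /conj_coef; have [cj|cj] := eqVneq (c j) j.
    rewrite cj leqnn; apply/eqP; rewrite eq_complex /=.
    by apply/andP; split; apply/eqP; field.
  have : (j != c j :> nat) by rewrite eq_sym.
  by case: ltngtP => // _ _; apply/eqP; rewrite eq_complex /=;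
    apply/andP; split; apply/eqP; field.
rewrite (inj_eq (inv_inj cK)) (negbTE ij) mulr0n.
have [ci|ci] := eqVneq i (c j); last first.
  have -> : (c i == j) = false.
    by apply/negbTE; apply: contra ci => /eqP <-; rewrite cK.
  by rewrite !mulr0 !addr0 !mulr0 addr0.
rewrite ci cK eqxx !mulr0 !mulr1 add0r addr0 /emb_coef /conj_coef cK.
have : (j != c j :> nat) by rewrite -ci eq_sym.
by case: ltngtP => // _ _; apply/eqP; rewrite eq_complex /=;
    apply/andP; split; apply/eqP; field.
Qed.

(** Each of the 2 s' indices in pairs contributes 1/2 to the absolute value of the product of the
    Gram entries. This is the square of the covolume formula 2^(-s') sqrt|disc|. *)
Lemma det_real_emb_matrix w : \det (real_emb_matrix w) ^+ 2 * 4 ^+ s' = `|ratr (disc_rat w)|.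
Proof.
have E : \det (real_emb_matrix w) ^+ 2 = (\prod_i gram_entry i) * ratr (disc_rat w).
  apply: complexI; rewrite rmorphXn rmorphM fmorph_rat (ratr_disc_rat s_ind).
  rewrite -det_map_mx real_emb_matrixE det_mulmx exprMn; congr (_ * _).
  rewrite expr2 -{2}det_tr -det_mulmx gram_conj_matrix det_map_mx det_diag.
  by congr (real_complex _ _); apply: eq_bigr => i _; rewrite mxE.
rewrite -[\det _ ^+ 2]ger0_norm ?sqr_ge0// E normrM mulrAC -[RHS]mul1r; congr (_ * _).
rewrite normr_prod (eq_bigr (fun i => if i \in [predC [pred i | c i == i]] then 2^-1 else 1)).
  rewrite -big_mkcond /= prodr_const.
  have -> : #|[predC [pred i : 'I_n | c i == i]]| = s'.*2.
    apply/eqP; rewrite -(eqn_add2l #|[pred i : 'I_n | c i == i]|) cardC card_ord.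
    by have := card_index cK; rewrite !card_sig => ->.
  by rewrite -muln2 mulnC exprM -exprMn (_ : 2^-1 ^+ 2 * 4 = 1 :> R) ?expr1n//; field.
move=> i _; rewrite !inE /gram_entry; case: eqP => _ /=; first by rewrite normr1.
by case: ifP => _; rewrite ?normrN ger0_norm.
Qed.

(** A complex place picks an embedding with nonreal image, hence a pair i < c i; the pair determines
    the absolute value, so different places pick different pairs. *)
Lemma card_complex_places_le (t : nat) :
  ([set v : place R k | complex_place v] #= `I_t)%card -> (t <= s')%N.
Proof.
move=> /card_set_bijP[f [_ _ surj]].
have /choice[h hh] : forall i : 'I_t, exists vj : place R k * 'I_n,
    [/\ f vj.1 = i, (vj.2 < c vj.2)%N & forall x, vj.1 x = N (s vj.2 x)].
  move=> i; have [v [va [sigma [vs [x0 hx0]]]] fv] := surj i (ltn_ord i).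
  have [j hj] := s_all sigma.
  have vN x : v x = N (s j x).
    by apply: complexI; rewrite -complex_absvalE -hj; apply: vs.
  have cj : (j != c j :> nat).
    apply: contraNneq hx0 => /val_inj cj; have := c_conj j x0; rewrite -cj -hj.
    by case: (sigma x0) => a b [] /eqP; rewrite -subr_eq0 opprK -mulr2n mulrn_eq0.
  have [jc|jc|/eqP] := ltngtP j (c j); last by rewrite (negbTE cj).
    by exists (v, j).
  exists (v, c j); split=> [//||x]; first by rewrite /= cK.
  exact: etrans (vN x) (etrans (esym (complex_absval_conj _)) (congr1 N (esym (c_conj j x)))).
have inj : injective (fun i => (h i).2).
  move=> i j ij; apply: val_inj; have [fi _ h1] := hh i; have [fj _ h2] := hh j.
  by rewrite /= -fi -fj; congr f; apply: place_ext => x; rewrite h1 h2 ij.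
rewrite -[t]card_ord -(card_codom inj); apply/subset_leq_card/fintype.subsetP => _ /codomP[i ->].
by rewrite inE; case: (hh i).
Qed.

End Archimedean.

(** * A lattice element with small conjugates *)

Section SmallElement.
Variables (R : realType) (k : fieldExtType rat).
Local Notation n := (\dim {:k}).
Variable s : 'I_n -> {rmorphism k -> R[i]}.
Hypothesis s_ind : forall a : 'I_n -> R[i],
  (forall x, \sum_i a i * s i x = 0) -> forall i, a i = 0.
Variable c : 'I_n -> 'I_n.
Hypotheses (c_conj : forall i x, s (c i) x = conjc (s i x)) (cK : involutive c).
Local Notation N := (complex_absval R).
Local Notation s' := #|[pred i : 'I_n | (i < c i)%N]|.

Lemma dim_gt0 : (0 < n)%N.
Proof. exact: (adim_gt0 (aspacef k)). Qed.

(** The hypothesis raised to the power n reads (2/pi)^t sqrt|Delta| < Q, where sqrt|Delta| = 2^s'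
    |T|; since 2/pi <= 1, the exponent t may be raised to s'. *)
Lemma field_const_lt t (Q : R) (T : R) (D : rat) : (t <= s')%N -> 0 < Q ->
  T ^+ 2 * 4 ^+ s' = `|ratr D| ->
  D = (discriminant k)%:~R -> field_const R k t < Q `^ n%:R^-1 ->
  4 ^+ s' * `|T| < Q * pi ^+ s'.
Proof.
move=> ts Q0 hT DE hc; rewrite {}DE in hT; have pi0 : 0 < pi :> R by exact: pi_gt0.
have n0 : 0 <= n%:R^-1 :> R by rewrite invr_ge0.
have a0 : 0 < 2 / pi :> R by rewrite divr_gt0.
have a1 : 2 / pi <= 1 :> R by rewrite ler_pdivrMr// mul1r pi_ge2.
have sqD : `|(discriminant k)%:~R| `^ 2^-1 = 2 ^+ s' * `|T| :> R.
  rewrite powR12_sqrt// -(_ : (2 ^+ s' * `|T|) ^+ 2 = `|(discriminant k)%:~R|).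
    by rewrite sqrtr_sqr ger0_norm// mulr_ge0// exprn_ge0.
  rewrite exprMn real_normK ?num_real// mulrC -exprM mulnC exprM.
  by rewrite (_ : 2 ^+ 2 = 4 :> R) ?hT ?ratr_int//; ring.
have h : (2 / pi) ^+ t * (2 ^+ s' * `|T|) < Q.
  rewrite ltNge; apply/negP => hQ; move: hc; rewrite ltNge => /negP; apply.
  rewrite /field_const powRrM powR_mulrn ?(ltW a0)// invfM powRrM sqD -powRM.
  - by apply: ge0_ler_powR; rewrite ?nnegrE ?(ltW Q0)// ?(le_trans (ltW Q0)).
  - by rewrite exprn_ge0// ltW.
  - by rewrite mulr_ge0// exprn_ge0.
have h' : (2 / pi) ^+ s' * (2 ^+ s' * `|T|) < Q.
  apply: le_lt_trans h; rewrite ler_wpM2r ?mulr_ge0 ?exprn_ge0//.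
  by rewrite ler_wiXn2l// ltW.
rewrite -ltr_pdivrMr ?exprn_gt0//; apply: le_lt_trans h'.
have -> : 4 ^+ s' = 2 ^+ s' * 2 ^+ s' :> R by rewrite -exprMn; congr (_ ^+ _); ring.
rewrite le_eqVlt; apply/orP; left; apply/eqP; rewrite exprMn exprVn.
by move: (2 ^+ s') (pi ^+ s')^-1 => A B; ring.
Qed.

Lemma intr_lincomb_eq0 (w : 'I_n -> k) (z : 'cV[int]_n) : integral_basis w ->
  \sum_j (z j 0)%:~R * w j = 0 -> z = 0.
Proof.
move=> [_ hw] hz; have [|a [_ ha]] := hw 0; first exact: (alg_integer_nat _ 0).
have az : a = [ffun j => z j 0].
  by apply: ha; apply/esym; rewrite -[RHS]hz; apply: eq_bigr => j _; rewrite ffunE.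
have a0 : a = [ffun=> 0].
  by apply: ha; rewrite big1// => j _; rewrite ffunE mul0r.
by apply/colP => j; move/ffunP/(_ j): az; rewrite a0 !ffunE mxE.
Qed.

Lemma exists_small_element w (delta : k) (q : nat) : integral_basis w -> (0 < q)%N ->
  alg_integer (q%:R * delta) -> (forall m, (0 < m < q)%N -> ~ alg_integer (m%:R * delta)) ->
  4 ^+ s' * `|\det (real_emb_matrix s c w)| < q%:R * pi ^+ s' ->
  exists (u : k) (m : int), let alpha := u + m%:~R * delta in
    [/\ alg_integer u, alpha != 0 & forall i, N (s i alpha) < 1].
Proof.
move=> hw q0 hq hm hvol; have [a [aE _]] := hw.2 _ hq.
have s'0 : 0 < 4 ^+ s' :> R by rewrite exprn_gt0.
pose D : 'cV[int]_n := \col_j a j.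
have q0R : 0 < q%:R :> R by rewrite ltr0n.
have qk0 : q%:R != 0 :> k by rewrite -natr_alg -in_algE fmorph_eq0 pnatr_eq0 -lt0n.
have dT : \det (real_emb_matrix s c w) != 0.
  apply/eqP => T0; have := det_real_emb_matrix s_ind c_conj cK w.
  rewrite T0 expr0n mul0r => /esym/eqP; rewrite normr_eq0 fmorph_eq0 => /eqP D0.
  have := ratr_disc_rat s_ind w; rewrite D0 rmorph0 => /esym/eqP.
  by rewrite expf_eq0 /= (negbTE (integral_basis_det s_ind hw)).
(* As q delta has coordinates D, the vectors z q + D b are the coordinates of q times the elements
   of O_k + Z delta. Multiplying the lattice by q keeps it integral. *)
have coord (z : 'cV[int]_n) (b : int) : \sum_j ((z *+ q + D *~ b) j 0)%:~R * w j =
    q%:R * (\sum_j (z j 0)%:~R * w j + b%:~R * delta).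
  rewrite mulrDr [_ * (b%:~R * _)]mulrCA aE !mulr_sumr -big_split /=; apply: eq_bigr => j _.
  have -> : (z *+ q + D *~ b) j 0 = z j 0 *+ q + a j * b.
    by rewrite mxE mulmxnE -scaler_int !mxE intz mulrC.
  by rewrite rmorphD rmorphMn rmorphM /= -mulr_natl; ring.
have hD m : (0 < m < q)%N -> forall u : 'cV[int]_n, D *+ m <> u *+ q.
  move=> hmq u uE; apply: (hm m hmq); have := coord (- u) m%:Z.
  rewrite -pmulrn uE mulNrn addNr big1 => [|j _]; last by rewrite mxE mul0r.
  move=> /esym/eqP; rewrite mulf_eq0 (negbTE qk0) /= addr_eq0 => /eqP h.
  have -> : m%:R * delta = - \sum_j ((- u) j 0)%:~R * w j by rewrite h opprK.
  rewrite -sub0r; apply: alg_integerB; first exact: (alg_integer_nat _ 0).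
  apply: alg_integer_sum => j _; apply: alg_integerM; first exact: alg_integer_int.
  exact: hw.1.
have [u [m [z0 yfix ypair]]] := minkowski_discs cK dT q0 hD hvol.
set z := _ + _ in z0 yfix ypair; set y := _ *m _ in yfix ypair.
exists (\sum_j (u j 0)%:~R * w j), m; set alpha := _ + _.
have zE : \sum_j (z j 0)%:~R * w j = q%:R * alpha by exact: coord.
split.
- apply: alg_integer_sum => j _; apply: alg_integerM; first exact: alg_integer_int.
  exact: hw.1.
- apply: contraNneq z0 => a0; apply/eqP; apply: (intr_lincomb_eq0 hw).
  by rewrite zE a0 mulr0.
have yE i : y i 0 = if (i <= c i)%N then complex.Re (s i (q%:R * alpha))
    else complex.Im (s i (q%:R * alpha)).
  rewrite -zE rmorph_sum /= mxE.
  have S (f : {additive R[i] -> R}) :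
      f (\sum_j s i ((z j 0)%:~R * w j)) = \sum_j f (s i (w j)) * (z j 0)%:~R.
    rewrite raddf_sum; apply: eq_bigr => j _.
    by rewrite rmorphM rmorph_int mulrzl raddfMz mulrzr.
  case: ifP => ic.
    rewrite (S [the {additive R[i] -> R} of (@complex.Re R)]); apply: eq_bigr => j _; by rewrite !mxE ic.
  rewrite (S [the {additive R[i] -> R} of (@complex.Im R)]); apply: eq_bigr => j _; by rewrite !mxE ic.
have Nq i : N (s i (q%:R * alpha)) = q%:R * N (s i alpha).
  by rewrite rmorphM rmorph_nat avM -(rmorph_nat (real_complex R)) complex_absval_real ger0_norm.
have conjE i x : complex.Re (s (c i) x) = complex.Re (s i x) /\
    complex.Im (s (c i) x) = - complex.Im (s i x).
  by rewrite c_conj; case: (s i x).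
have lt i : N (s i (q%:R * alpha)) ^+ 2 < q%:R ^+ 2.
  rewrite complex_absval_sqr.
  have [ci|ci] := eqVneq (c i) i.
    have := yfix i ci; rewrite yE ci leqnn => h.
    have [_] := conjE i (q%:R * alpha); rewrite ci => /eqP.
    rewrite -subr_eq0 opprK -mulr2n mulrn_eq0 => /eqP ->.
    by rewrite expr0n addr0 -[_ ^+ 2]real_normK ?num_real// ltrXn2r ?nnegrE.
  have := ypair i ci; have [h1 h2] := conjE i (q%:R * alpha).
  rewrite !yE cK h1 h2; have : (i != c i :> nat) by rewrite eq_sym.
  by case: ltngtP => // _ _; rewrite ?sqrrN// addrC.
move=> i; rewrite -(ltr_pM2l q0R) mulr1 -Nq.
by have := lt i; rewrite ltr_pXn2r ?nnegrE ?av_ge0// ltW.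
Qed.

End SmallElement.

Section NormalizedAbs.
Variables (R : realType) (k : fieldExtType rat).
Implicit Types (v : place R k) (x : k).
Local Notation n := (\dim {:k}).

Lemma ler_powR2r (a b r : R) : 0 < r -> 0 <= a -> 0 <= b -> (a `^ r <= b `^ r) = (a <= b).
Proof.
move=> r0 a0 b0; have [ab|ba] := leP a b; first by rewrite ge0_ler_powR ?nnegrE// ltW.
by apply/negbTE; rewrite -ltNge gt0_ltr_powR ?nnegrE.
Qed.

Lemma ltr_powR2r (a b r : R) : 0 < r -> 0 <= a -> 0 <= b -> (a `^ r < b `^ r) = (a < b).
Proof. by move=> r0 a0 b0; rewrite !ltNge ler_powR2r. Qed.

Lemma local_exponent_gt0 v : 0 < (local_degree v)%:R / n%:R :> R.
Proof. by rewrite divr_gt0// ltr0n ?local_degree_gt0// dim_gt0. Qed.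

Lemma abs_placeE v x : abs_place v x = v x `^ ((local_degree v)%:R / n%:R).
Proof. by rewrite /abs_place /abs_compl comp_embE. Qed.

Lemma abs_place_lt1 v x : (abs_place v x < 1) = (v x < 1).
Proof.
rewrite abs_placeE; have := ltr_powR2r (local_exponent_gt0 v) (av_ge0 v x) ler01.
by rewrite powR1.
Qed.

Lemma abs_place_le1 v x : (abs_place v x <= 1) = (v x <= 1).
Proof.
rewrite abs_placeE; have := ler_powR2r (local_exponent_gt0 v) (av_ge0 v x) ler01.
by rewrite powR1.
Qed.

Lemma powRV (a r : R) : 0 <= a -> (a `^ r)^-1 = a^-1 `^ r.
Proof. by move=> a0; rewrite -[LHS]powR_inv1 ?powR_ge0// -powRrM mulrC powRrM powR_inv1. Qed.

Lemma abs_place_le_unif v x (pi : compl v) :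
  (abs_place v x <= (abs_compl pi)^-1) = (v x <= (comp_av (compl v) pi)^-1).
Proof.
have N0 : 0 <= comp_av (compl v) pi by exact: av_ge0.
by rewrite abs_placeE powRV// ler_powR2r ?av_ge0 ?invr_ge0// local_exponent_gt0.
Qed.

End NormalizedAbs.

(** * Existence of an admissible element *)

Section Existence.
Variables (R : realType) (k : fieldExtType rat) (t : nat).
Hypothesis ht : ([set v : place R k | complex_place v] #= `I_t)%card.
Variables (P : {fset nat}) (S : set (place R k)).
Hypothesis P_prime : forall p, p \in P -> prime p.
Hypothesis S_over : forall v, S v ->
  (exists2 p, p \in P & lies_over v p) /\ residue_degree v = 1%N.
Hypothesis S_unique : forall p, p \in P -> exists! v : place R k, S v /\ lies_over v p.
Hypothesis hc : field_const R k t < (\prod_(p <- P) p%:R) `^ (\dim {:k})%:R^-1.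
Variable pi_ : forall v : place R k, compl v.
Hypothesis pi_unif : forall v, S v -> uniformizer (pi_ v).

Lemma exists_admissible : exists alpha : k, admissible S pi_ alpha.
Proof.
have [s [s_all s_ind]] := exists_embeddings R k.
have [c [c_conj cK]] := conj_embedding s_all s_ind.
have /choice[delta hd] : forall p, exists delta : k, p \in P -> exists v : place R k,
   [/\ S v, lies_over v p & [/\ alg_integer (p%:R * delta), ~ alg_integer delta,
      v delta <= (comp_av (compl v) (pi_ v))^-1 &
    forall (w : absval R k) q, lies_over w q -> (exists y, w y != v y) -> w delta <= 1]].
  move=> p; have [pP|pP] := boolP (p \in P); last by exists 0.
  have [v [[Sv vp] _]] := S_unique pP; have [_ f1] := S_over Sv.
  have U := pi_unif Sv.
  have [[|e] [e0 _ he]] := local_degree_ramification vp f1 U; first by [].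
  have [x hx vx] := integer_unif vp U.
  have [dl hdl] := exists_simple_pole vp hx vx (unif_gt0 vp U) he (unif_max U).
  by exists dl => _; exists v.
pose q := (\prod_(p <- P) p)%N; pose D := \sum_(p <- P) delta p.
have q0 : (0 < q)%N by rewrite /q big_seq prodn_cond_gt0// => p /P_prime/prime_gt0.
have p_delta p : p \in P -> alg_integer (p%:R * delta p).
  by move=> /hd[v [_ _ []]].
have delta_nint p : p \in P -> ~ alg_integer (delta p).
  by move=> /hd[v [_ _ []]].
have [w hw disc] := discriminantP s_ind.
have Q0 : 0 < q%:R :> R by rewrite ltr0n.
have hq := hc; rewrite (_ : \prod_(p <- P) p%:R = q%:R) in hq; last by rewrite /q natr_prod.
have vol := field_const_lt (card_complex_places_le s_all c_conj cK ht) Q0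
  (det_real_emb_matrix s_ind c_conj cK w) (esym disc) hq.
have hm m := @sum_poles_order k P delta P_prime p_delta delta_nint m.
have [u [m]] := exists_small_element s_ind c_conj cK hw q0 (sum_poles_int p_delta) hm vol.
set alpha := _ + _ => -[hu a0 a1]; exists alpha; split=> //.
- move=> v va; rewrite abs_place_lt1.
  (* Strictness survives because there are finitely many conjugates; the default 1/2 makes the bound
     positive, as [archimedean_le] requires. *)
  pose rho := \big[Num.max/2^-1]_i complex_absval R (s i alpha).
  have rho1 : rho < 1 by apply: bigmax_lt => //; rewrite invf_lt1 ?ltr1n.
  apply: le_lt_trans rho1; apply: (archimedean_le s_ind va).
    by apply: lt_le_trans (bigmax_ge_id _ _ _ _); rewrite invr_gt0.
  by move=> i; apply: le_bigmax.
- move=> v [p vp] nS; rewrite abs_place_le1.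
  have U := lies_over_ultrametric vp.
  apply: le_trans (U _ _) _; rewrite ge_max (alg_integer_le1 vp hu) avM.
  rewrite mulr_ile1 ?av_ge0 ?(lies_over_int_le1 _ vp)//.
  rewrite big_seq; apply: (ultrametric_sum U) => [|p' p'P]; first exact: ler01.
  have [v' [Sv' _ [_ _ _ h]]] := hd _ p'P; apply: h vp _.
  apply: contrapT => /forallNP h; apply: nS; suff -> : v = v' by [].
  by apply: place_ext => x; apply/eqP/negPn/negP/h.
- move=> v Sv; rewrite abs_place_le_unif.
  have [[p pP vp] _] := S_over Sv; have Uf := pi_unif Sv.
  have U := lies_over_ultrametric vp.
  have rho1 : 1 <= (comp_av (compl v) (pi_ v))^-1.
    by rewrite ltW// invf_gt1 ?(unif_lt1 Uf)// (unif_gt0 vp Uf).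
  apply: le_trans (U _ _) _; rewrite ge_max (le_trans (alg_integer_le1 vp hu))// avM.
  rewrite /=; apply: le_trans (_ : 1 * v (\sum_(p' <- P) delta p') <= _).
    by rewrite ler_wpM2r ?av_ge0// (lies_over_int_le1 _ vp).
  rewrite mul1r big_seq; apply: (ultrametric_sum U) => [|p' p'P]; first exact: le_trans ler01 rho1.
  have [v' [Sv' v'p [_ _ h1 h2]]] := hd _ p'P.
  have [<-//|vv'] := pselect (v' = v).
  apply: le_trans rho1; apply: h2 vp _; apply: contrapT => /forallNP h; apply: vv'.
  by apply/esym/place_ext => x; apply/eqP/negPn/negP/h.
Qed.

End Existence.

(** * Properties of admissible elements *)

Lemma irreducible_divisor (F : fieldType) (g : {poly F}) : (1 < size g)%N ->
  exists2 h, irreducible_poly h & h %| g.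
Proof.
have [m] := ubnP (size g); elim: m g => // m IH g; rewrite ltnS => gm g1.
have [irr|nirr] := pselect (irreducible_poly g); first by exists g => //; apply: dvdpp.
have [q [q1 qg nq]] : exists q : {poly F}, [/\ size q != 1%N, q %| g & ~~ (q %= g)].
  apply: contrapT => /forallNP h; apply: nirr; split=> // q q1 qg.
  by apply/negPn/negP => nq; apply: (h q); split.
have g0 : g != 0 by rewrite -size_poly_eq0; apply: contraTneq g1 => ->.
have qg' : (size q < size g)%N.
  by rewrite ltn_neqAle dvdp_leq// andbT dvdp_size_eqp.
have q0 : q != 0 by apply: contraNneq g0 => q0; rewrite q0 dvd0p in qg.
have [|h irr hq] := IH q (leq_trans qg' gm); last by exists h => //; apply: dvdp_trans hq qg.
by rewrite ltn_neqAle eq_sym q1 size_poly_gt0.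
Qed.

Section PullBack.
Variables (R : realType) (K E : fieldType) (f : {rmorphism K -> E}) (v : absval R E).

Lemma absval_comp_eq0 x : (v (f x) == 0) = (x == 0).
Proof. by rewrite av_eq0 fmorph_eq0. Qed.

Lemma absval_compM x y : v (f (x * y)) = v (f x) * v (f y).
Proof. by rewrite rmorphM avM. Qed.

Lemma absval_compD x y : v (f (x + y)) <= v (f x) + v (f y).
Proof. by rewrite rmorphD av_triangle. Qed.

Definition absval_comp : absval R K :=
  AbsVal (fun x => av_ge0 v (f x)) absval_comp_eq0 absval_compM absval_compD.

End PullBack.

(** * Large absolute values and dense subfields *)

Section PlacesOfElement.
Variables (R : realType) (k : fieldExtType rat).
Implicit Types (v : absval R k) (x y : k).
Local Notation n := (\dim {:k}).

Lemma ratr_normM (q1 q2 : rat) : `|ratr (q1 * q2)| = `|ratr q1| * `|ratr q2| :> R.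
Proof. by rewrite rmorphM normrM. Qed.

Lemma ratr_normD (q1 q2 : rat) : `|ratr (q1 + q2)| <= `|ratr q1| + `|ratr q2| :> R.
Proof. by rewrite rmorphD ler_normD. Qed.

Lemma ratr_norm_eq0 (q : rat) : (`|ratr q| == 0 :> R) = (q == 0).
Proof. by rewrite normr_eq0 fmorph_eq0. Qed.

Definition ratr_absval : absval R rat :=
  AbsVal (fun q => normr_ge0 (ratr q)) ratr_norm_eq0 ratr_normM ratr_normD.

(* The extension theorem realizes the spectral norm of x, which bounds the
   norm of x to Q; a norm of absolute value < 1 that is nonzero has a p in
   its denominator. *)
Lemma exists_place_gt1 x : x != 0 -> (forall v, archimedean v -> v x < 1) ->
  exists v p, lies_over v p /\ 1 < v x.
Proof.
move=> x0 hx; pose D := \det (mul_matrix x : 'M[rat]_n).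
have D0 : D != 0 by apply: det_mul_matrix_neq0.
have D1 : `|ratr D| < 1 :> R.
  have [v [va vx]] := absval_extension (E := k) ratr_absval x.
  have := hx v va; rewrite vx; set rho := spectral_norm _ x => rho1.
  have rho0 : 0 <= rho by rewrite /rho -vx av_ge0.
  have r0 : 0 < (rho + 1) / 2 by lra.
  have rr : rho < (rho + 1) / 2 by lra.
  apply: le_lt_trans (absval_det_mul_matrix r0 rr) _.
  by rewrite exprn_ilt1 ?(ltW r0) ?dim_gt0//; [rewrite -lt0n dim_gt0|lra].
have [p pp hp] : exists2 p, prime p & 1 < padic_abs R p D.
  apply: contrapT => h; have [|a aE] := @rat_int_of_padic R D.
    by move=> p pp; rewrite leNgt; apply/negP => hp; apply: h; exists p.
  move: D1; rewrite aE ratr_int -intr_norm -[1]/(1%:~R) ltr_int => a1.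
  move: D0; rewrite aE intr_eq0; move: a1; case: a {aE} => [[|m]|m] //.
have [v [vp vx]] := absval_extension (E := k) (padic_absval R pp) x.
exists v, p; split; first by split.
rewrite ltNge; apply/negP => v1.
(* The determinant bound asks for a radius strictly above v x; 1 + e is one whose n-th power is
   still below |D|_p. *)
have [e /andP[e0 _] he] := exprn1D_lt n ltr01 hp.
have := absval_det_mul_matrix (w := padic_absval R pp) (y := x) (r := 1 + e).
rewrite -vx => /(_ (addr_gt0 ltr01 e0)) h.
have /h : v x < 1 + e by rewrite (le_lt_trans v1)// ltrDl.
by rewrite leNgt; rewrite mulr1 in he; rewrite he.
Qed.

(** Expansions in powers of b with natural digits stay in F, since F contains b and the digits. A
    power of b first brings y into the unit ball. *)
Lemma dense_subfield (F : {subfield k}) v p (b : k) : lies_over v p ->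
    (forall y, v y <= 1 -> exists m : nat, v (y - m%:R) < 1) ->
    b \in F -> b != 0 -> v b < 1 -> (forall y, v y < 1 -> v y <= v b) ->
  forall y (e : R), 0 < e -> exists2 z, z \in F & v (y - z) < e.
Proof.
move=> vp res bF b0 b1 bmax y e e0; have vb0 : 0 < v b by rewrite absval_gt0.
have approx m u : v u <= 1 -> exists2 z, z \in F & v (u - z) <= v b ^+ m.
  elim: m u => [|m IH] u u1; first by exists 0; rewrite ?mem0v// subr0.
  have [j hj] := res u u1; have [|z zF hz] := IH ((u - j%:R) / b).
    by rewrite avM avV ler_pdivrMr// mul1r bmax.
  exists (j%:R + b * z); first by rewrite rpredD ?rpred_nat// rpredM.
  have -> : u - (j%:R + b * z) = b * ((u - j%:R) / b - z) by field.
  by rewrite avM exprS ler_pM2l.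
have vbr : 0 < v b < 1 by rewrite vb0.
have [i hi] : exists i, v (b ^+ i * y) <= 1.
  have [y0|y0] := eqVneq y 0; first by exists 0%N; rewrite y0 mulr0 av0.
  have vy0 : 0 < v y by rewrite absval_gt0.
  have [|i hi] := exprn_small vbr (_ : 0 < (v y)^-1); first by rewrite invr_gt0.
  exists i; rewrite avM absvalX -ler_pdivlMr// mul1r; exact: ltW.
have bi0 : 0 < v b ^+ i by rewrite exprn_gt0.
have [m hm] := exprn_small vbr (mulr_gt0 e0 bi0).
have [z zF hz] := approx m _ hi.
exists (z / b ^+ i); first by rewrite rpredM// rpredV rpredX.
have -> : y - z / b ^+ i = (b ^+ i * y - z) / b ^+ i by field; rewrite expf_neq0.
by rewrite avM avV absvalX ltr_pdivrMr// (le_lt_trans hz).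
Qed.

(* If the primitive element t had a conjugate t' over F other than t, then v
   would have another extension from F to k, by embedding t to t'. *)
Lemma dense_subfield_full (F : {subfield k}) v p : lies_over v p ->
    (forall y (e : R), 0 < e -> exists2 z, z \in F & v (y - z) < e) ->
    (forall w : absval R k, lies_over w p -> {in F, forall z, w z = v z} -> forall y, w y = v y) ->
  F = {:k}%VS :> {vspace k}.
Proof.
move=> vp dense uniq; have [t ft] := exists_primitive k.
suff tF : t \in F by apply/eqP; rewrite eqEsubv subvf -ft; apply/FadjoinP; rewrite sub1v.
rewrite -adjoin_deg_eq1; apply/negPn/negP => deg.
have rt : root (minPoly F t) t by apply: root_minPoly.
have [g gE] := factor_theorem _ _ rt.
have sep : separable_poly (minPoly F t).
  apply: pcharf0_separable => q; rewrite !inE; apply/negP => /andP[q_pr].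
  by rewrite -natr_alg -in_algE fmorph_eq0 pnatr_eq0 => /eqP q0; rewrite q0 in q_pr.
(* t is a simple root of its minimal polynomial, so the roots of the cofactor g differ from t. *)
move: sep; rewrite gE separable_root => /andP[_ gt].
have g0 : g != 0 by apply: contraNneq gt => ->; rewrite root0.
have g1 : (1 < size g)%N.
  have := size_minPoly F t; rewrite gE size_Mmonic ?monicXsubC// size_XsubC addn2 => -[sg].
  by rewrite ltn_neqAle eq_sym sg deg -sg size_poly_gt0.
have [h irr hg] := irreducible_divisor g1.
have [E _ [t' t'h _]] := irredp_FAdjoin irr.
have gt' : root (map_poly (in_alg E) g) t'.
  by move: hg => /dvdpP[g' ->]; rewrite rmorphM /= rootM t'h orbT.
have tt' : t' != t%:A.
  by apply: contraNneq gt => t'E; move: gt'; rewrite t'E -in_algE fmorph_root.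
pose j : {rmorphism subvs_of F -> k} := vsval.
pose i : {rmorphism subvs_of F -> E} := (in_alg E) \o j.
have [|q q0|tau [taut tauF]] := @rmorphism_adjoin _ _ _ j i t t'.
- move=> x; have : x \in <<F; t>>%VS.
    by have := memvf x; rewrite -ft; apply: subvP; rewrite adjoinSl ?sub1v.
  by move=> /Fadjoin_polyP[q /polyOver_subvs[q' ->] ->]; exists q'.
- have : minPoly F t %| map_poly j q.
    by apply: minPoly_dvdp; [apply/polyOver_subvs; exists q|apply/rootP].
  rewrite gE => /dvdpP[q' qE]; rewrite map_poly_comp qE !rmorphM /= hornerM hornerM.
  by move/rootP: gt' => ->; rewrite mul0r mulr0.
have tauz z : z \in F -> tau z = z%:A.
  by move=> zF; have := tauF (vsproj F z); rewrite /i /= !vsprojK.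
have [v' [v'v _]] := absval_extension (E := E) v 1.
pose w := absval_comp tau v'.
have wF : {in F, forall z, w z = v z} by move=> z zF; rewrite /= tauz.
have wp : lies_over w p.
  split; first exact: vp.1.
  by move=> q; rewrite wF ?vp.2// rpredZ// rpred1.
(* If w = v, an element z of F close to t is equally close to t', which forces t' = t. *)
have wv := uniq w wp wF; have e0 : 0 < v' (t' - t%:A) by rewrite absval_gt0 subr_eq0.
have [z zF hz] := dense t _ (ltac:(by rewrite divr_gt0 ?e0) : 0 < v' (t' - t%:A) / 2).
have h1 : v' (t' - z%:A) = v (t - z) by rewrite -taut -tauz// -rmorphB; apply: wv.
have h2 : v' (z%:A - t%:A) = v (t - z) by rewrite -scalerBl v'v av_distC.
by have := av_split v' z%:A t' t%:A; rewrite h1 h2; lra.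
Qed.

End PlacesOfElement.

(** * Generation and height *)

Section Admissible.
Variables (R : realType) (k : fieldExtType rat).
Local Notation n := (\dim {:k}).
Variables (P : {fset nat}) (S : set (place R k)).
Hypothesis S_over : forall v, S v ->
  (exists2 p, p \in P & lies_over v p) /\ residue_degree v = 1%N.
Hypothesis S_unique : forall p, p \in P -> exists! v : place R k, S v /\ lies_over v p.
Variable pi_ : forall v : place R k, compl v.
Hypothesis pi_unif : forall v, S v -> uniformizer (pi_ v).
Variable alpha : k.
Hypothesis alpha_adm : admissible S pi_ alpha.

Lemma admissible_archimedean (v : place R k) : archimedean v -> v alpha < 1.
Proof. by case: alpha_adm => _ h _ _ va; rewrite -abs_place_lt1 h. Qed.

Lemma admissible_gt1 (v : place R k) p : lies_over v p -> 1 < v alpha -> S v.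
Proof.
move=> vp v1; apply: contrapT => nS; case: alpha_adm => _ _ h _.
by have := h v (ex_intro _ p vp) nS; rewrite abs_place_le1 leNgt v1.
Qed.

Lemma admissible_generates : <<1; alpha>>%VS = {:k}%VS.
Proof.
have a0 : alpha != 0 by case: alpha_adm.
have [|v0 [p [vp v1]]] := @exists_place_gt1 R k alpha a0.
  by move=> v0 va; apply: (@admissible_archimedean (Place (or_introl va))).
pose v : place R k := Place (or_intror (ex_intro _ p vp)).
have Sv : S v by apply: (@admissible_gt1 v p).
have [[p' p'P vp'] f1] := S_over Sv.
have pP : p \in P by rewrite (lies_over_uniq vp vp').
have U := pi_unif Sv; have rho0 := unif_gt0 vp U.
have aF : alpha \in <<1; alpha>>%VS by apply: memv_adjoin.
have va : v alpha <= (comp_av (compl v) (pi_ v))^-1.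
  by rewrite -abs_place_le_unif; case: alpha_adm => _ _ _; apply.
apply: (@dense_subfield_full R k <<1; alpha>>%AS v p vp).
  (* As 1 < v alpha <= 1 / N(pi_v), no value below 1 exceeds that of alpha^-1: it is a uniformizer
     lying in Q(alpha). *)
  apply: (@dense_subfield R k _ v p alpha^-1 vp).
  - by move=> y; apply: (residue_local vp) => x; apply: (@residue_degree1 R k v p vp f1).
  - by rewrite rpredV.
  - by rewrite invr_eq0.
  - by rewrite avV invf_lt1// (lt_trans ltr01).
  - move=> y y1; apply: le_trans (unif_max U y1) _.
    by rewrite avV -[leLHS]invrK lef_pV2// ?posrE ?invr_gt0// (lt_trans ltr01).
move=> w wp wF; pose w' : place R k := Place (or_intror (ex_intro _ p wp)).
have Sw : S w' by apply: (@admissible_gt1 w' p) => //=; rewrite wF.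
have [u [_ hu]] := S_unique pP.
have wv : w' = v by rewrite -(hu w' (conj Sw wp)); apply: hu.
by move=> y; rewrite -[w]/(place_absval w') wv.
Qed.

Lemma prod_powR (s : seq nat) (r : R) :
  \prod_(p <- s) (p%:R `^ r) = (\prod_(p <- s) p%:R) `^ r.
Proof.
elim: s => [|p s IH]; first by rewrite !big_nil powR1.
by rewrite !big_cons IH powRM// prodr_ge0.
Qed.

Lemma admissible_height : height (R := R) alpha <= (\prod_(p <- P) p%:R) `^ n%:R^-1.
Proof.
(* An archimedean place, serving as the default value of g outside P. *)
have [v0 [v0a _]] := absval_extension (E := k) (ratr_absval R) 1.
have /choice[g hg] : forall p, exists v : place R k, p \in P -> S v /\ lies_over v p.
  move=> p; have [pP|_] := boolP (p \in P); last by exists (Place (or_introl v0a)).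
  by have [v [hv _]] := S_unique pP; exists v.
have max1 (v : place R k) : ~ S v -> Num.max 1 (abs_place v alpha) = 1.
  move=> nS; apply: max_l; case: alpha_adm => _ h1 h2 _.
  by case: (place_normalized v) => [va|vn]; [exact/ltW/h1|exact: h2].
(* Factors outside S equal 1, so the product runs over the places g p, which are distinct because a
   place lies over one prime. *)
rewrite /height (fsbigE (map g P)) //=; first last.
- move=> v _; apply: contraNeq => hv.
  have Sv : S v by apply: contrapT => /max1 /eqP; rewrite (negbTE hv).
  have [[p pP vp] _] := S_over Sv; apply/mapP; exists p => //.
  have [u [_ hu]] := S_unique pP; rewrite -(hu v)//.
  by apply: hu; apply: hg.
- rewrite map_inj_in_uniq ?fset_uniq// => p q pP qP gpq.
  by apply: lies_over_uniq (hg p pP).2 _; rewrite gpq; case: (hg q qP).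
rewrite (eq_bigl xpredT) => [|v]; last by rewrite in_setT.
rewrite big_map -prod_powR big_seq [leRHS]big_seq; apply: ler_prod => p pP.
rewrite (le_trans ler01) ?le_max ?lexx//= ge_max.
have [Sv vp] := hg p pP; have [_ f1] := S_over Sv.
have p1 : 1 <= p%:R `^ n%:R^-1 :> R.
  have n0 : 0 < n%:R^-1 :> R by rewrite invr_gt0 ltr0n dim_gt0.
  have := ler_powR2r n0 ler01 (ler0n R p); rewrite powR1 => ->.
  by rewrite ler1n prime_gt0// vp.1.
rewrite p1 -(abs_compl_uniformizer vp f1 (pi_unif Sv)).
by case: alpha_adm => _ _ _; apply.
Qed.

End Admissible.

Theorem theorem4p1 (R : realType) (k : fieldExtType rat) (d r s : nat)
    (hd : \dim {:k} = d)
    (hr : ([set v : place R k | real_place v] #= `I_r)%card)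
    (hs : ([set v : place R k | complex_place v] #= `I_s)%card)
    (P : {fset nat})
    (P_prime : forall p, p \in P -> prime p)
    (P_deg1 : forall p, p \in P ->
      exists v : place R k, lies_over v p /\ residue_degree v = 1%N)
    (S : set (place R k))
    (S_over : forall v, S v ->
      (exists2 p, p \in P & lies_over v p) /\ residue_degree v = 1%N)
    (S_unique : forall p, p \in P -> exists! v : place R k, S v /\ lies_over v p)
    (hc : field_const R k s < (\prod_(p <- P) p%:R) `^ d%:R^-1)
    (pi_ : forall v : place R k, compl v)
    (pi_unif : forall v, S v -> uniformizer (pi_ v)) :
  [/\ forall v p, S v -> lies_over v p ->
        (abs_compl (pi_ v))^-1 = p%:R `^ d%:R^-1,
      exists alpha : k, admissible S pi_ alpha &
      forall alpha : k, admissible S pi_ alpha ->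
        <<1; alpha>>%VS = {:k}%VS /\
        height (R := R) alpha <= (\prod_(p <- P) p%:R) `^ d%:R^-1].
Proof.
subst d; split=> [v p Sv vp||alpha h].
- by have [_ f1] := S_over v Sv; exact: (abs_compl_uniformizer vp f1 (pi_unif v Sv)).
- exact: (exists_admissible hs P_prime S_over S_unique hc pi_unif).
- split; first exact: (admissible_generates S_over S_unique pi_unif h).
  exact: (admissible_height S_over S_unique pi_unif h).
Qed.
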